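(* Let $N\ge1$ be an integer, $\alpha>0$, $\gamma>0$, $\gamma\ne N$, and $q_c=\frac{N\alpha}2$. Assume that $$\min\left[\frac{N\alpha}2,\frac{\gamma\alpha}2\right]<1 .$$ Let $\varphi\in L^q(\mathbb R^N)\cap L^q_\gamma(\mathbb R^N)$, where $q\in(1,\infty]$ and $q>q_c$. If $\gamma<N$, assume further that $$\frac1q+\frac\gamma N<1,\qquad \frac{N\alpha}{2q}+\frac{\alpha\gamma}{2}<1 .$$ Then the existence time $T_{\max}(\lambda\varphi)$ of the maximal solution in $L^q(\mathbb R^N)$ of $\partial_tu=\Delta u+|u|^\alpha u$ on $\mathbb R^N$ with $u(0)=\lambda\varphi$ satisfies $$T_{\max}(\lambda\varphi)\ \ge\ C\,\lambda^{-\left(\frac1\alpha-\frac12\min\left(\frac Nq+\gamma,\,N\right)\right)^{-1}}\qquad\text{for all }0<\lambda\le1,$$ where $C$ is a positive constant, with $C=C(\alpha,q,\gamma,N,\|\varphi\|_{L^q_\gamma\cap L^q})$ if $\gamma<N$ and $C=C(\alpha,q,\gamma,N,\|\varphi\|_{1})$ if $\gamma>N$.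
   Context: $L^q_\gamma(\mathbb R^N)$ is the space of measurable $f:\mathbb R^N\to\mathbb R$ with $|\cdot|^\gamma f\in L^q(\mathbb R^N)$, normed by $\|f\|_{L^q_\gamma}=\||\cdot|^\gamma f\|_{L^q(\mathbb R^N)}$; $\|\cdot\|_{L^q_\gamma\cap L^q}$ is the natural norm of the intersection, $\|\cdot\|_1$ the $L^1(\mathbb R^N)$ norm, and $1/q=0$ if $q=\infty$. Solutions are solutions of the integral equation $u(t)=e^{t\Delta}u_0+\int_0^te^{(t-\sigma)\Delta}[|u(\sigma)|^\alpha u(\sigma)]\,d\sigma$, $u_0=\lambda\varphi$, with $e^{t\Delta}$ the heat semigroup on $\mathbb R^N$. For $q\ge1$, $q>q_c$ it is known that there is a unique maximal solution in $C([0,T_{\max});L^q(\mathbb R^N))\cap L^\infty_{\rm loc}((0,T_{\max});L^\infty(\mathbb R^N))$ (for $q=\infty$, a unique maximal solution in $L^\infty_{\rm loc}([0,T_{\max});L^\infty(\mathbb R^N))$, with $[0,T_{\max})$ replaced by $(0,T_{\max})$ in the continuity statement); $T_{\max}(u_0)\in(0,\infty]$ is its existence time. *)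

(* Defs.v *)
From HB Require Import structures.
From mathcomp Require Import all_boot all_order all_algebra.
From mathcomp Require Import all_classical all_reals all_analysis.

Set Implicit Arguments.
Unset Strict Implicit.
Unset Printing Implicit Defensive.

Import Order.TTheory GRing.Theory Num.Theory.
Import numFieldNormedType.Exports.

Local Open Scope classical_set_scope.
Local Open Scope ring_scope.

(* R^N is [N.-tuple (measurableTypeR R)], i.e. N-tuples of reals with the
   product of the Borel sigma-algebras generated by the coordinates. *)
Notation RN R N := (N.-tuple (measurableTypeR R)).

Section LebesgueMeasureRN.
Context {R : realType}.

Definition consRN (n : nat) (z : measurableTypeR R * RN R n) : RN R n.+1 :=
  [tuple of z.1 :: z.2].

Lemma measurable_consRN (n : nat) : measurable_fun setT (@consRN n).
Proof. exact: measurable_cons. Qed.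

Section step.
Context (n : nat).
Variables (mu1 : {sigma_finite_measure set (measurableTypeR R) -> \bar R})
  (mu : {sigma_finite_measure set (RN R n) -> \bar R}).

Definition lebesgueRN_step : set (RN R n.+1) -> \bar R :=
  pushforward (mu1 \x mu)%E (@consRN n).

Let step0 : lebesgueRN_step set0 = 0%E.
Proof. by rewrite /lebesgueRN_step /pushforward preimage_set0 measure0. Qed.

Let step_ge0 A : (0 <= lebesgueRN_step A)%E.
Proof. by rewrite /lebesgueRN_step /pushforward; exact: measure_ge0. Qed.

Let step_sigma_additive : semi_sigma_additive lebesgueRN_step.
Proof.
move=> F mF tF mUF; rewrite /lebesgueRN_step /pushforward preimage_bigcup.
apply: measure_semi_sigma_additive.
- by move=> k; rewrite -[X in measurable X]setTI; exact: measurable_consRN.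
- apply/trivIsetP => /= i j _ _ ij; rewrite -preimage_setI.
  by move/trivIsetP : tF => /(_ _ _ _ _ ij) ->//; rewrite preimage_set0.
- rewrite -preimage_bigcup -[X in measurable X]setTI.
  exact: measurable_consRN.
Qed.

HB.instance Definition _ := isMeasure.Build _ _ _
  lebesgueRN_step step0 step_ge0 step_sigma_additive.

Let step_sigma_finite : sigma_finite setT lebesgueRN_step.
Proof.
have /sigma_finiteP[F [FT ndF Foo]] := sigma_finiteT mu1.
have /sigma_finiteP[G [GT ndG Goo]] := sigma_finiteT mu.
exists (fun k => [set x | F k (thead x) /\ G k [tuple of behead x]]).
  rewrite predeqE => x; split=> // _.
  have [i _ Fi] : (\bigcup_i F i) (thead x) by rewrite -FT.
  have [j _ Gj] : (\bigcup_j G j) [tuple of behead x] by rewrite -GT.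
  exists (maxn i j) => //=; split.
    by move: Fi; exact/subsetPset/ndF/leq_maxl.
  by move: Gj; exact/subsetPset/ndG/leq_maxr.
move=> k; have [mF Fkoo] := Foo k; have [mG Gkoo] := Goo k; split.
  apply: measurableI.
    rewrite -[X in measurable X]setTI.
    exact: (@measurable_tnth _ (measurableTypeR R) n.+1 ord0).
  by rewrite -[X in measurable X]setTI; exact: measurable_behead.
rewrite /lebesgueRN_step /pushforward (_ : _ @^-1` _ = F k `*` G k).
  by rewrite product_measure1E// lte_mul_pinfty// ge0_fin_numE.
apply/seteqP; split=> -[a t] /=; rewrite theadE.
  move=> [Fa Gt]; split=> //.
  by rewrite (_ : t = [tuple of behead (a :: t)])//; exact/val_inj.
by move=> [Fa Gt]; split=> //; rewrite (_ : [tuple of _] = t)//; exact/val_inj.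
Qed.

HB.instance Definition _ := Measure_isSigmaFinite.Build _ _ _
  lebesgueRN_step step_sigma_finite.

End step.

(* N-dimensional Lebesgue measure, as the N-fold product of the
   one-dimensional one; see [lebesgueRN_box]. *)
Fixpoint lebesgueRN (n : nat) : {sigma_finite_measure set (RN R n) -> \bar R} :=
  match n with
  | 0 => \d_([tuple] : RN R 0)
  | m.+1 => lebesgueRN_step (@lebesgue_measure R) (lebesgueRN m)
  end.

Lemma lebesgueRN_box (n : nat) (A : 'I_n -> set (measurableTypeR R)) :
  (forall i, measurable (A i)) ->
  lebesgueRN n [set x | forall i, A i (tnth x i)] =
  (\prod_(i < n) lebesgue_measure (A i))%E.
Proof.
elim: n A => [|n IHn] A mA.
  rewrite big_ord0 /= diracE mem_set// => -[].
  by [].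
rewrite big_ord_recl /= /lebesgueRN_step /pushforward.
rewrite -IHn; last by move=> i; exact: mA.
rewrite -product_measure1E//; last first.
  rewrite (_ : [set x | _] = \bigcap_(i in [set: 'I_n])
      ((fun x : RN R n => tnth x i) @^-1` A (lift ord0 i))); last first.
    by apply/seteqP; split => x /= h i; [move=> _; exact: h|exact: h].
  apply: fin_bigcap_measurable => [|i _]; first exact: finite_finset.
  by rewrite -[X in measurable X]setTI; exact: measurable_tnth.
congr product_measure1; apply/seteqP; split => -[a t] /=.
  by move=> h; split; [exact: (h ord0)|move=> i; have := h (lift ord0 i);
    rewrite tnthS].
move=> [h0 h] i; case: (unliftP ord0 i) => [j|] ->; last exact: h0.
by rewrite tnthS.
Qed.

End LebesgueMeasureRN.

Section HeatEquation.
Context {R : realType} (N : nat).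

Definition euclid_norm (x : RN R N) : R := Num.sqrt (\sum_(i < N) tnth x i ^+ 2).

Definition euclid_dist (x y : RN R N) : R :=
  Num.sqrt (\sum_(i < N) (tnth x i - tnth y i) ^+ 2).

Local Notation leb1 := (@lebesgue_measure R).
Local Notation lebN := (@lebesgueRN R N).

Definition weight (gamma : R) (f : RN R N -> R) : RN R N -> R :=
  fun x => euclid_norm x `^ gamma * f x.

Definition Lq (q : \bar R) (f : RN R N -> R) : Prop := f \in Lfun lebN q.

Definition Lqnorm (q : \bar R) (f : RN R N -> R) : \bar R :=
  'N[lebN]_q[EFin \o f]%E.

Definition Lqw (gamma : R) (q : \bar R) (f : RN R N -> R) : Prop :=
  measurable_fun setT f /\ Lq q (weight gamma f).

Definition Lqwnorm (gamma : R) (q : \bar R) (f : RN R N -> R) : \bar R :=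
  Lqnorm q (weight gamma f).

(* 1 / q, with 1 / +oo = 0 *)
Definition recip (q : \bar R) : R := fine (q^-1)%E.

(* Only meaningful, and only used, for t > 0. *)
Definition heat_kernel (t : R) (x y : RN R N) : R :=
  (4 * pi * t) `^ (- (N%:R / 2)) * expR (- (euclid_dist x y ^+ 2 / (4 * t))).

Definition heat (t : R) (f : RN R N -> R) : RN R N -> R :=
  fun x => (\int[lebN]_y (heat_kernel t x y * f y))%R.

Definition nonlin (alpha : R) (f : RN R N -> R) : RN R N -> R :=
  fun x => `|f x| `^ alpha * f x.

(* Functions u : [0, T) * R^N -> R are curried, u t being a representative of
   the class of u(t). In the two time intervals below, T may be +oo. *)
Definition time_co (T : \bar R) : set R := [set t | 0 <= t /\ (t%:E < T)%E].
Definition time_oo (T : \bar R) : set R := [set t | 0 < t /\ (t%:E < T)%E].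

Definition Lq_continuous (q : \bar R) (J : set R) (u : R -> RN R N -> R) :=
  (forall t, J t -> Lq q (u t)) /\
  (forall t0, J t0 ->
    Lqnorm q (u t \- u t0) @[t --> within J (nbhs t0)] --> (0 : \bar R)%E).

Definition Linfty_loc (J : set R) (u : R -> RN R N -> R) :=
  forall a b : R, `[a, b] `<=` J ->
    exists M : R,
      {ae leb1, forall t, a <= t <= b -> (Lqnorm +oo (u t) <= M%:E)%E}.

(* u in C([0,T); L^q) /\ L^oo_loc((0,T); L^oo)        if q < +oo,
   u in C((0,T); L^oo) /\ L^oo_loc([0,T); L^oo)       if q = +oo;
   joint measurability selects the representatives for which the double
   integral in Duhamel's formula makes sense. *)
Definition solution_class (q T : \bar R) (u : R -> RN R N -> R) :=
  [/\ measurable_fun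
        ((time_oo T : set (measurableTypeR R)) `*` [set: RN R N])
        (fun z : measurableTypeR R * RN R N => u z.1 z.2),
      Lq_continuous q (if q == +oo%E then time_oo T else time_co T) u
    & Linfty_loc (if q == +oo%E then time_co T else time_oo T) u].

Definition duhamel_eq (alpha : R) (u0 : RN R N -> R) (T : \bar R)
    (u : R -> RN R N -> R) :=
  forall t, time_oo T t ->
    {ae lebN, forall x,
      (leb1 \x lebN)%E.-integrable (`]0, t[ `*` [set: RN R N])
        (fun z => (heat_kernel (t - z.1) x z.2 * nonlin alpha (u z.1) z.2)%:E)
      /\
      u t x = heat t u0 x +
        (\int[leb1]_(s in `]0, t[) heat (t - s) (nonlin alpha (u s)) x)%R}.

Definition solution (alpha : R) (q : \bar R) (u0 : RN R N -> R) (T : \bar R)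
    (u : R -> RN R N -> R) :=
  [/\ (0 < T)%E,
      solution_class q T u,
      ae_eq lebN setT (u 0) u0
    & duhamel_eq alpha u0 T u].

(* u is defined on [0, T) and has no extension to a larger interval [0, T');
   T is then the existence time T_max(u0). *)
Definition maximal_solution (alpha : R) (q : \bar R) (u0 : RN R N -> R)
    (T : \bar R) (u : R -> RN R N -> R) :=
  solution alpha q u0 T u /\
  forall (T' : \bar R) (v : R -> RN R N -> R),
    solution alpha q u0 T' v ->
    (forall t, time_co T t -> ae_eq lebN setT (v t) (u t)) ->
    (T' <= T)%E.

Definition existence_time (alpha : R) (q : \bar R) (u0 : RN R N -> R)
    (T : \bar R) := exists u, maximal_solution alpha q u0 T u.

(* The norm of the initial value on which the constant C depends. *)
Definition data_norm (gamma : R) (q : \bar R) (phi : RN R N -> R) : R :=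
  if gamma < N%:R then fine (Lqnorm q phi + Lqwnorm gamma q phi)%E
  else fine (Lqnorm 1 phi).

End HeatEquation.

(* Main.v *)
Require Import Defs.
From HB Require Import structures.
From mathcomp Require Import all_boot all_order all_algebra.
From mathcomp Require Import all_classical all_reals all_analysis.
From mathcomp Require Import measurable_realfun ess_sup_inf ring lra.

Set Implicit Arguments.
Unset Strict Implicit.
Unset Printing Implicit Defensive.

Import Order.TTheory GRing.Theory Num.Theory.
Import numFieldNormedType.Exports.

Local Open Scope classical_set_scope.
Local Open Scope ring_scope.

(* Write E(t) = e^{t Delta}|u_0| with u_0 = lambda phi. Hoelder's inequality
   against the weight (or phi in L^1, if gamma > N) gives
   E(t) <= K t^{-b} with K = O(lambda), b = min(N/q + gamma, N) / 2, and the
   hypotheses say that alpha b < 1. By the semigroup law,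
   int_0^t e^{(t-s) Delta} [k(s) E(s)] ds = (int_0^t k) E(t), so on the set
   |w| <= 2 E the Duhamel map is a contraction on (0, T) as soon as
   K^alpha T^{1 - alpha b} is small, that is for
   T = C lambda^{-(1/alpha - b)^{-1}}. If T_max < T, its fixed point w would
   extend the maximal solution u, provided that u = w on (0, T_max).
   On time intervals on which both are bounded, this uniqueness is Gronwall's
   argument. Near t = 0 with q < oo, the L^q-continuity of u and q > q_c give
   |u(t)| <= 2 e^{(t-e) Delta}|u(e)| for small e < t; letting e -> 0 yields
   |u| <= 2 E, and the contraction estimate applies. *)

(** Two smoothing estimates with different exponents are at work. The lower bound on the time uses
    only the weighted one, applied to u_0. The maximal solution u is controlled at positive times
    through its L^q norm alone: nothing says that u(e) has a finite weighted norm. The comparison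
    that leads to |u| <= 2 E therefore uses the exponent N/(2q), for which alpha N/(2q) < 1 is the
    condition q > q_c. The length of the interval on which it works depends on u, which is harmless:
    it serves only to identify u with w near 0, and Gronwall's argument continues the identity. All
    bounds on w are pointwise, relative to E; its regularity in L^q is then read off from E(t) being
    in L^q. Continuity of w in L^q at t = 0 is not estimated: w coincides with u for small times and
    inherits it. Nonnegative integrals are taken in the extended reals, where Tonelli's theorem
    needs no integrability; their finiteness then yields the integrability of the signed ones. *)

Lemma ge0_le_integral_bigcup {d} {T : measurableType d} {R : realType} (mu : measure T R)
    (F : (set T)^nat) (f : T -> \bar R) (M : \bar R) :
  nondecreasing_seq F -> (forall i, measurable (F i)) ->
  measurable_fun setT f -> (forall x, 0 <= f x)%E ->
  (forall i, \int[mu]_(x in F i) f x <= M)%E ->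
  (\int[mu]_(x in \bigcup_i F i) f x <= M)%E.
Proof.
move=> ndF mF mf f0 FM.
have Fcvg := @ge0_nondecreasing_set_cvg_integral _ _ _ F f mu ndF mF
  (fun i => measurable_funTS mf) (fun i x _ => f0 x).
rewrite -(cvg_lim _ Fcvg)//; apply: lime_le; last exact: nearW.
by apply/cvg_ex; exists (\int[mu]_(x in \bigcup_i F i) f x)%E.
Qed.

(** * Integrals of powers and exponentials over time intervals *)

Section time_integrals.
Context {R : realType}.
Local Notation leb1 := (@lebesgue_measure R).
Implicit Types a b t e r : R.

Lemma integral_itv_derive (f F : R -> R) a b : a < b ->
  (forall x, a <= x <= b -> is_derive x (1 : R) F (f x)) ->
  (forall x, a <= x <= b -> {for x, continuous f}) ->
  (\int[leb1]_(x in `[a, b]) (f x)%:E = (F b - F a)%:E)%E.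
Proof.
move=> ab dF cf; rewrite EFinB; apply: continuous_FTC2 => //.
- apply: continuous_in_subspaceT => x; rewrite inE/= in_itv/=; exact: cf.
- have cF x : a <= x <= b -> {for x, continuous F}.
    move=> /dF[dFx _]; exact/differentiable_continuous/derivable1_diffP.
  split.
  + move=> x; rewrite in_itv/= => /andP[ax xb].
    by have [] := dF x; rewrite ?(ltW ax) ?(ltW xb).
  + by apply: cvg_at_right_filter; apply: cF; rewrite lexx ltW.
  + by apply: cvg_at_left_filter; apply: cF; rewrite lexx ltW.
- move=> x; rewrite in_itv/= => /andP[ax xb].
  by rewrite derive1E; have [] := dF x; rewrite ?(ltW ax) ?(ltW xb).
Qed.

Lemma is_derive1_powR_shift e (c x : R) : c < x ->
  is_derive x (1 : R) (fun y => (y - c) `^ e) (e * (x - c) `^ (e - 1)).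
Proof.
move=> cx; have x0 : 0 < x - c by rewrite subr_gt0.
have h := is_derive1_powR e x0.
have h2 : is_derive x (1 : R) (fun y : R => y - c) 1.
  by apply: is_derive_eq; rewrite subr0.
have := @is_derive1_comp _ (fun y => y `^ e) (fun y : R => y - c) x _ _ h h2.
by rewrite mulr1.
Qed.

Lemma integral_itv_powR_shift e (c : R) a b : e != -1 -> c < a -> a < b ->
  (\int[leb1]_(x in `[a, b]) ((x - c) `^ e)%:E =
   (((b - c) `^ (e + 1) - (a - c) `^ (e + 1)) / (e + 1))%:E)%E.
Proof.
move=> e1 ca ab; have e10 : e + 1 != 0 by rewrite addr_eq0.
transitivity (((b - c) `^ (e + 1) / (e + 1) - (a - c) `^ (e + 1) / (e + 1))%:E)%E; last by rewrite mulrBl.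
apply: (@integral_itv_derive (fun x => (x - c) `^ e) (fun x => (x - c) `^ (e + 1) / (e + 1))) => //.
- move=> x /andP[ax _]; have cx : c < x by exact: lt_le_trans ax.
  have h := is_derive1_powR_shift (e + 1) cx.
  rewrite (_ : (fun x => _) = (e + 1)^-1 *: (fun x : R => (x - c) `^ (e + 1))); last first.
    by apply/funext => y; rewrite /GRing.scale/= mulrC.
  apply: is_derive_eq; rewrite /GRing.scale/= addrK; field.
  by rewrite addr_eq0.
- move=> x /andP[ax _]; have cx : c < x by exact: lt_le_trans ax.
  have [h _] := is_derive1_powR_shift e cx.
  exact/differentiable_continuous/derivable1_diffP.
Qed.

Lemma measurable_powR_shift (D : set R) e (c : R) :
  measurable_fun D (fun x : measurableTypeR R => ((x - c) `^ e)%:E).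
Proof.
apply/measurable_EFinP; apply: measurable_funTS; apply: (measurableT_comp (measurable_powR _)).
exact: measurable_funB.
Qed.

(** The primitive is not differentiable at the endpoint [a], so the fundamental theorem of calculus
    is used on compact subintervals and monotone convergence does the rest. *)
Lemma integral_powR_shift (th a t : R) : 0 <= th -> th < 1 -> a < t ->
  (\int[leb1]_(x in `]a, t[) ((x - a) `^ (- th))%:E <= ((t - a) `^ (1 - th) / (1 - th))%:E)%E.
Proof.
move=> th0 th1 at_; have ta : 0 < t - a by rewrite subr_gt0.
(* With [n.+2] instead of [n.+1] the interval is nondegenerate already for n = 0. *)
pose F (n : nat) : set (measurableTypeR R) := `[a + (t - a) / n.+2%:R, t]%classic.
have UF : \bigcup_n F n = `]a, t]%classic.
  apply/seteqP; split => x /=.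
    move=> [n _]; rewrite /F/= !in_itv/= => /andP[xn ->]; rewrite andbT.
    by apply: lt_le_trans xn; rewrite ltrDl divr_gt0.
  rewrite in_itv/= => /andP[ax xt]; have xa : 0 < x - a by rewrite subr_gt0.
  exists (Num.truncn ((t - a) / (x - a))) => //; rewrite /F/= in_itv/= xt andbT.
  rewrite -lerBrDl ler_pdivrMr// mulrC -ler_pdivrMr// ltW//.
  by apply: lt_trans (truncnS_gt _) _; rewrite ltr_nat.
apply: (@le_trans _ _ (\int[leb1]_(x in `]a, t]) ((x - a) `^ (- th))%:E)%E).
  apply: ge0_subset_integral => //=.
  - exact: measurable_powR_shift.
  - by move=> x _; rewrite lee_fin powR_ge0.
  - by move=> x/=; rewrite !in_itv/= => /andP[-> /ltW ->].
rewrite -UF.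
apply: ge0_le_integral_bigcup.
- move=> m n mn; rewrite /F; apply/subsetPset => x /=; rewrite !in_itv/= => /andP[h ->]; rewrite andbT.
  by apply: le_trans h; rewrite lerD2l ler_pM2l// lef_pV2 ?posrE// ler_nat.
- by move=> n; exact: measurable_itv.
- exact: measurable_powR_shift.
- by move=> x; rewrite lee_fin powR_ge0.
- move=> n; rewrite /F integral_itv_powR_shift.
  + rewrite (addrC _ 1) lee_fin ler_pM2r ?invr_gt0 ?subr_gt0// lerBlDr lerDl powR_ge0//.
  + by apply/negP => /eqP h; lra.
  + by rewrite ltrDl divr_gt0.
  + by rewrite -ltrBrDl ltr_pdivrMr// ltr_pMr// ltr1n.
Qed.

Lemma measurable_powR_itv (D : set R) e :
  measurable_fun D (fun x : measurableTypeR R => (x `^ e)%:E).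
Proof. by have := @measurable_powR_shift D e 0; under eq_fun do rewrite subr0. Qed.

Lemma integral_powR0 (th t : R) : 0 <= th -> th < 1 -> 0 < t ->
  (\int[leb1]_(x in `]0%R, t[) (x `^ (- th))%:E <= (t `^ (1 - th) / (1 - th))%:E)%E.
Proof.
move=> th0 th1 t0; have := integral_powR_shift th0 th1 t0.
by rewrite subr0; under eq_integral do rewrite subr0.
Qed.

Lemma integral_powRy (b : R) : 1 < b ->
  (\int[leb1]_(x in `[1%R, +oo[) (x `^ (- b))%:E < +oo)%E.
Proof.
move=> b1; rewrite (_ : integral _ _ _ = \int[leb1]_(x in `[1%R, +oo[) ((x - 0) `^ (- b))%:E)%E; last first.
  by apply: eq_integral => x _; rewrite subr0.
pose F (n : nat) : set (measurableTypeR R) := `[1%R, n.+2%:R]%classic.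
have UF : \bigcup_n F n = `[1, +oo[%classic.
  apply/seteqP; split => x /=.
    by move=> [n _]; rewrite /F/= !in_itv/= => /andP[-> _].
  rewrite in_itv/= andbT => x1.
  exists (Num.truncn x) => //; rewrite /F/= in_itv/= x1/= ltW//.
  by apply: lt_trans (truncnS_gt _) _; rewrite ltr_nat.
rewrite -UF.
apply: (@le_lt_trans _ _ (b - 1)^-1%:E); last exact: ltry.
apply: ge0_le_integral_bigcup.
- move=> m n mn; rewrite /F; apply/subsetPset => x /=; rewrite !in_itv/= => /andP[-> h] /=.
  by apply: (le_trans h); rewrite ler_nat.
- by move=> n; exact: measurable_itv.
- exact: measurable_powR_shift.
- by move=> x; rewrite lee_fin powR_ge0.
- move=> n; rewrite /F integral_itv_powR_shift//.
  + rewrite lee_fin !subr0 powR1 -(opprK (- b + 1)) invrN mulrN -mulNr opprB opprD opprK -[leRHS]mul1r.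
    by rewrite ler_pM2r ?invr_gt0 ?subr_gt0// lerBlDr lerDl powR_ge0.
  + by apply/negP => /eqP h; lra.
  + by rewrite ltr1n.
Qed.

(** The gain 1 / L on integrating an exponential weight is what makes the iteration in
    [gronwall_duhE] contract. *)
Lemma integral_expR_le (L a t : R) : 0 < L ->
  (\int[leb1]_(x in `]a, t[) (expR (L * x))%:E <= (expR (L * t) / L)%:E)%E.
Proof.
move=> L0.
have [ta|at_] := leP t a.
  by rewrite set_itv_ge ?bnd_simp -?leNgt// integral_set0 lee_fin divr_ge0 ?expR_ge0 ?ltW.
have mexp (D : set R) : measurable_fun D (fun x : measurableTypeR R => (expR (L * x))%:E).
  apply/measurable_EFinP; apply: measurable_funTS; apply: (measurableT_comp (@measurable_expR R)).
  exact: (measurable_funM (f := fun=> L) (g := id)).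
apply: (@le_trans _ _ (\int[leb1]_(x in `[a, t]) (expR (L * x))%:E)%E).
  apply: ge0_subset_integral => //=.
  - exact: mexp.
  - by move=> x/=; rewrite !in_itv/= => /andP[/ltW -> /ltW ->].
rewrite (_ : integral _ _ _ = ((expR (L * t) / L - expR (L * a) / L)%:E)%E).
  by rewrite lee_fin lerBlDr lerDl divr_ge0 ?expR_ge0 ?ltW.
apply: (@integral_itv_derive (fun x => expR (L * x)) (fun x => expR (L * x) / L)) => //.
- move=> x _.
  rewrite (_ : (fun x => _) = L^-1 *: (expR \o (fun x : R => L * x))); last first.
    by apply/funext => y; rewrite /GRing.scale/= mulrC.
  apply: is_derive_eq; rewrite /GRing.scale/=; field.
  by rewrite gt_eqF.
- move=> x _; apply: continuous_comp; last exact: continuous_expR.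
  by apply: continuousM => //; exact: cst_continuous.
Qed.

End time_integrals.

(** * The nonlinearity, and limits of geometrically convergent sequences *)

Section nonlinearity.
Context {R : realType}.
Implicit Types alpha a b r M : R.

Definition powabs alpha r : R := `|r| `^ alpha * r.

Lemma powabsN alpha r : powabs alpha (- r) = - powabs alpha r.
Proof. by rewrite /powabs normrN mulrN. Qed.

Lemma norm_powabs alpha r : `|powabs alpha r| = `|r| `^ alpha * `|r|.
Proof. by rewrite /powabs normrM ger0_norm ?powR_ge0. Qed.

(** No derivative is taken. For 0 <= b <= a, division by a reduces the bound to 1 - r^(alpha + 1) <=
    m (1 - r) with r = b / a in [0, 1]; this follows from r^n <= r^alpha for an integer n >= alpha
    and Bernoulli's inequality with exponent n + 1 = m. For opposite signs M^alpha |a - b| already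
    suffices. *)
Lemma powabs_lipschitz alpha : 0 < alpha -> exists2 m : R, 1 <= m &
  forall a b M, `|a| <= M -> `|b| <= M ->
    `|powabs alpha a - powabs alpha b| <= m * M `^ alpha * `|a - b|.
Proof.
move=> alpha0; pose n := (Num.truncn alpha).+1; pose m : R := n.+1%:R.
have m1 : 1 <= m by rewrite ler1n.
have an : alpha <= n%:R by rewrite ltW// truncnS_gt.
exists m => //.
have pos a b : 0 <= b -> b <= a ->
    0 <= powabs alpha a - powabs alpha b <= m * a `^ alpha * (a - b).
  move=> b0 ba; have a0 : 0 <= a by exact: le_trans ba.
  rewrite /powabs (ger0_norm b0) (ger0_norm a0); apply/andP; split.
    by rewrite subr_ge0 ler_pM ?powR_ge0// ge0_ler_powR ?nnegrE// ltW.
  have [a00|/negPf aN0] := eqVneq a 0.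
    have b00 : b = 0 by apply/eqP; rewrite eq_le b0 -a00 ba.
    by rewrite a00 b00 !mulr0 subrr !mulr0.
  have {aN0}a0 : 0 < a by rewrite lt_def aN0.
  pose r := b / a; have br : b = r * a by rewrite /r divfK ?gt_eqF.
  have r0 : 0 <= r by rewrite divr_ge0// ltW.
  have r1 : r <= 1 by rewrite ler_pdivrMr// mul1r.
  have rn : r ^+ n <= r `^ alpha.
    have [->|/negPf rN0] := eqVneq r 0; first by rewrite expr0n/= powR_ge0.
    by rewrite -powR_mulrn// ger_powR// r1 lt_def rN0 r0.
  have bern k : 1 - r ^+ k <= k%:R * (1 - r).
    elim: k => [|k IH]; first by rewrite expr0 subrr mul0r.
    have rk : 0 <= 1 - r ^+ k by rewrite subr_ge0 exprn_ile1.
    rewrite exprS -natr1; nra.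
  have ap : 0 <= a `^ alpha by exact: powR_ge0.
  rewrite br powRM ?(ltW a0)//.
  rewrite [leLHS](_ : _ = a `^ alpha * a * (1 - r `^ alpha * r)); last by ring.
  rewrite [leRHS](_ : _ = a `^ alpha * a * (m * (1 - r))); last by ring.
  rewrite ler_wpM2l// ?mulr_ge0 ?(ltW a0)//.
  apply: le_trans (bern n.+1); rewrite exprSr lerD2l lerN2 ler_wpM2r//.
have posM a b M : 0 <= a -> 0 <= b -> a <= M -> b <= M ->
    `|powabs alpha a - powabs alpha b| <= m * M `^ alpha * `|a - b|.
  wlog ab : a b / b <= a => [hw a0 b0 aM bM|a0 b0 aM bM].
    have [|/ltW ab] := leP b a; first by move=> ba; exact: hw.
    by rewrite distrC (distrC a); exact: hw.
  have /andP[p1 p2] := pos _ _ b0 ab.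
  rewrite (ger0_norm p1) (ger0_norm (_ : 0 <= a - b)) ?subr_ge0//.
  apply: (le_trans p2); rewrite ler_wpM2r ?subr_ge0// ler_wpM2l//.
  by apply: ge0_ler_powR; rewrite ?nnegrE ?(ltW alpha0)// (le_trans a0).
have opp a b M : 0 <= a -> b <= 0 -> a <= M -> - b <= M ->
    `|powabs alpha a - powabs alpha b| <= m * M `^ alpha * `|a - b|.
  move=> a0 b0 aM bM; have M0 : 0 <= M by exact: le_trans aM.
  rewrite (ger0_norm (_ : 0 <= a - b)); last by lra.
  have pM (c : R) : 0 <= c -> c <= M -> c `^ alpha <= M `^ alpha.
    by move=> c0 cM; apply: ge0_ler_powR; rewrite ?nnegrE ?(ltW alpha0).
  rewrite /powabs (ger0_norm a0) (ler0_norm b0).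
  have h1 := pM _ a0 aM; have h2 := pM (- b); rewrite oppr_ge0 in h2; have {}h2 := h2 b0 bM.
  have h3 := powR_ge0 a alpha; have h4 := powR_ge0 (- b) alpha; have h5 := powR_ge0 M alpha.
  rewrite ger0_norm; last by nra.
  apply: (@le_trans _ _ (M `^ alpha * (a - b))); first by nra.
  by rewrite -mulrA ler_peMl// mulr_ge0//; lra.
move=> a b M aM bM.
have [a0|/ltW a0] := leP 0 a; have [b0|/ltW b0] := leP 0 b.
- by apply: posM => //; [rewrite -(ger0_norm a0)|rewrite -(ger0_norm b0)].
- by apply: opp => //; [rewrite -(ger0_norm a0)|rewrite -(ler0_norm b0)].
- rewrite distrC (distrC a).
  by apply: opp => //; [rewrite -(ger0_norm b0)|rewrite -(ler0_norm a0)].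
- have -> : powabs alpha a - powabs alpha b = - (powabs alpha (- a) - powabs alpha (- b)).
    by rewrite !powabsN; ring.
  have -> : a - b = - (- a - - b) by ring.
  by rewrite !normrN; apply: posM; rewrite ?oppr_ge0// -ler0_norm.
Qed.

End nonlinearity.

Lemma geometric_limit {R : realType} (u : nat -> R) (C : R) :
  (forall n, `|u n.+1 - u n| <= C / 2 ^+ n) ->
  exists2 l : R, u n @[n --> \oo] --> l & forall n, `|l - u n| <= 2 * C / 2 ^+ n.
Proof.
move=> uC.
have C0 : 0 <= C by have := uC 0%N; rewrite expr0 divr1; exact: le_trans.
pose d i := u i.+1 - u i.
have uE n : u n = u 0%N + series d n.
  by rewrite /series/= telescope_sumr// addrC subrK.
have cd : cvgn (series d).
  apply: normed_cvg.
  apply: (@series_le_cvg _ _ (geometric C 2^-1)).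
  - by move=> n; exact: normr_ge0.
  - by move=> n; rewrite /geometric/= mulr_ge0// exprn_ge0.
  - by move=> n; rewrite /geometric/= exprVn; exact: uC.
  - by apply: is_cvg_geometric_series; rewrite ger0_norm ?invf_lt1 ?ltr1n.
have cu : u n @[n --> \oo] --> u 0%N + limn (series d).
  by rewrite [X in X @ _](funext uE); apply: cvgD; [exact: cvg_cst|exact: cd].
have um n k : `|u (n + k)%N - u n| <= 2 * C / 2 ^+ n.
  (* The factor [1 - 2^-1 ^+ k], from the partial geometric sum, is what makes the bound pass
     through the induction on [k]. *)
  suff : `|u (n + k)%N - u n| <= 2 * C / 2 ^+ n * (1 - 2^-1 ^+ k).
    move=> /le_trans; apply; apply: ler_piMr.
      by rewrite divr_ge0 ?mulr_ge0 ?exprn_ge0.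
    by rewrite lerBlDr lerDl exprn_ge0.
  elim: k => [|k IH]; first by rewrite addn0 subrr normr0 expr0 subrr mulr0.
  rewrite addnS (_ : u (n + k).+1 - u n = (u (n + k).+1 - u (n + k)%N) + (u (n + k)%N - u n)); last by ring.
  apply: (le_trans (ler_normD _ _)); apply: (le_trans (lerD (uC _) IH)).
  rewrite le_eqVlt; apply/orP; left; apply/eqP; rewrite !exprVn exprD exprS; field.
  by rewrite !expf_neq0.
exists (u 0%N + limn (series d)) => // n.
have cn : `|u (k + n)%N - u n| @[k --> \oo] --> `|u 0%N + limn (series d) - u n|.
  apply: cvg_norm; apply: cvgB; last exact: cvg_cst.
  by rewrite (cvg_shiftn n u).
rewrite -(cvg_lim _ cn)//; apply: limr_le; first by apply/cvg_ex; eexists; exact: cn.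
by apply: nearW => k; rewrite addnC.
Qed.

(** * The heat kernel *)

Section gaussian1.
Context {R : realType}.
Local Notation leb1 := (@lebesgue_measure R).
Implicit Types a b c s t m : R.

(** The heat kernel on the line, that is, the normal density of mean a and variance 2 t; the kernel
    on R^N is a product of these. *)
Definition gauss1 t a b : R := (Num.sqrt (4 * pi * t))^-1 * expR (- ((a - b) ^+ 2 / (4 * t))).

Lemma gauss1_ge0 t a b : 0 <= gauss1 t a b.
Proof. by rewrite mulr_ge0// ?invr_ge0// expR_ge0. Qed.

Lemma gauss1_normal_pdf t a b : 0 < t ->
  gauss1 t a b = normal_pdf a (Num.sqrt (2 * t)) b.
Proof.
move=> t0; have st0 : Num.sqrt (2 * t) != 0 by rewrite gt_eqF// sqrtr_gt0 mulr_gt0.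
rewrite /normal_pdf (negPf st0) /normal_peak /normal_fun sqr_sqrtr; last by lra.
congr (_ * expR _); first by congr (Num.sqrt _)^-1; ring.
by field; lra.
Qed.

Lemma integral_gauss1 t a : 0 < t ->
  (\int[leb1]_b (gauss1 t a b)%:E = 1)%E.
Proof.
move=> t0; rewrite -(@integral_normal_pdf R a (Num.sqrt (2 * t))).
by apply: eq_integral => b _; rewrite gauss1_normal_pdf.
Qed.

Lemma measurable_gauss1 t a : measurable_fun setT (gauss1 t a).
Proof.
apply: measurable_funM => //; apply: measurableT_comp => //.
apply: measurableT_comp => //; apply: measurable_funM => //.
by apply: measurable_funX; apply: measurable_funB.
Qed.

(** Completing the square in [b]: what depends on [b] is again a Gaussian, around the weighted mean
    of a and c, so integrating it out leaves the semigroup law. *)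
Lemma gauss1M s t a b c : 0 < s -> 0 < t ->
  gauss1 s a b * gauss1 t b c =
  gauss1 (s + t) a c * gauss1 (s * t / (s + t)) ((t * a + s * c) / (s + t)) b.
Proof.
move=> s0 t0; have st0 : 0 < s + t by lra.
have p0 := @pi_gt0 R.
rewrite /gauss1 mulrACA [RHS]mulrACA -!expRD -!invfM -!sqrtrM; last 2 first.
  by do !apply: mulr_ge0; lra.
  by do !apply: mulr_ge0; lra.
congr (_^-1 * expR _); first by congr Num.sqrt; field; lra.
by field; lra.
Qed.

Lemma gauss1_semigroup s t a c : 0 < s -> 0 < t ->
  (\int[leb1]_b (gauss1 s a b * gauss1 t b c)%:E = (gauss1 (s + t) a c)%:E)%E.
Proof.
move=> s0 t0; under eq_integral do rewrite gauss1M// EFinM.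
rewrite ge0_integralZl_EFin//; last 3 first.
- by move=> b _; rewrite lee_fin gauss1_ge0.
- by apply/measurable_EFinP; exact: measurable_gauss1.
- exact: gauss1_ge0.
by rewrite integral_gauss1 ?mule1// divr_gt0// ?mulr_gt0// addr_gt0.
Qed.

End gaussian1.

Section lebesgueRN_integral.
Context {R : realType}.
Local Notation leb1 := (@lebesgue_measure R).
Local Notation lebN := (@lebesgueRN R).

Lemma ge0_integral_lebesgueRNS n (f : RN R n.+1 -> \bar R) :
  measurable_fun setT f -> (forall x, 0 <= f x)%E ->
  (\int[lebN n.+1]_x f x = \int[leb1]_a \int[lebN n]_t f (consRN (a, t)))%E.
Proof.
move=> mf f0.
rewrite /= /lebesgueRN_step.
transitivity (\int[(leb1 \x lebN n)%E]_z f (consRN z))%E.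
  rewrite -(preimage_setT (@consRN R n)).
  rewrite -(@ge0_integral_pushforward _ _ _ _ R (@consRN R n) (@measurable_consRN R n)).
  done.
  done.
  done.
  done.
rewrite fubini_tonelli1//; apply: measurableT_comp => //.
exact: measurable_consRN.
Qed.

(** Tonelli for tensor products. It reduces the mass, the semigroup law and the weighted bounds of
    the kernel on R^N to dimension one. *)
Lemma ge0_integral_prod_lebesgueRN n (h : 'I_n -> R -> \bar R) :
  (forall i, measurable_fun setT (h i)) -> (forall i a, 0 <= h i a)%E ->
  (\int[lebN n]_x (\prod_(i < n) h i (tnth x i)) = \prod_(i < n) \int[leb1]_a h i a)%E.
Proof.
elim: n h => [|n IH] h mh h0.
  rewrite big_ord0 integral_dirac//; last first.
    apply: (eq_measurable_fun (cst 1%E)) => // x _.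
    by rewrite big_ord0.
  by rewrite diracT big_ord0 mule1.
have mprod m (k : 'I_m -> R -> \bar R) : (forall i, measurable_fun setT (k i)) ->
    measurable_fun setT (fun x : RN R m => \prod_(i < m) k i (tnth x i))%E.
  move=> mk; elim: (index_enum 'I_m) => [|i r IHr].
    by under eq_fun do rewrite big_nil; exact: measurable_cst.
  under eq_fun do rewrite big_cons; apply: emeasurable_funM => //.
  by apply: (measurableT_comp (mk i)); exact: (measurable_tnth (T := measurableTypeR R)).
rewrite ge0_integral_lebesgueRNS//; [|exact: mprod|by move=> x; apply: prode_ge0].
have split_head a (t : RN R n) : (\prod_(i < n.+1) h i (tnth (consRN (a, t)) i) =
    h ord0 a * \prod_(i < n) h (lift ord0 i) (tnth t i))%E.
  rewrite big_ord_recl; congr (_ * _)%E.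
  by apply: eq_bigr => i _; rewrite tnthS.
under eq_integral => a _.
  under eq_integral => t _ do rewrite split_head.
  rewrite ge0_integralZl//; last 2 first.
  - exact: (mprod n (fun i => h (lift ord0 i))).
  - by move=> x _; apply: prode_ge0.
  rewrite (IH (fun i => h (lift ord0 i)))//.
  over.
rewrite big_ord_recl ge0_integralZr//; first exact: mh.
by apply: prode_ge0 => i _; apply: integral_ge0.
Qed.
End lebesgueRN_integral.

Section heat_kernel.
Context {R : realType} (N : nat).
Local Notation lebN := (@lebesgueRN R N).
Implicit Types (x y z : RN R N) (s t : R).

Lemma heat_kernel_prod t x y : 0 < t ->
  heat_kernel t x y = \prod_(i < N) gauss1 t (tnth x i) (tnth y i).
Proof.
move=> t0; have p0 := @pi_gt0 R.
have pt0 : 0 <= 4 * pi * t by do !apply: mulr_ge0; lra.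
rewrite big_split /= prodr_const card_ord -expR_sum /heat_kernel; congr (_ * expR _).
  by rewrite powRN (mulrC N%:R) powRrM powR12_sqrt// powR_mulrn ?sqrtr_ge0// exprVn.
rewrite /euclid_dist sqr_sqrtr ?sumr_ge0// => [|i _]; last exact: sqr_ge0.
by rewrite sumrN -mulr_suml.
Qed.

Lemma heat_kernel_ge0 t x y : 0 <= heat_kernel t x y.
Proof. by rewrite mulr_ge0// ?powR_ge0// expR_ge0. Qed.

Lemma euclid_distC x y : euclid_dist x y = euclid_dist y x.
Proof.
by rewrite /euclid_dist; congr Num.sqrt; apply: eq_bigr => i _; rewrite -sqrrN opprB.
Qed.

Lemma heat_kernelC t x y : heat_kernel t x y = heat_kernel t y x.
Proof. by rewrite /heat_kernel euclid_distC. Qed.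

Lemma integral_heat_kernel t x : 0 < t ->
  (\int[lebN]_y (heat_kernel t x y)%:E = 1)%E.
Proof.
move=> t0; under eq_integral do rewrite heat_kernel_prod// -prodEFin.
rewrite (ge0_integral_prod_lebesgueRN (h := fun i a => (gauss1 t (tnth x i) a)%:E)).
- by apply: big1 => i _; rewrite integral_gauss1.
- by move=> i; apply/measurable_EFinP; exact: measurable_gauss1.
- by move=> i a; rewrite lee_fin gauss1_ge0.
Qed.

Lemma heat_kernel_semigroup s t x z : 0 < s -> 0 < t ->
  (\int[lebN]_y (heat_kernel s x y * heat_kernel t y z)%:E =
   (heat_kernel (s + t) x z)%:E)%E.
Proof.
move=> s0 t0.
under eq_integral do rewrite !heat_kernel_prod// -big_split/= -prodEFin.
rewrite (ge0_integral_prod_lebesgueRN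
  (h := fun i b => (gauss1 s (tnth x i) b * gauss1 t b (tnth z i))%:E)).
- rewrite heat_kernel_prod ?addr_gt0// -prodEFin.
  by apply: eq_bigr => i _; rewrite gauss1_semigroup.
- move=> i; apply/measurable_EFinP; apply: measurable_funM; first exact: measurable_gauss1.
  rewrite (_ : (fun b => _) = fun b => gauss1 t (tnth z i) b).
    exact: measurable_gauss1.
  by apply/funext => b; rewrite /gauss1 -[(b - _) ^+ 2]sqrrN opprB.
- by move=> i b; rewrite lee_fin mulr_ge0// gauss1_ge0.
Qed.

Lemma measurable_euclid_dist :
  measurable_fun setT (fun z : RN R N * RN R N => euclid_dist z.1 z.2).
Proof.
apply: (measurableT_comp (f := @Num.sqrt R)).
  by apply: continuous_measurable_fun; exact: sqrt_continuous.
apply: measurable_sum => i; apply: measurable_funX; apply: measurable_funB.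
  by apply: (measurableT_comp (f := fun x : RN R N => tnth x i)); [exact: measurable_tnth|exact: measurable_fst].
by apply: (measurableT_comp (f := fun x : RN R N => tnth x i)); [exact: measurable_tnth|exact: measurable_snd].
Qed.

Lemma measurable_heat_kernel :
  measurable_fun setT (fun z : R * (RN R N * RN R N) => heat_kernel z.1 z.2.1 z.2.2).
Proof.
apply: measurable_funM.
  apply: (measurableT_comp (measurable_powR _)).
  by apply: measurable_funM => //; exact: measurable_fst.
apply: measurableT_comp => //; apply: measurableT_comp => //.
apply: measurable_funM.
  apply: measurable_funX.
  apply: (measurableT_comp (f := fun z : RN R N * RN R N => euclid_dist z.1 z.2)).
    exact: measurable_euclid_dist.
  exact: measurable_snd.
apply: (measurableT_comp (f := @GRing.inv R)).
  (* The power -1 of [powR] is the inverse for nonnegative arguments only, hence the square; at 0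
     both sides are 0, the inverse of 0 being 0. *)
  rewrite (_ : GRing.inv = fun a : R => a * (a ^+ 2) `^ (-1)).
    apply: measurable_funM => //; apply: (measurableT_comp (measurable_powR _)).
    exact: measurable_funX.
  apply/funext => a; rewrite powR_inv1 ?sqr_ge0//.
  have [->|a0] := eqVneq a 0; first by rewrite invr0 mul0r.
  by rewrite expr2 invfM mulrA divff// mul1r.
by apply: measurable_funM => //; exact: measurable_fst.
Qed.

(** The exponential increases with time, so only the normalisation costs a factor. This lets heat
    flows at nearby times be compared with the one at a single later time. *)
Lemma heat_kernel_le_time s t x y : 0 < s -> s <= t ->
  heat_kernel s x y <= (t / s) `^ (N%:R / 2) * heat_kernel t x y.
Proof.
move=> s0 st; have p0 := @pi_gt0 R; have t0 : 0 < t by exact: lt_le_trans st.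
have ps0 : 0 < 4 * pi * s by do !apply: mulr_gt0; lra.
rewrite /heat_kernel mulrA; apply: ler_pM; rewrite ?powR_ge0 ?expR_ge0//.
  rewrite !powRN (_ : 4 * pi * t = t / s * (4 * pi * s)); last by field; lra.
  have ts0 : 0 < t / s by rewrite divr_gt0.
  rewrite (@powRM _ (t / s)) ?(ltW ps0) ?(ltW ts0)// invfM mulrA divff ?mul1r//.
  by rewrite gt_eqF// powR_gt0.
rewrite ler_expR lerN2 ler_wpM2l ?sqr_ge0// lef_pV2 ?posrE; lra.
Qed.

(* From [u * exp(-u) <= 2 * exp(-u/2)] for the exponential factor, and
   [r ^ (N/2) - 1 <= 2 ^ N * (r - 1)] on [1, 2] for the normalisation. *)
Lemma heat_kernel_time_lipschitz :
  exists2 c : R, 0 <= c & forall s t x y, 0 < s -> s <= t -> t <= 2 * s ->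
  `|heat_kernel t x y - heat_kernel s x y| <=
    c * ((t - s) / s) * heat_kernel (2 * t) x y.
Proof.
(* The factor 2 ^ d is the ratio of the normalisations at times t and 2 t; the summands 2 ^ N and 2
   come from the increments of the normalisation and of the exponential. *)
pose d : R := N%:R / 2; pose c := 2 `^ d * (2 ^+ N + 2) : R.
exists c; first by rewrite mulr_ge0 ?powR_ge0// addr_ge0// exprn_ge0.
move=> s t x y s0 st ts; have p0 := @pi_gt0 R.
have t0 : 0 < t by exact: lt_le_trans st.
set r2 := euclid_dist x y ^+ 2; have r20 : 0 <= r2 by exact: sqr_ge0.
pose e (a : R) := expR (- (r2 / (4 * a))).
pose A (a : R) := (4 * pi * a) `^ (- d).
have KE a : heat_kernel a x y = A a * e a by [].
have A0 a : 0 <= A a by exact: powR_ge0.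
have e0 a : 0 <= e a by exact: expR_ge0.
have le_e a b : 0 < a -> a <= b -> e a <= e b.
  move=> a0 ab; rewrite ler_expR lerN2 ler_wpM2l// lef_pV2 ?posrE; lra.
set q := (t - s) / s.
have q0 : 0 <= q by rewrite divr_ge0; lra.
have de : e t - e s <= 2 * q * e (2 * t).
  have u0 : 0 <= r2 / (4 * t) by rewrite divr_ge0//; lra.
  set u := r2 / (4 * t) in u0.
  have es : e s = e t * expR (- (u * q)).
    rewrite -expRD; congr expR; rewrite /u /q; field; lra.
  have et : e t = e (2 * t) * expR (- (u / 2)).
    rewrite -expRD; congr expR; rewrite /u; field; lra.
  have le1 : e t - e s <= e t * (u * q).
    rewrite es -[X in X - _]mulr1 -mulrBr ler_wpM2l//.
    have := expR_ge1Dx (- (u * q)); lra.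
  apply: (le_trans le1); rewrite et.
  have : u / 2 * expR (- (u / 2)) <= 1.
    rewrite expRN -ler_pdivlMr ?invr_gt0 ?expR_gt0// invrK mul1r.
    have := expR_ge1Dx (u / 2); lra.
  move=> h; rewrite [leLHS](_ : _ = 2 * q * e (2 * t) * (u / 2 * expR (- (u / 2)))); last by field.
  apply: ler_piMr h; apply: mulr_ge0 => //; apply: mulr_ge0 => //.
have As : A s = (t / s) `^ d * A t.
  rewrite /A !powRN (_ : 4 * pi * t = t / s * (4 * pi * s)); last by field; lra.
  have ts0 : 0 < t / s by rewrite divr_gt0.
  have ps0 : 0 < 4 * pi * s by do !apply: mulr_gt0; lra.
  rewrite (@powRM _ (t / s)) ?(ltW ps0) ?(ltW ts0)// invfM mulrA divff ?mul1r//.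
  by rewrite gt_eqF// powR_gt0.
have d0 : 0 <= d by rewrite /d divr_ge0.
have ts1 : 1 <= t / s by rewrite ler_pdivlMr; lra.
have dA : (t / s) `^ d - 1 <= (2 ^+ N) * q.
  have -> : q = t / s - 1 by rewrite /q; field; lra.
  apply: (@le_trans _ _ ((t / s) ^+ N - 1)).
    rewrite lerB// -powR_mulrn; last by lra.
    by rewrite ler_powR// /d ler_pdivrMr// ler_peMr//; lra.
  have : (t / s) ^+ N - 1 <= (2 ^+ N - 1) * (t / s - 1).
    have ts2 : t / s <= 2 by rewrite ler_pdivrMr; lra.
    elim: (N) => [|n IH]; first by rewrite !expr0; lra.
    have pos : 0 <= (t / s) ^+ n - 1 by rewrite subr_ge0 exprn_ege1.
    rewrite !exprS; nra.
  move=> h; apply: (le_trans h); rewrite ler_wpM2r; lra.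
have A2 : A t = 2 `^ d * A (2 * t).
  rewrite /A !powRN (_ : 4 * pi * (2 * t) = 2 * (4 * pi * t)); last by ring.
  have pt0 : 0 < 4 * pi * t by do !apply: mulr_gt0; lra.
  by rewrite (@powRM _ 2) ?(ltW pt0)// invfM mulrA divff ?mul1r// gt_eqF// powR_gt0.
have -> : heat_kernel t x y - heat_kernel s x y =
    A t * (e t - e s) - ((t / s) `^ d - 1) * A t * e s.
  by rewrite !KE As; ring.
have h1 : 0 <= A t * (e t - e s) by rewrite mulr_ge0// subr_ge0 le_e.
have h2 : 0 <= ((t / s) `^ d - 1) * A t * e s.
  by rewrite !mulr_ge0// subr_ge0 -(powRr0 (t / s)) ler_powR.
apply: (@le_trans _ _ (A t * (2 * q * e (2 * t)) + (2 ^+ N * q) * A t * e (2 * t))).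
  have h3 : A t * (e t - e s) <= A t * (2 * q * e (2 * t)) by rewrite ler_wpM2l.
  have h4 : ((t / s) `^ d - 1) * A t * e s <= (2 ^+ N * q) * A t * e (2 * t).
    apply: ler_pM => //; last by apply: le_e; lra.
      by rewrite mulr_ge0// subr_ge0 -(powRr0 (t / s)) ler_powR.
    by rewrite ler_wpM2r.
  rewrite ler_norml; apply/andP; split; last by lra.
  have h5 : 0 <= A t * (2 * q * e (2 * t)) by do !apply: mulr_ge0 => //.
  lra.
rewrite KE A2 /c le_eqVlt; apply/orP; left; apply/eqP; ring.
Qed.

End heat_kernel.

(** * Abstract semigroup kernels, null sets and Fubini's theorem *)

(** The Duhamel, Picard and uniqueness arguments rest on positivity, mass one and the
    Chapman-Kolmogorov identity; symmetry and regularity in time enter as separate hypotheses where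
    they are used. Positivity and measurability are asked for all real t, so that integrands can be
    handled on all of space-time before a time interval is cut out. *)
Record semigroup_kernel {R : realType} {d} {X : measurableType d}
    (mu : {measure set X -> \bar R}) (G : R -> X -> X -> R) : Prop := SemigroupKernel {
  kernel_ge0 : forall t x y, 0 <= G t x y ;
  measurable_kernel :
    measurable_fun setT (fun z : measurableTypeR R * (X * X) => G z.1 z.2.1 z.2.2) ;
  kernel_mass : forall t x, 0 < t -> (\int[mu]_y (G t x y)%:E = 1)%E ;
  kernelD : forall s t x z, 0 < s -> 0 < t ->
    (\int[mu]_y (G s x y * G t y z)%:E = (G (s + t) x z)%:E)%E }.

(* Stated for a general measure because the Filter instance of
   almost_everywhere is not inferred for lebesgue_measure and lebesgueRN. *)
Section almost_everywhere.
Context {R : realType} d (X : measurableType d) (mu : {measure set X -> \bar R}).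

Lemma ae_imply (P Q : X -> Prop) : (forall x, P x -> Q x) ->
  {ae mu, forall x, P x} -> {ae mu, forall x, Q x}.
Proof. exact: filterS. Qed.

Lemma ae_imply2 (P P' Q : X -> Prop) : (forall x, P x -> P' x -> Q x) ->
  {ae mu, forall x, P x} -> {ae mu, forall x, P' x} -> {ae mu, forall x, Q x}.
Proof. exact: filterS2. Qed.

Lemma ae_imply3 (P P' P'' Q : X -> Prop) : (forall x, P x -> P' x -> P'' x -> Q x) ->
  {ae mu, forall x, P x} -> {ae mu, forall x, P' x} -> {ae mu, forall x, P'' x} ->
  {ae mu, forall x, Q x}.
Proof. exact: filterS3. Qed.

End almost_everywhere.

(** No integrability is assumed: Tonelli's theorem is applied to the positive and the negative
    part. *)
Lemma measurable_integral_param {R : realType} d d' (Z : measurableType d)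
    (Y : measurableType d') (nu : {sigma_finite_measure set Y -> \bar R})
    (f : Z * Y -> \bar R) : measurable_fun setT f ->
  measurable_fun setT (fun z => \int[nu]_y f (z, y))%E.
Proof.
move=> mf.
rewrite (_ : (fun z => _) = (fubini_F nu f^\+ \- fubini_F nu f^\-)%E).
  apply: emeasurable_funB.
    by apply: measurable_fun_fubini_tonelli_F => //; exact: measurable_funepos.
  by apply: measurable_fun_fubini_tonelli_F => //; exact: measurable_funeneg.
apply/funext => z; rewrite [LHS]integralE.
under eq_integral do rewrite funepos_comp/=.
by under [X in (_ - X)%E = _]eq_integral do rewrite funeneg_comp/=.
Qed.

Section product_sigma_finite.
Context {R : realType} d1 d2 {Y1 : measurableType d1} {Y2 : measurableType d2}
  (m1 : {sigma_finite_measure set Y1 -> \bar R}) (m2 : {sigma_finite_measure set Y2 -> \bar R}).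

Lemma sigma_finite_product : sigma_finite setT (m1 \x m2)%E.
Proof.
have /sigma_finiteP[F [FT ndF Foo]] := sigma_finiteT m1.
have /sigma_finiteP[G [GT ndG Goo]] := sigma_finiteT m2.
exists (fun n => F n `*` G n).
  apply/seteqP; split=> // -[x y] _.
  have [i _ Fi] : (\bigcup_i F i) x by rewrite -FT.
  have [j _ Gj] : (\bigcup_j G j) y by rewrite -GT.
  exists (maxn i j) => //; split => /=.
    by move: Fi; exact/subsetPset/ndF/leq_maxl.
  by move: Gj; exact/subsetPset/ndG/leq_maxr.
move=> n; have [mF Fn] := Foo n; have [mG Gn] := Goo n.
split; first exact: measurableX.
by rewrite product_measure1E// lte_mul_pinfty// ge0_fin_numE.
Qed.

(* In the library the canonical sigma-finite structure of [m1 \x m2] is shadowed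
   by the one for subprobabilities, and is not found for Lebesgue measure. *)
Definition sigma_finite_prod : {sigma_finite_measure set (Y1 * Y2)%type -> \bar R} :=
  HB.pack (product_measure1 m1 m2)
    (Measure_isSigmaFinite.Build _ _ _ (product_measure1 m1 m2) sigma_finite_product).

End product_sigma_finite.

Section weighted_fubini.
Context {R : realType} d d' {X : measurableType d} {Y : measurableType d'}
  (mu : {sigma_finite_measure set X -> \bar R}) (nu : {sigma_finite_measure set Y -> \bar R})
  (A : X -> R) (B : X * Y -> R) (C h : Y -> R).
Hypotheses (mA : measurable_fun setT A) (mB : measurable_fun setT B)
  (mh : measurable_fun setT h)
  (A0 : forall x, 0 <= A x) (B0 : forall z, 0 <= B z)
  (ABC : forall y, h y != 0 -> (\int[mu]_x (A x * B (x, y))%:E = (C y)%:E)%E)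
  (Ch : nu.-integrable setT (fun y => (C y * h y)%:E)).

Let K (z : X * Y) := A z.1 * B z * h z.2.

Let mK : measurable_fun setT K.
Proof.
apply: measurable_funM; last exact: (measurableT_comp mh).
by apply: measurable_funM => //; exact: (measurableT_comp mA).
Qed.

Let integral_normK y : (\int[mu]_x `|(K (x, y))%:E| = `|(C y * h y)%:E|)%E.
Proof.
have [h0|h0] := eqVneq (h y) 0.
  by rewrite h0 mulr0 abse0 integral0_eq// => x _; rewrite /K/= h0 mulr0 normr0.
have mAB : measurable_fun setT (fun x => A x * B (x, y)).
  apply: measurable_funM => //; apply: (measurableT_comp mB).
  exact: measurable_fun_pair.
have C0 : 0 <= C y.
  by rewrite -lee_fin -ABC//; apply: integral_ge0 => x _; rewrite lee_fin mulr_ge0.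
under eq_integral do rewrite /K/= normrM (ger0_norm (mulr_ge0 (A0 _) (B0 _))) EFinM.
rewrite ge0_integralZr//.
- by rewrite ABC//= normrM (ger0_norm C0).
- exact/measurable_EFinP.
- by move=> x _; rewrite lee_fin mulr_ge0.
Qed.

Let integrableK : (mu \x nu)%E.-integrable setT (EFin \o K).
Proof.
apply/integrable21ltyP; first exact/measurable_EFinP.
under eq_integral do rewrite integral_normK.
by have /integrableP[] := Ch.
Qed.

Let integralK y : (\int[mu]_x (K (x, y))%:E = (C y * h y)%:E)%E.
Proof.
have [h0|h0] := eqVneq (h y) 0.
  by rewrite h0 mulr0 integral0_eq// => x _; rewrite /K/= h0 mulr0.
have mAB : measurable_fun setT (fun x => A x * B (x, y)).
  apply: measurable_funM => //; apply: (measurableT_comp mB).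
  exact: measurable_fun_pair.
under eq_integral do rewrite /K/= EFinM.
rewrite integralZr//; first by rewrite ABC.
apply/integrableP; split; first exact/measurable_EFinP.
rewrite (_ : integral _ _ _ = (C y)%:E) ?ltry// -ABC//.
by apply: eq_integral => x _; rewrite gee0_abs// lee_fin mulr_ge0.
Qed.

(** Almost every slice of [K] is integrable. Where A x is nonzero, dividing by it makes B h
    integrable, so the real-valued inner integral is not a default value; where A x = 0 both sides
    vanish. *)
Let weighted_fubini_ae : {ae mu, forall x,
  (\int[nu]_y (K (x, y))%:E = (A x * \int[nu]_y (B (x, y) * h y))%:E)%E}.
Proof.
apply: filterS (ae_integrable1 integrableK) => x iK.
have [Ax0|Ax0] := eqVneq (A x) 0.
  by rewrite Ax0 mul0r integral0_eq// => y _; rewrite /K/= Ax0 !mul0r.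
have iBh : nu.-integrable setT (fun y => (B (x, y) * h y)%:E).
  have := integrableZl measurableT (A x)^-1 iK; apply: eq_integrable => // y _ /=.
  by rewrite /K/= -EFinM !mulrA mulVf// mul1r.
rewrite EFinM /Rintegral fineK; last exact: integrable_fin_num.
by rewrite -integralZl//; apply: eq_integral => y _; rewrite /K/= -mulrA EFinM.
Qed.

(** Applied with [A] and [B] heat kernels and [C] their composition, for a signed [h]. The identity
    between them is asked only where h is nonzero: for Duhamel terms h contains the indicator of the
    time interval, outside which the kernel times need not be positive. *)
Lemma integrable_weighted_fubini :
  mu.-integrable setT (fun x => (A x * \int[nu]_y (B (x, y) * h y))%:E).
Proof.
have iF := integrable_fubini_F integrableK.
have mI : measurable_fun setT (fun x => (A x * \int[nu]_y (B (x, y) * h y))%:E).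
  apply/measurable_EFinP; apply: measurable_funM => //; apply: measurableT_comp => //.
  apply: (measurable_integral_param nu (f := fun z => (B z * h z.2)%:E)).
  by apply/measurable_EFinP; apply: measurable_funM => //; exact: (measurableT_comp mh).
apply/integrableP; split => //.
have /integrableP[mF] := iF; apply: le_lt_trans.
apply: ae_ge0_le_integral => //; [exact: measurableT_comp|exact: measurableT_comp|].
by apply: filterS weighted_fubini_ae => x <- _.
Qed.

Lemma weighted_fubini :
  \int[mu]_x (A x * \int[nu]_y (B (x, y) * h y)) = \int[nu]_y (C y * h y).
Proof.
rewrite /Rintegral; congr fine.
transitivity (\int[mu]_x \int[nu]_y (K (x, y))%:E)%E.
  apply: ae_eq_integral => //.
  - by have /integrableP[] := integrable_weighted_fubini.
  - exact: measurable_fubini_F integrableK.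
  - by apply: filterS weighted_fubini_ae => x -> _.
rewrite (integral12_prod_meas1 integrableK) -(integral21_prod_meas1 integrableK).
by apply: eq_integral => y _; rewrite /fubini_G /= integralK.
Qed.

End weighted_fubini.

(** * The heat semigroup and Duhamel's formula *)

Section semigroup.
Context {R : realType} d (X : measurableType d)
  (mu : {sigma_finite_measure set X -> \bar R}) (G : R -> X -> X -> R)
  (KG : semigroup_kernel mu G).
Local Notation leb1 := (@lebesgue_measure R).
Local Notation Rm := (measurableTypeR R).
Implicit Types (s t a b c r : R) (x y : X) (F : X -> \bar R) (P Q : R -> X -> \bar R).
Local Open Scope ereal_scope.

Let G0 t x y : (0 <= G t x y)%R. Proof. exact: kernel_ge0 KG _ _ _. Qed.
#[local] Hint Resolve G0 : core.

Lemma measurable_kernel_comp d' (Z : measurableType d') (tau : Z -> Rm) (xi eta : Z -> X) :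
  measurable_fun setT tau -> measurable_fun setT xi -> measurable_fun setT eta ->
  measurable_fun setT (fun z => G (tau z) (xi z) (eta z)).
Proof.
move=> mt mx me.
apply: (measurableT_comp (measurable_kernel KG) (g := fun z => (tau z, (xi z, eta z)))).
by apply: measurable_fun_pair => //; exact: measurable_fun_pair.
Qed.

(* The suffix E marks integrals of nonnegative extended-real functions, which
   need no integrability; heatR and duhR are their real-valued counterparts. *)
Definition heatE t F x := \int[mu]_y ((G t x y)%:E * F y).

Definition duhE a t P x := \int[leb1]_(s in `]a, t[) heatE (t - s) (P s) x.

Definition pmeasurable P := measurable_fun setT (fun z : Rm * X => P z.1 z.2).

Lemma pmeasurable_slice P s : pmeasurable P -> measurable_fun setT (P s).
Proof.
move=> mP; apply: (measurableT_comp mP (g := fun y => (s : Rm, y))).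
exact: measurable_fun_pair.
Qed.

Lemma heatE_ge0 t F x : (forall y, 0 <= F y) -> 0 <= heatE t F x.
Proof. by move=> F0; apply: integral_ge0 => y _; rewrite mule_ge0// lee_fin. Qed.

Lemma duhE_ge0 a t P x : (forall s y, 0 <= P s y) -> 0 <= duhE a t P x.
Proof. by move=> P0; apply: integral_ge0 => y _; exact: heatE_ge0. Qed.

Lemma measurable_heatE_integrand t F x : measurable_fun setT F ->
  measurable_fun setT (fun y => (G t x y)%:E * F y).
Proof.
move=> mF; apply: emeasurable_funM => //; apply/measurable_EFinP.
by apply: measurable_kernel_comp.
Qed.

Lemma measurable_heatE_param d' (Z : measurableType d') (tau : Z -> Rm) (xi : Z -> X)
    (Q : Z -> X -> \bar R) :
  measurable_fun setT tau -> measurable_fun setT xi ->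
  measurable_fun setT (fun w : Z * X => Q w.1 w.2) -> (forall z y, 0 <= Q z y) ->
  measurable_fun setT (fun z => heatE (tau z) (Q z) (xi z)).
Proof.
move=> mt mx mQ Q0.
apply: (measurable_fun_fubini_tonelli_F
  (fun w : Z * X => (G (tau w.1) (xi w.1) w.2)%:E * Q w.1 w.2)) => /=.
  apply: emeasurable_funM => //; apply/measurable_EFinP.
  apply: measurable_kernel_comp; last exact: measurable_snd.
    by apply: measurableT_comp.
  by apply: measurableT_comp.
by move=> w; rewrite mule_ge0// lee_fin.
Qed.

Lemma measurable_heatE t F : measurable_fun setT F -> (forall y, 0 <= F y) ->
  measurable_fun setT (heatE t F).
Proof.
move=> mF F0; apply: (measurable_heatE_param (Q := fun=> F)) => //.
by apply: (measurableT_comp mF).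
Qed.

Lemma measurable_duhE_integrand t P x : pmeasurable P -> (forall s y, 0 <= P s y) ->
  measurable_fun setT (fun s : Rm => heatE (t - s) (P s) x).
Proof.
move=> mP P0; apply: (measurable_heatE_param (Z := Rm) (tau := fun s => (t - s)%R)
  (xi := fun=> x) (Q := P)) => //.
by apply: measurable_funB.
Qed.

Lemma le_heatE t F F' x : measurable_fun setT F -> measurable_fun setT F' ->
  (forall y, 0 <= F y) -> (forall y, 0 <= F' y) ->
  {ae mu, forall y, F y <= F' y} -> heatE t F x <= heatE t F' x.
Proof.
move=> mF mF' F0 F'0 FF'; apply: ae_ge0_le_integral => //.
- by move=> y _; rewrite mule_ge0// lee_fin.
- exact: measurable_heatE_integrand.
- by move=> y _; rewrite mule_ge0// lee_fin.
- exact: measurable_heatE_integrand.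
- by apply: filterS FF' => y FF' _; rewrite lee_wpmul2l// lee_fin.
Qed.

Lemma le_duhE a t P Q x : pmeasurable P -> pmeasurable Q ->
  (forall s y, 0 <= P s y) -> (forall s y, 0 <= Q s y) ->
  {ae leb1, forall s, (a < s < t)%R -> {ae mu, forall y, P s y <= Q s y}} ->
  duhE a t P x <= duhE a t Q x.
Proof.
move=> mP mQ P0 Q0 PQ; apply: ae_ge0_le_integral => //.
- by move=> s _; exact: heatE_ge0.
- by apply: measurable_funTS; exact: measurable_duhE_integrand.
- by move=> s _; exact: heatE_ge0.
- by apply: measurable_funTS; exact: measurable_duhE_integrand.
- apply: ae_imply PQ => s PQ /=; rewrite in_itv/= => ast.
  apply: le_heatE; last exact: PQ.
  - exact: pmeasurable_slice. - exact: pmeasurable_slice. - exact: P0. - exact: Q0.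
Qed.

Lemma heatE_cst t x r : (0 < t)%R -> heatE t (cst r%:E) x = r%:E.
Proof.
move=> t0; rewrite /heatE /=.
under eq_integral do rewrite muleC.
rewrite integralZl//; first by rewrite (kernel_mass KG)// mule1.
apply/integrableP; split; first by apply/measurable_EFinP; exact: measurable_kernel_comp.
by under eq_integral do rewrite gee0_abs ?lee_fin//; rewrite (kernel_mass KG)// ltry.
Qed.

Lemma heatEZ t F x r : measurable_fun setT F -> (forall y, 0 <= F y) -> (0 <= r)%R ->
  heatE t (fun y => r%:E * F y) x = r%:E * heatE t F x.
Proof.
move=> mF F0 r0; rewrite /heatE.
under eq_integral do rewrite muleCA.
rewrite ge0_integralZl_EFin//; first by move=> y _; rewrite mule_ge0// lee_fin.
exact: measurable_heatE_integrand.
Qed.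

Lemma heatED t F F' x : measurable_fun setT F -> measurable_fun setT F' ->
  (forall y, 0 <= F y) -> (forall y, 0 <= F' y) ->
  heatE t (fun y => F y + F' y) x = heatE t F x + heatE t F' x.
Proof.
move=> mF mF' F0 F'0; rewrite /heatE.
under eq_integral do rewrite ge0_muleDr//.
rewrite ge0_integralD//.
- by move=> y _; rewrite mule_ge0// lee_fin.
- exact: measurable_heatE_integrand.
- by move=> y _; rewrite mule_ge0// lee_fin.
- exact: measurable_heatE_integrand.
Qed.

Lemma heatE_heatE s t F x : (0 < s)%R -> (0 < t)%R ->
  measurable_fun setT F -> (forall y, 0 <= F y) ->
  heatE s (heatE t F) x = heatE (s + t) F x.
Proof.
move=> s0 t0 mF F0; rewrite /heatE.
transitivity (\int[mu]_y \int[mu]_z ((G s x y * G t y z)%:E * F z)).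
  apply: eq_integral => y _; rewrite -ge0_integralZl_EFin//.
  - by apply: eq_integral => z _; rewrite muleA EFinM.
  - by move=> z _; rewrite mule_ge0// lee_fin.
  - exact: measurable_heatE_integrand.
rewrite (fubini_tonelli (m1 := mu) (m2 := mu)
  (fun w : X * X => (G s x w.1 * G t w.1 w.2)%:E * F w.2)) /=.
- apply: eq_integral => z _; rewrite ge0_integralZr//.
  + by rewrite (kernelD KG).
  + apply/measurable_EFinP; apply: measurable_funM; exact: measurable_kernel_comp.
  + by move=> y _; rewrite lee_fin mulr_ge0.
- apply: emeasurable_funM; last exact: measurableT_comp.
  by apply/measurable_EFinP; apply: measurable_funM; apply: measurable_kernel_comp.
- by move=> w; rewrite mule_ge0// lee_fin mulr_ge0.
Qed.

(** The times t - s and s - c add up to t - c whatever s is, so the heat factor leaves the time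
    integral. The base time [c] is 0 in the contraction estimate and the restart time in
    [comparison]. *)
Lemma duhE_heatE a t c (k : R -> R) F x : (c <= a)%R ->
  measurable_fun setT (k : Rm -> R) -> (forall s, (a < s < t)%R -> 0 <= k s)%R ->
  measurable_fun setT F -> (forall y, 0 <= F y) ->
  duhE a t (fun s y => (k s)%:E * heatE (s - c) F y) x =
  (\int[leb1]_(s in `]a, t[) (k s)%:E) * heatE (t - c) F x.
Proof.
move=> ca mk k0 mF F0; rewrite /duhE.
transitivity (\int[leb1]_(s in `]a, t[) ((k s)%:E * heatE (t - c) F x)).
  apply: eq_integral => s; rewrite inE/= in_itv/= => /andP[as_ st].
  rewrite heatEZ ?k0 ?as_ ?st//.
  - rewrite heatE_heatE ?subr_gt0 ?(le_lt_trans ca)//.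
    by rewrite addrA subrK.
  - exact: measurable_heatE.
  - by move=> y; exact: heatE_ge0.
rewrite ge0_integralZr//.
- by apply/measurable_EFinP; exact: measurable_funTS.
- exact: heatE_ge0.
Qed.

Lemma duhE_cst a t (k : R -> R) x :
  duhE a t (fun s _ => (k s)%:E) x = \int[leb1]_(s in `]a, t[) (k s)%:E.
Proof.
apply: eq_integral => s; rewrite inE/= in_itv/= => /andP[as_ st].
by rewrite (heatE_cst x (k s))// subr_gt0.
Qed.

Lemma duhEZ a t P x r : pmeasurable P -> (forall s y, 0 <= P s y) -> (0 <= r)%R ->
  duhE a t (fun s y => r%:E * P s y) x = r%:E * duhE a t P x.
Proof.
move=> mP P0 r0; rewrite /duhE -ge0_integralZl_EFin//.
- by apply: eq_integral => s _; rewrite heatEZ//; exact: pmeasurable_slice.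
- by move=> s _; exact: heatE_ge0.
- by apply: measurable_funTS; exact: measurable_duhE_integrand.
Qed.

Lemma duhED a t P Q x : pmeasurable P -> pmeasurable Q ->
  (forall s y, 0 <= P s y) -> (forall s y, 0 <= Q s y) ->
  duhE a t (fun s y => P s y + Q s y) x = duhE a t P x + duhE a t Q x.
Proof.
move=> mP mQ P0 Q0; rewrite /duhE -ge0_integralD//.
- by apply: eq_integral => s _; rewrite heatED//; exact: pmeasurable_slice.
- by move=> s _; exact: heatE_ge0.
- by apply: measurable_funTS; exact: measurable_duhE_integrand.
- by move=> s _; exact: heatE_ge0.
- by apply: measurable_funTS; exact: measurable_duhE_integrand.
Qed.

Lemma le0_geometric (r : \bar R) (c : R) :
  (forall n, r <= (c / 2 ^+ n)%:E) -> r <= 0.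
Proof.
move=> h; rewrite leNgt; apply/negP => r0.
have rfin : r \is a fin_num.
  by rewrite ge0_fin_numE ?ltW//; exact: le_lt_trans (h 0%N) (ltry _).
move: r0 h; rewrite -(fineK rfin) lte_fin; set q := fine r => q0 h.
have := h (Num.truncn (c / q)); rewrite lee_fin; apply/negP; rewrite -ltNge.
rewrite ltr_pdivrMr ?exprn_gt0// mulrC -ltr_pdivrMr//.
apply: (lt_le_trans (truncnS_gt _)); rewrite -natrX ler_nat; exact: ltn_expl.
Qed.

(* If P t <= c * expR (2 * L * t), then one more application of the hypothesis
   halves c. *)
Lemma gronwall_duhE a b (L M : R) P : pmeasurable P -> (forall s y, 0 <= P s y) ->
  (0 < L)%R -> (0 <= M)%R ->
  {ae leb1, forall s, (a < s < b)%R -> {ae mu, forall y, P s y <= M%:E}} ->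
  (forall t, (a < t < b)%R -> {ae mu, forall x, P t x <= L%:E * duhE a t P x}) ->
  forall t, (a < t < b)%R -> {ae mu, forall x, P t x = 0}.
Proof.
move=> mP P0 L0 M0 PM Pduh.
pose B n s : R := (M / 2 ^+ n * expR (2 * L * (s - a)))%R.
have B0 n s : (0 <= B n s)%R by rewrite mulr_ge0 ?expR_ge0// divr_ge0 ?exprn_ge0.
have mB n : measurable_fun setT (B n : Rm -> R).
  apply: measurable_funM => //; apply: measurableT_comp => //.
  by apply: measurable_funM => //; exact: measurable_funB.
have step n : {ae leb1, forall s, (a < s < b)%R -> {ae mu, forall y, P s y <= (B n s)%:E}} ->
    forall t, (a < t < b)%R -> {ae mu, forall x, P t x <= (B n.+1 t)%:E}.
  move=> IH t atb; apply: filterS (Pduh t atb) => x Ptx; apply: (le_trans Ptx).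
  have -> : (B n.+1 t)%:E = L%:E * (B n t / (2 * L))%:E.
    by rewrite -EFinM; congr EFin; rewrite /B exprS; field; rewrite !gt_eqF ?exprn_gt0.
  apply: lee_wpmul2l; first by rewrite lee_fin ltW.
  apply: (@le_trans _ _ (duhE a t (fun s _ => (B n s)%:E) x)).
    apply: le_duhE => //.
    - by apply/measurable_EFinP; apply: (measurableT_comp (mB n)).
    - by move=> s y; rewrite lee_fin.
    - apply: ae_imply IH => s h /andP[as_ st]; apply: h.
      by rewrite as_ (lt_trans st)//; case/andP: atb.
  rewrite duhE_cst.
  pose k : R := (M / 2 ^+ n * expR (- (2 * L * a)))%R.
  have k0 : (0 <= k)%R by rewrite mulr_ge0 ?expR_ge0// divr_ge0 ?exprn_ge0.
  have BE s : B n s = (k * expR (2 * L * s))%R.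
    by rewrite /B /k -[RHS]mulrA -expRD; congr (_ * expR _)%R; ring.
  under eq_integral do rewrite BE EFinM.
  rewrite ge0_integralZl_EFin//; last first.
    apply/measurable_EFinP; apply: measurable_funTS; apply: (measurableT_comp (@measurable_expR R)).
    exact: (measurable_funM (f := (fun=> 2 * L)%R) (g := id)).
  rewrite (_ : B n t / (2 * L) = k * (expR (2 * L * t) / (2 * L)))%R; last by rewrite BE mulrA.
  rewrite [leRHS]EFinM; apply: lee_wpmul2l; rewrite ?lee_fin//.
  by apply: integral_expR_le; rewrite mulr_gt0.
have allB n : forall t, (a < t < b)%R -> {ae mu, forall x, P t x <= (B n.+1 t)%:E}.
  elim: n => [|n IHn]; apply: step.
    apply: ae_imply PM => s h as_; apply: filterS (h as_) => y Py.
    apply: (le_trans Py); rewrite lee_fin /B expr0 divr1 ler_peMr//.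
    rewrite -expR0 ler_expR mulr_ge0// ?mulr_ge0 ?ltW// subr_gt0.
    by case/andP: as_.
  by apply: aeW => s as_; exact: IHn.
move=> t atb; have /ae_foralln := fun n => allB n t atb.
apply: filterS => x Px; apply/eqP; rewrite eq_le P0 andbT.
apply: (@le0_geometric _ (M / 2 * expR (2 * L * (t - a)))) => n.
apply: (le_trans (Px n)); rewrite lee_fin /B exprS le_eqVlt; apply/orP; left; apply/eqP.
by field; rewrite expf_neq0.
Qed.

Local Notation mu2 := (leb1 \x mu).

Lemma measurable_indic_fst (D : set Rm) : measurable D ->
  measurable_fun setT (fun z : Rm * X => \1_D z.1 : R).
Proof. by move=> mD; exact: (measurableT_comp ((measurable_indicP _ D).1 mD) measurable_fst). Qed.

(** The kernel time [tau s] is kept general because, besides t - s, the time 2 (t' - s) will occur,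
    produced by the Lipschitz bound of the kernel in time. *)
Lemma integral_prod_heatE (D : set Rm) (tau : Rm -> Rm) Q x :
  measurable D -> measurable_fun setT tau -> pmeasurable Q -> (forall s y, 0 <= Q s y) ->
  \int[mu2]_z ((\1_D z.1)%:E * ((G (tau z.1) x z.2)%:E * Q z.1 z.2)) =
  \int[leb1]_(s in D) heatE (tau s) (Q s) x.
Proof.
move=> mD mt mQ Q0; rewrite fubini_tonelli1/=; last 2 first.
- apply: emeasurable_funM.
    by apply/measurable_EFinP; exact: measurable_indic_fst.
  apply: emeasurable_funM => //; apply/measurable_EFinP; apply: measurable_kernel_comp => //.
  exact: (measurableT_comp mt measurable_fst).
- by move=> z; rewrite mule_ge0 ?lee_fin// mule_ge0 ?lee_fin.
rewrite [RHS]integral_mkcond; apply: eq_integral => s _; rewrite /fubini_F /= patchE.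
case: ifPn => sD.
  by rewrite /heatE; apply: eq_integral => y _; rewrite indicE sD mul1e.
by apply: integral0_eq => y _; rewrite indicE (negPf sD) mul0e.
Qed.

(* The indicator lets Duhamel integrals over different time intervals be
   compared under a single integral sign. *)
Definition duhK (D : set R) t x (F : R -> X -> R) (z : Rm * X) : R :=
  (\1_D z.1 * (G (t - z.1) x z.2 * F z.1 z.2))%R.

Definition rmeasurable (F : R -> X -> R) :=
  measurable_fun setT (fun z : Rm * X => F z.1 z.2).

Lemma rmeasurable_slice (F : R -> X -> R) s : rmeasurable F -> measurable_fun setT (F s).
Proof.
move=> mF; apply: (measurableT_comp mF (g := fun y => (s : Rm, y))).
exact: measurable_fun_pair.
Qed.

Lemma rmeasurable_norm (F : R -> X -> R) : rmeasurable F ->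
  pmeasurable (fun s y => `|F s y|%:E).
Proof. by move=> mF; apply/measurable_EFinP; apply: measurableT_comp. Qed.

Lemma measurable_duhK (D : set Rm) t x (F : R -> X -> R) : measurable D -> rmeasurable F ->
  measurable_fun setT (duhK D t x F).
Proof.
move=> mD mF; apply: measurable_funM.
  exact: measurable_indic_fst.
apply: measurable_funM => //; apply: measurable_kernel_comp => //.
by apply: measurable_funB => //; exact: measurable_fst.
Qed.

Lemma integral_norm_duhK (D : set Rm) t x (F : R -> X -> R) : measurable D -> rmeasurable F ->
  \int[mu2]_z `|(duhK D t x F z)%:E| =
  \int[leb1]_(s in D) heatE (t - s) (fun y => `|F s y|%:E) x.
Proof.
move=> mD mF; rewrite -(integral_prod_heatE (Q := fun s y => `|F s y|%:E))//.
- apply: eq_integral => z _; rewrite /duhK /= !normrM ger0_norm// (ger0_norm (G0 _ _ _)).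
  by rewrite !EFinM.
- exact: measurable_funB.
- exact: rmeasurable_norm.
Qed.

Lemma integrable_duhK (D : set Rm) t x (F : R -> X -> R) : measurable D -> rmeasurable F ->
  \int[leb1]_(s in D) heatE (t - s) (fun y => `|F s y|%:E) x < +oo ->
  mu2.-integrable setT (EFin \o duhK D t x F).
Proof.
move=> mD mF Foo; apply/integrableP; split.
  by apply/measurable_EFinP; exact: measurable_duhK.
by rewrite /= integral_norm_duhK.
Qed.

(** One integral over space-time instead of the iterated one, so that linearity and the triangle
    inequality follow from integrability of the integrand alone. *)
Definition duhR a t (F : R -> X -> R) x : R := (\int[mu2]_z duhK `]a, t[ t x F z)%R.

Definition heatR t (f : X -> R) x : R := (\int[mu]_y (G t x y * f y))%R.

Lemma integrable_duhR a t (F : R -> X -> R) x : rmeasurable F ->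
  duhE a t (fun s y => `|F s y|%:E) x < +oo ->
  mu2.-integrable setT (EFin \o duhK `]a, t[ t x F).
Proof. by move=> mF Foo; exact: integrable_duhK. Qed.

Lemma le_duhR_sub a t (F F' : R -> X -> R) x : rmeasurable F -> rmeasurable F' ->
  duhE a t (fun s y => `|F s y|%:E) x < +oo ->
  duhE a t (fun s y => `|F' s y|%:E) x < +oo ->
  `|duhR a t F x - duhR a t F' x|%:E <= duhE a t (fun s y => `|F s y - F' s y|%:E) x.
Proof.
move=> mF mF' Foo F'oo; have i1 := integrable_duhR mF Foo; have i2 := integrable_duhR mF' F'oo.
rewrite /duhR -RintegralB// EFin_normr_Rintegral//; last first.
  by have := integrableB measurableT i1 i2.
apply: (le_trans (le_abse_integral _ _ _)) => //.
  by apply/measurable_EFinP; apply: measurable_funB; exact: measurable_duhK.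
rewrite /duhE -(@integral_norm_duhK `]a, t[ t x (fun s y => F s y - F' s y)%R)//.
  rewrite le_eqVlt; apply/orP; left; apply/eqP; apply: eq_integral => z _ /=.
  by congr (`|_|%:E); rewrite /duhK; ring.
exact: measurable_funB.
Qed.

Lemma le_duhR a t (F : R -> X -> R) x : rmeasurable F ->
  duhE a t (fun s y => `|F s y|%:E) x < +oo ->
  `|duhR a t F x|%:E <= duhE a t (fun s y => `|F s y|%:E) x.
Proof.
move=> mF Foo; have i1 := integrable_duhR mF Foo.
rewrite /duhR EFin_normr_Rintegral// /duhE -(integral_norm_duhK _ _ _ mF)//.
by apply: le_abse_integral => //; apply/measurable_EFinP; exact: measurable_duhK.
Qed.

Lemma integrable_heatR t (f : X -> R) x : measurable_fun setT f ->
  heatE t (fun y => `|f y|%:E) x < +oo ->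
  mu.-integrable setT (fun y => (G t x y * f y)%:E).
Proof.
move=> mf foo; apply/integrableP; split.
  by apply/measurable_EFinP; apply: measurable_funM => //; exact: measurable_kernel_comp.
rewrite (eq_integral (fun y => (G t x y)%:E * `|f y|%:E))// => y _.
by rewrite /= normrM ger0_norm// EFinM.
Qed.

Lemma le_heatR t (f : X -> R) x : measurable_fun setT f ->
  heatE t (fun y => `|f y|%:E) x < +oo ->
  `|heatR t f x|%:E <= heatE t (fun y => `|f y|%:E) x.
Proof.
move=> mf foo; have i1 := integrable_heatR mf foo.
rewrite /heatR EFin_normr_Rintegral//.
apply: (le_trans (le_abse_integral _ _ _)) => //.
  exact: (measurable_int mu).
rewrite le_eqVlt; apply/orP; left; apply/eqP; apply: eq_integral => y _ /=.
by rewrite normrM ger0_norm// EFinM.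
Qed.

Lemma integrable_duhamelP t (F : R -> X -> R) x : rmeasurable F ->
  mu2.-integrable (`]0%R, t[ `*` [set: X]) (fun z => (G (t - z.1) x z.2 * F z.1 z.2)%:E) <->
  duhE 0 t (fun s y => `|F s y|%:E) x < +oo.
Proof.
move=> mF.
have mD : measurable (`]0%R, t[ `*` [set: X] : set (Rm * X)) by exact: measurableX.
rewrite (integrable_mkcond _ mD) (_ : _ \_ _ = EFin \o duhK `]0%R, t[ t x F).
  split; last exact: integrable_duhR.
  by move=> /integrableP[_]; rewrite /= integral_norm_duhK.
apply/funext => z; rewrite patchE /duhK /= indicE.
have -> : (z \in `]0%R, t[ `*` [set: X]) = (z.1 \in `]0%R, t[%classic).
  by apply/idP/idP; rewrite !inE/=; [case|].
by case: ifPn => _; rewrite ?mul1r ?mul0r.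
Qed.

(** Fubini's theorem. The slices are integrable for almost every s only; at the other times the
    inner real-valued integral may be a default value, which the time integral does not see. *)
Lemma duhR_iterated t (F : R -> X -> R) x : rmeasurable F ->
  duhE 0 t (fun s y => `|F s y|%:E) x < +oo ->
  duhR 0 t F x = (\int[leb1]_(s in `]0%R, t[) heatR (t - s) (F s) x)%R.
Proof.
move=> mF Foo; have i1 := integrable_duhR mF Foo.
rewrite /duhR /Rintegral -integral12_prod_meas1//; congr fine.
rewrite [RHS]integral_mkcond.
apply: ae_eq_integral => //.
- exact: measurable_fubini_F i1.
- rewrite (_ : _ \_ _ = fun s => (fine (fubini_F mu (EFin \o duhK `]0%R, t[ t x F) s))%:E).
    by apply/measurable_EFinP; apply: measurableT_comp => //; exact: measurable_fubini_F i1.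
  apply/funext => s; rewrite patchE /fubini_F /duhK /=.
  case: ifPn => sD; last first.
    by rewrite integral0_eq// => y _; rewrite indicE (negPf sD) mul0r.
  rewrite /heatR /Rintegral; congr (fine _)%:E; apply: eq_integral => y _.
  by rewrite indicE sD mul1r.
- have := ae_integrable1 i1.
  apply: ae_imply => s si _; rewrite patchE /fubini_F.
  case: ifPn => sD; last first.
    by rewrite integral0_eq// => y _; rewrite /duhK /= indicE (negPf sD) mul0r.
  rewrite /heatR /Rintegral -(_ : \int[mu]_y (duhK `]0%R, t[ t x F (s, y))%:E =
    \int[mu]_y (G (t - s) x y * F s y)%:E); last first.
    by apply: eq_integral => y _; rewrite /duhK /= indicE sD mul1r.
  by rewrite fineK//; exact: integrable_fin_num.
Qed.

Lemma measurable_heatR (u0 : X -> R) : measurable_fun setT u0 ->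
  measurable_fun setT (fun z : Rm * X => heatR z.1 u0 z.2).
Proof.
move=> mu0; apply: measurableT_comp => //.
pose f (w : (Rm * X) * X) : \bar R := (G w.1.1 w.1.2 w.2 * u0 w.2)%:E.
have mf : measurable_fun setT f.
  apply/measurable_EFinP; apply: measurable_funM; last exact: (measurableT_comp mu0 measurable_snd).
  apply: measurable_kernel_comp => //.
    exact: (measurableT_comp measurable_fst measurable_fst).
  exact: (measurableT_comp measurable_snd measurable_fst).
exact: (measurable_integral_param mu mf).
Qed.

Lemma measurable_duhR a (F : R -> X -> R) : rmeasurable F ->
  measurable_fun setT (fun z : Rm * X => duhR a z.1 F z.2).
Proof.
move=> mF; apply: measurableT_comp => //.
pose f (w : (Rm * X) * (Rm * X)) : \bar R := (duhK `]a, w.1.1[ w.1.1 w.1.2 F w.2)%:E.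
have mf : measurable_fun setT f.
  apply/measurable_EFinP; apply: measurable_funM.
    (* The time interval moves with the variable, so its indicator is written as a test that is
       measurable jointly in both times. *)
    rewrite (_ : (fun _ => _) = (fun w : (Rm * X) * (Rm * X) =>
      if (a < w.2.1)%R && (w.2.1 < w.1.1)%R then 1%R else 0%R)); last first.
      apply/funext => w; rewrite indicE mem_setE in_itv/=.
      by case: ifP.
    apply: measurable_fun_ifT => //; apply: measurable_and; apply: measurable_fun_ltr => //.
    - exact: (measurableT_comp measurable_fst measurable_snd).
    - exact: (measurableT_comp measurable_fst measurable_snd).
    - exact: (measurableT_comp measurable_fst measurable_fst).
  apply: measurable_funM; last exact: (measurableT_comp mF measurable_snd).
  apply: measurable_kernel_comp.
  - apply: measurable_funB; first exact: (measurableT_comp measurable_fst measurable_fst).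
    exact: (measurableT_comp measurable_fst measurable_snd).
  - exact: (measurableT_comp measurable_snd measurable_fst).
  - exact: (measurableT_comp measurable_snd measurable_snd).
exact: (measurable_integral_param (sigma_finite_prod leb1 mu) mf).
Qed.

Lemma heatR_heatR_aux s t (f : X -> R) x : (0 < s)%R -> (0 < t)%R ->
  measurable_fun setT f -> heatE (s + t) (fun y => `|f y|%:E) x < +oo ->
  mu.-integrable setT (fun z => (G s x z * heatR t f z)%:E) /\
  heatR s (heatR t f) x = heatR (s + t) f x.
Proof.
move=> s0 t0 mf foo.
pose B (z : X * X) := G t z.1 z.2.
have mA : measurable_fun setT (G s x) by exact: measurable_kernel_comp.
have mB : measurable_fun setT B by exact: measurable_kernel_comp.
have ABC y : f y != 0%R -> \int[mu]_z (G s x z * B (z, y))%:E = (G (s + t) x y)%:E.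
  by move=> _; rewrite (kernelD KG).
have iC := integrable_heatR mf foo.
split; first exact: (integrable_weighted_fubini mA mB mf (G0 _ _) (fun z => G0 _ _ _) ABC iC).
exact: (weighted_fubini mA mB mf (G0 _ _) (fun z => G0 _ _ _) ABC iC).
Qed.

(** Since (t - e) + (e - s) = t - s, the semigroup over t - e turns the Duhamel term at time e into
    the part over (0, e) of the Duhamel term at time t. *)
Lemma heatR_duhR_aux e t (F : R -> X -> R) x : (0 < e < t)%R -> rmeasurable F ->
  duhE 0 t (fun s y => `|F s y|%:E) x < +oo ->
  [/\ mu.-integrable setT (fun z => (G (t - e) x z * duhR 0 e F z)%:E),
     mu2.-integrable setT (EFin \o duhK `]0%R, e[ t x F) &
  heatR (t - e) (duhR 0 e F) x = (\int[mu2]_z duhK `]0%R, e[ t x F z)%R].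
Proof.
move=> /andP[e0 et] mF Foo.
pose B (z : X * (Rm * X)) := G (e - z.2.1) z.1 z.2.2.
pose h (w : Rm * X) := (\1_`]0%R, e[ w.1 * F w.1 w.2)%R.
pose C (w : Rm * X) := G (t - w.1) x w.2.
have iK : mu2.-integrable setT (EFin \o duhK `]0%R, e[ t x F).
  apply: integrable_duhK => //; apply: le_lt_trans Foo.
  apply: ge0_subset_integral => //=.
  - by apply: measurable_funTS; apply: measurable_duhE_integrand => //; exact: rmeasurable_norm.
  - by move=> s _; apply: heatE_ge0 => y; rewrite lee_fin.
  - by move=> s /=; rewrite !in_itv/= => /andP[-> /lt_trans ->].
have mA : measurable_fun setT (G (t - e) x) by exact: measurable_kernel_comp.
have mB : measurable_fun setT B.
  apply: measurable_kernel_comp => //.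
    by apply: measurable_funB => //; exact: (measurableT_comp measurable_fst measurable_snd).
  exact: (measurableT_comp measurable_snd measurable_snd).
have mh : measurable_fun setT h.
  by apply: measurable_funM => //; exact: measurable_indic_fst.
have ABC w : h w != 0%R -> \int[mu]_z (G (t - e) x z * B (z, w))%:E = (C w)%:E.
  rewrite /h indicE; case: (boolP (_ \in _)); last by rewrite mul0r eqxx.
  rewrite inE/= in_itv/= => /andP[w0 we] _.
  by rewrite /B/= (kernelD KG) ?subr_gt0// addrA subrK.
have iC : mu2.-integrable setT (fun w => (C w * h w)%:E).
  by move: iK; apply: eq_integrable => // w _ /=; rewrite /duhK /C /h mulrCA.
have duhRE z : duhR 0 e F z = (\int[mu2]_w (B (z, w) * h w))%R.
  by apply: eq_Rintegral => w _; rewrite /duhK /B /h/= mulrCA.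
pose nu := sigma_finite_prod leb1 mu.
split => //.
  under eq_fun do rewrite duhRE.
  exact: (integrable_weighted_fubini (nu := nu) mA mB mh (G0 _ _) (fun z => G0 _ _ _) ABC iC).
rewrite /heatR; under eq_Rintegral do rewrite duhRE.
rewrite (weighted_fubini (nu := nu) mA mB mh (G0 _ _) (fun z => G0 _ _ _) ABC iC)//.
by apply: eq_Rintegral => w _; rewrite /duhK /C /h mulrCA.
Qed.

(* Duhamel's formula restarted at time [e]. *)
Lemma duhamel_shift_le e t (u0 v : X -> R) (F : R -> X -> R) x : (0 < e < t)%R ->
  measurable_fun setT u0 -> measurable_fun setT v -> rmeasurable F ->
  heatE t (fun y => `|u0 y|%:E) x < +oo ->
  duhE 0 t (fun s y => `|F s y|%:E) x < +oo ->
  {ae mu, forall z, v z = (heatR e u0 z + duhR 0 e F z)%R} ->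
  `|heatR t u0 x + duhR 0 t F x|%:E <=
    heatE (t - e) (fun y => `|v y|%:E) x + duhE e t (fun s y => `|F s y|%:E) x.
Proof.
move=> /andP[e0 et] mu0 mv mF u0oo Foo vE.
have te0 : (0 < t - e)%R by rewrite subr_gt0.
have [i1 h1] : mu.-integrable setT (fun z => (G (t - e) x z * heatR e u0 z)%:E) /\
    heatR (t - e) (heatR e u0) x = heatR t u0 x.
  by have := @heatR_heatR_aux (t - e) e u0 x te0 e0 mu0; rewrite subrK; exact.
have [i2 i3 h2] : [/\ mu.-integrable setT (fun z => (G (t - e) x z * duhR 0 e F z)%:E),
     mu2.-integrable setT (EFin \o duhK `]0%R, e[ t x F) &
  heatR (t - e) (duhR 0 e F) x = (\int[mu2]_z duhK `]0%R, e[ t x F z)%R].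
  by apply: heatR_duhR_aux => //; rewrite e0.
have hv : heatR (t - e) v x = (heatR t u0 x + \int[mu2]_z duhK `]0%R, e[ t x F z)%R.
  rewrite -h1 -h2 /heatR -RintegralD//; congr fine; apply: ae_eq_integral => //.
  - apply/measurable_EFinP; apply: measurable_funM => //; exact: measurable_kernel_comp.
  - by have /integrableP[] := integrableD measurableT i1 i2.
  - by apply: filterS vE => z -> _; rewrite mulrDr.
(* Finiteness of the heat flow of |v| is not among the hypotheses, and in the infinite case the
   bound is trivial. *)
have [->|voo] := eqVneq (heatE (t - e) (fun y => `|v y|%:E) x) +oo.
  rewrite addye ?leey// gt_eqF// (@lt_le_trans _ _ 0)//.
  by apply: duhE_ge0 => s y; rewrite lee_fin.
have -> : (heatR t u0 x + duhR 0 t F x = heatR (t - e) v x +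
    (duhR 0 t F x - \int[mu2]_z duhK `]0%R, e[ t x F z))%R by rewrite hv; ring.
apply: (@le_trans _ _ (`|heatR (t - e) v x|%:E +
    `|duhR 0 t F x - \int[mu2]_z duhK `]0%R, e[ t x F z|%:E)).
  by rewrite -EFinD lee_fin ler_normD.
apply: leeD; first by apply: le_heatR => //; rewrite ltey.
have i4 := integrable_duhR mF Foo.
rewrite /duhR -RintegralB// EFin_normr_Rintegral//; last first.
  by have := integrableB measurableT i4 i3.
apply: (le_trans (le_abse_integral _ _ _)) => //.
  by apply/measurable_EFinP; apply: measurable_funB; exact: measurable_duhK.
rewrite /duhE integral_itv_obnd_cbnd; last first.
  by apply: measurable_funTS; apply: measurable_duhE_integrand => //; exact: rmeasurable_norm.
rewrite -integral_norm_duhK//.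
rewrite le_eqVlt; apply/orP; left; apply/eqP; apply: eq_integral => z _ /=.
congr (`|_|%:E); rewrite /duhK -mulrBl; congr (_ * _)%R.
rewrite !indicE !mem_setE !in_itv/=.
have [z0|z0] := ltP 0%R z.1; have [ze|ze] := ltP z.1 e; have [zt|zt] := ltP z.1 t => /=;
  rewrite ?subr0 ?subrr//; lra.
Qed.

Lemma measurable_heatE_joint F : measurable_fun setT F -> (forall y, 0 <= F y) ->
  pmeasurable (fun s => heatE s F).
Proof.
move=> mF F0; apply: (measurable_heatE_param (Z := (Rm * X)%type) (tau := fst) (xi := snd)
  (Q := fun=> F)) => //.
exact: (measurableT_comp mF measurable_snd).
Qed.

(** * Regularity of the heat semigroup in time *)

Section time_regularity.
Context (pw cL : R)
  (le_time : forall s t x y, (0 < s)%R -> (s <= t)%R -> (G s x y <= (t / s) `^ pw * G t x y)%R)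
  (cL0 : (0 <= cL)%R)
  (time_lip : forall s t x y, (0 < s)%R -> (s <= t)%R -> (t <= 2 * s)%R ->
    (`|G t x y - G s x y| <= cL * ((t - s) / s) * G (2 * t) x y)%R).

Lemma heatE_le_time s t F x : (0 < s)%R -> (s <= t)%R ->
  measurable_fun setT F -> (forall y, 0 <= F y) ->
  heatE s F x <= ((t / s) `^ pw)%:E * heatE t F x.
Proof.
move=> s0 st mF F0; rewrite /heatE -ge0_integralZl_EFin//; last 3 first.
- by move=> y _; apply: mule_ge0; rewrite // lee_fin.
- exact: measurable_heatE_integrand.
- exact: powR_ge0.
apply: ge0_le_integral => //.
- by move=> y _; apply: mule_ge0; rewrite // lee_fin.
- exact: measurable_heatE_integrand.
- by apply: emeasurable_funM => //; exact: measurable_heatE_integrand.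
- by move=> y _; rewrite muleA -EFinM; apply: lee_wpmul2r => //; rewrite lee_fin le_time.
Qed.

Lemma heatE_time_lip s t F x : (0 < s)%R -> (s <= t)%R -> (t <= 2 * s)%R ->
  measurable_fun setT F -> (forall y, 0 <= F y) ->
  heatE s F x <= heatE t F x + (cL * ((t - s) / s))%:E * heatE (2 * t) F x.
Proof.
move=> s0 st ts mF F0.
have c0 : (0 <= cL * ((t - s) / s))%R by rewrite mulr_ge0// divr_ge0 ?subr_ge0// ltW.
rewrite /heatE -ge0_integralZl_EFin//; last 2 first.
- by move=> y _; apply: mule_ge0; rewrite // lee_fin.
- exact: measurable_heatE_integrand.
rewrite -ge0_integralD//; last 4 first.
- by move=> y _; apply: mule_ge0; rewrite // lee_fin.
- exact: measurable_heatE_integrand.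
- by move=> y _; apply: mule_ge0; [rewrite lee_fin|apply: mule_ge0; rewrite // lee_fin].
- by apply: emeasurable_funM => //; exact: measurable_heatE_integrand.
apply: ge0_le_integral => //.
- by move=> y _; apply: mule_ge0; rewrite // lee_fin.
- exact: measurable_heatE_integrand.
- apply: emeasurable_funD; first exact: measurable_heatE_integrand.
  by apply: emeasurable_funM => //; exact: measurable_heatE_integrand.
- move=> y _; have g0 : (0 <= cL * ((t - s) / s) * G (2 * t) x y)%R by rewrite mulr_ge0.
  rewrite muleA -EFinM -ge0_muleDl ?lee_fin// -EFinD.
  apply: lee_wpmul2r => //; rewrite lee_fin.
  have := time_lip x y s0 st ts; rewrite distrC => /(le_trans (ler_norm _)); lra.
Qed.

(** The limit e -> 0 in |u(t)| <= 2 e^{(t-e) Delta}|u(e)|. The exceptional null set depends on [e],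
    so e runs through a sequence only. Replacing u(e) by u0 costs a multiple of [eta e], and
    replacing t - e by t costs a multiple of e / (t - e) by the Lipschitz bound in time. *)
Lemma dominated_from_shift (u : R -> X -> R) (u0 : X -> R) (tau C delta : R) (eta : R -> R) :
  (forall t, measurable_fun setT (u t)) -> measurable_fun setT u0 ->
  (0 <= C)%R -> (0 <= delta)%R ->
  (forall e t, (0 < e)%R -> (e < t < tau)%R ->
    {ae mu, forall x, `|u t x|%:E <= 2%:E * heatE (t - e) (fun y => `|u e y|%:E) x}) ->
  (forall e s x, (0 < e < tau)%R -> (0 < s)%R ->
    heatE s (fun y => `|u e y - u0 y|%:E) x <= (C * s `^ (- delta) * eta e)%:E) ->
  (forall r, (0 < r)%R -> exists2 e0, (0 < e0)%R & forall e, (0 < e < e0)%R -> (eta e <= r)%R) ->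
  (forall t x, (0 < t)%R -> heatE t (fun y => `|u0 y|%:E) x < +oo) ->
  forall t, (0 < t < tau)%R ->
    {ae mu, forall x, `|u t x|%:E <= 2%:E * heatE t (fun y => `|u0 y|%:E) x}.
Proof.
move=> mu_ mu0 C0 delta0 hu hC heta hfin t /andP[t0 ttau].
have u0ge0 y : 0 <= `|u0 y|%:E by rewrite lee_fin.
have mabs : measurable_fun setT (fun y => `|u0 y|%:E).
  by apply/measurable_EFinP; exact: measurableT_comp.
pose E s x := heatE s (fun y => `|u0 y|%:E) x.
have E0 s x : 0 <= E s x by exact: heatE_ge0.
have Efin s x : (0 < s)%R -> E s x \is a fin_num by move=> s0; rewrite ge0_fin_numE// hfin.
pose A x := (2 * (2 * cL * fine (E (2 * t)%R x) + C * (t / 2) `^ (- delta)))%R.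
suff key n : {ae mu, forall x, `|u t x|%:E <= 2%:E * E t x + (A x / 2 ^+ n)%:E}.
  have /ae_foralln := key; apply: filterS => x h.
  rewrite -/(E t x) -(fineK (Efin t x t0)) -EFinM lee_fin -subr_le0 -lee_fin.
  apply: (@le0_geometric _ (A x)) => n; move: (h n).
  by rewrite -(fineK (Efin t x t0)) -EFinM -EFinD !lee_fin lerBlDl.
have q0 : (0 < (2 ^+ n)^-1 :> R)%R by rewrite invr_gt0 exprn_gt0.
have [e0 e00 eta_le] := heta _ q0.
(* Both errors are O(2^-n) for this choice: [eta e] is at most 2^-n, and as t - e >= t / 2 so is e /
   (t - e). *)
pose e := Num.min (e0 / 2)%R (t / 2 / 2 ^+ n)%R.
have te0 : (0 < t / 2 / 2 ^+ n)%R by rewrite !divr_gt0 ?exprn_gt0.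
have e_gt0 : (0 < e)%R by rewrite lt_min te0 divr_gt0.
have e_lt : (e < e0)%R by rewrite gt_min ltr_pdivrMr// ltr_pMr// ltr1n.
have e_le : (e <= t / 2 / 2 ^+ n)%R by rewrite ge_min lexx orbT.
have et2 : (e <= t / 2)%R.
  by apply: (le_trans e_le); rewrite ler_piMr ?invf_le1 ?exprn_gt0 ?exprn_ege1 ?ler1n// divr_ge0// ltW.
have et : (e < t)%R by lra.
have eta_e : (eta e <= (2 ^+ n)^-1)%R by apply: eta_le; rewrite e_gt0.
apply: filterS (hu e t e_gt0 _) => [x ux|]; last by rewrite et.
have s0 : (0 < t - e)%R by rewrite subr_gt0.
have h1 : heatE (t - e) (fun y => `|u e y|%:E) x <=
    heatE (t - e) (fun y => `|u0 y|%:E) x + heatE (t - e) (fun y => `|u e y - u0 y|%:E) x.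
  have md : measurable_fun setT (fun y => `|u e y - u0 y|%:E).
    by apply/measurable_EFinP; apply: measurableT_comp => //; exact: measurable_funB.
  rewrite -heatED//; apply: le_heatE => //.
  - by apply/measurable_EFinP; exact: measurableT_comp.
  - exact: emeasurable_funD.
  - by move=> y; rewrite -EFinD lee_fin addr_ge0.
  - apply: aeW => y; rewrite -EFinD lee_fin.
    by have := ler_normD (u0 y) (u e y - u0 y)%R; rewrite (addrC (u0 y)) subrK.
have h2 : heatE (t - e) (fun y => `|u0 y|%:E) x <= E t x + (cL * ((t - (t - e)) / (t - e)))%:E * E (2 * t)%R x.
  by apply: heatE_time_lip => //; lra.
have etau : (0 < e < tau)%R by rewrite e_gt0 (lt_trans et).
have h3 := hC e (t - e)%R x etau s0.
apply: (le_trans ux); apply: (@le_trans _ _ (2%:E * (E t x +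
  ((cL * ((t - (t - e)) / (t - e)))%:E * E (2 * t)%R x + (C * (t - e) `^ (- delta) * eta e)%:E)))).
  apply: lee_wpmul2l; first by rewrite lee_fin.
  by apply: (le_trans h1); rewrite [leRHS]addeA; exact: leeD.
have t20 : (0 < 2 * t)%R by rewrite mulr_gt0.
rewrite -(fineK (Efin t x t0)) -(fineK (Efin _ x t20)) -?EFinM -?EFinD -?EFinM lee_fin.
rewrite /A; set f := fine (E (2 * t)%R x); have f0 : (0 <= f)%R by exact: fine_ge0.
set q := (2 ^+ n)^-1%R in e_le eta_e q0 *.
set p := ((t / 2) `^ (- delta))%R; set r := ((t - e) `^ (- delta))%R.
have r0 : (0 <= r)%R by exact: powR_ge0.
have i1 : (cL * ((t - (t - e)) / (t - e)) * f <= 2 * cL * f * q)%R.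
  rewrite (_ : 2 * cL * f * q = cL * (2 * q) * f)%R; last by ring.
  apply: ler_wpM2r => //; apply: ler_wpM2l => //.
  by rewrite opprB addrC subrK ler_pdivrMr//; nra.
have rp : (r <= p)%R.
  rewrite /r /p !powRN lef_pV2 ?posrE ?powR_gt0//; last by lra.
  by apply: ge0_ler_powR; rewrite ?nnegrE//; lra.
have i2 : (C * r * eta e <= C * p * q)%R.
  apply: (@le_trans _ _ (C * r * q)%R); first by rewrite ler_wpM2l// mulr_ge0.
  by rewrite ler_wpM2r ?ler_wpM2l// ltW.
lra.
Qed.

End time_regularity.

(** * Picard iteration *)

Section fixed_point.
Variables (alpha m : R) (u0 : X -> R) (K b T : R).
Hypotheses (alpha0 : (0 < alpha)%R) (m1 : (1 <= m)%R)
  (lip : forall r r' M : R, (`|r| <= M)%R -> (`|r'| <= M)%R ->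
    (`|powabs alpha r - powabs alpha r'| <= m * M `^ alpha * `|r - r'|)%R)
  (mu0 : measurable_fun setT u0) (K0 : (0 <= K)%R) (b0 : (0 <= b)%R) (ab1 : (alpha * b < 1)%R)
  (T0 : (0 < T)%R).
Local Notation E t := (heatE t (fun y => `|u0 y|%:E)).
Hypothesis EK : forall t x, (0 < t)%R -> E t x <= (K * t `^ (- b))%:E.
(** On |r| <= 2 E(s) the nonlinearity has Lipschitz constant m (2 E(s))^alpha <= k(s), by the bound
    [EK]. As alpha b < 1, k is integrable at 0, and [kT] makes its integral over (0, T) at most
    1/4. *)
Let k s : R := (m * (2 * K) `^ alpha * s `^ (- (alpha * b)))%R.
Hypothesis kT : (m * (2 * K) `^ alpha * (T `^ (1 - alpha * b) / (1 - alpha * b)) <= 4^-1)%R.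

Let absu0_ge0 y : 0 <= `|u0 y|%:E. Proof. by rewrite lee_fin. Qed.

Let mabsu0 : measurable_fun setT (fun y => `|u0 y|%:E).
Proof. by apply/measurable_EFinP; exact: measurableT_comp. Qed.

Let E_ge0 t x : 0 <= E t x. Proof. exact: heatE_ge0. Qed.

Let E_fin t x : (0 < t)%R -> E t x \is a fin_num.
Proof. by move=> t0; rewrite ge0_fin_numE//; exact: le_lt_trans (EK _ t0) (ltry _). Qed.

Let k_ge0 s : (0 <= k s)%R.
Proof. by rewrite !mulr_ge0 ?powR_ge0// (le_trans ler01). Qed.

Let mk : measurable_fun setT (k : Rm -> R).
Proof. by apply: measurable_funM => //; exact: measurable_powR. Qed.

Let integral_k t : (0 < t)%R -> (t <= T)%R -> \int[leb1]_(s in `]0%R, t[) (k s)%:E <= (4^-1)%:E.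
Proof.
move=> t0 tT; apply: le_trans (_ : (m * (2 * K) `^ alpha * (T `^ (1 - alpha * b) / (1 - alpha * b)))%:E <= _); last first.
  by rewrite lee_fin.
have c0 : (0 <= m * (2 * K) `^ alpha)%R by rewrite mulr_ge0 ?powR_ge0// (le_trans ler01).
under eq_integral do rewrite EFinM.
rewrite ge0_integralZl_EFin//; last 2 first.
- by move=> s _; rewrite lee_fin powR_ge0.
- exact: measurable_powR_itv.
rewrite [leRHS]EFinM; apply: lee_wpmul2l; first by rewrite lee_fin.
apply: (@le_trans _ _ (\int[leb1]_(s in `]0%R, T[) (s `^ (- (alpha * b)))%:E)).
  apply: ge0_subset_integral => //=.
  - exact: measurable_powR_itv.
  - by move=> s _; rewrite lee_fin powR_ge0.
  - by move=> s /=; rewrite !in_itv/= => /andP[-> /lt_le_trans ->].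
by apply: integral_powR0 => //; rewrite mulr_ge0// ltW.
Qed.

(** With r = 2 this bounds the Duhamel term by E / 2, and E + E / 2 <= 2 E makes the set |w| <= 2 E
    invariant; with r = c it gives the contraction factor 1/4. *)
Lemma duhE_contraction (P : R -> X -> \bar R) (r t : R) x : pmeasurable P ->
  (forall s y, 0 <= P s y) -> (0 <= r)%R -> (0 < t)%R -> (t <= T)%R ->
  {ae leb1, forall s, (0 < s < t)%R -> {ae mu, forall y, P s y <= (r * k s)%:E * E s y}} ->
  duhE 0 t P x <= (r / 4)%:E * E t x.
Proof.
move=> mP P0 r0 t0 tT Pk.
apply: (@le_trans _ _ (duhE 0 t (fun s y => (r * k s)%:E * heatE (s - 0) (fun y => `|u0 y|%:E) y) x)).
  apply: le_duhE => //.
  - apply: emeasurable_funM.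
      apply/measurable_EFinP; apply: measurable_funM => //; exact: (measurableT_comp mk measurable_fst).
    rewrite (_ : (fun z => _) = fun z : Rm * X => E z.1 z.2); last by apply/funext => z; rewrite subr0.
    exact: measurable_heatE_joint.
  - move=> s y; apply: mule_ge0; last exact: heatE_ge0.
    by rewrite lee_fin mulr_ge0.
  - by apply: ae_imply Pk => s h st; apply: filterS (h st) => y; rewrite subr0.
rewrite (duhE_heatE (k := fun s => r * k s)%R)//; last first.
- by move=> s _; rewrite mulr_ge0.
- exact: measurable_funM.
rewrite subr0 lee_wpmul2r//.
under eq_integral do rewrite EFinM.
rewrite ge0_integralZl_EFin//; last 2 first.
- by move=> s _; rewrite lee_fin.
- by apply/measurable_EFinP; exact: measurable_funTS.
by rewrite EFinM lee_wpmul2l ?lee_fin ?integral_k.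
Qed.

Lemma norm_powabs_le_E (r s : R) y : (0 < s)%R -> `|r|%:E <= 2%:E * E s y ->
  `|powabs alpha r|%:E <= (2 * k s)%:E * E s y.
Proof.
move=> s0 rE; have Efin := E_fin y s0; have := EK y s0.
move: rE; rewrite -(fineK Efin) -!EFinM !lee_fin.
set e := fine _ => re eK.
have e0 : (0 <= e)%R by rewrite /e fine_ge0.
rewrite norm_powabs.
have sb0 : (0 <= s `^ (- b))%R by exact: powR_ge0.
have pa : (`|r| `^ alpha <= k s)%R.
  apply: (@le_trans _ _ ((2 * K * s `^ (- b)) `^ alpha)%R).
    by apply: ge0_ler_powR; rewrite ?nnegrE ?(ltW alpha0) ?mulr_ge0//; lra.
  rewrite powRM// ?mulr_ge0// -powRrM mulNr (mulrC b) /k.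
  by rewrite ler_wpM2r ?powR_ge0// ler_peMl// powR_ge0.
rewrite (_ : 2 * k s * e = k s * (2 * e))%R; last by ring.
by apply: ler_pM => //; exact: powR_ge0.
Qed.

Lemma powabs_lip_E (r r' c s : R) y : (0 < s)%R ->
  `|r|%:E <= 2%:E * E s y -> `|r'|%:E <= 2%:E * E s y -> `|r - r'|%:E <= c%:E * E s y ->
  `|powabs alpha r - powabs alpha r'|%:E <= (c * k s)%:E * E s y.
Proof.
move=> s0 rE rE' cE; have Efin := E_fin y s0; have := EK y s0.
move: rE rE' cE; rewrite -(fineK Efin) -!EFinM !lee_fin.
set e := fine _ => re re' ce eK.
have e0 : (0 <= e)%R by rewrite /e fine_ge0.
have sb0 : (0 <= s `^ (- b))%R by exact: powR_ge0.
apply: (le_trans (lip re re')).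
rewrite (_ : c * k s * e = k s * (c * e))%R; last by ring.
apply: ler_pM => //; first by rewrite mulr_ge0 ?powR_ge0// (le_trans ler01).
rewrite /k -mulrA ler_wpM2l ?(le_trans ler01)//.
apply: (@le_trans _ _ ((2 * K * s `^ (- b)) `^ alpha)%R).
  by apply: ge0_ler_powR; rewrite ?nnegrE ?(ltW alpha0) ?mulr_ge0//; lra.
by rewrite powRM// ?mulr_ge0// -powRrM mulNr (mulrC b).
Qed.

Definition nonlinR (u : R -> X -> R) (s : R) (y : X) : R := powabs alpha (u s y).

Lemma rmeasurable_nonlinR (u : R -> X -> R) : rmeasurable u -> rmeasurable (nonlinR u).
Proof.
move=> mu_; apply: measurable_funM => //.
by apply: (measurableT_comp (measurable_powR _)); exact: measurableT_comp.
Qed.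

Lemma duhE_nonlinR_le (u : R -> X -> R) t x : rmeasurable u -> (0 < t)%R -> (t <= T)%R ->
  {ae leb1, forall s, (0 < s < t)%R -> {ae mu, forall y, `|u s y|%:E <= 2%:E * E s y}} ->
  duhE 0 t (fun s y => `|nonlinR u s y|%:E) x <= 2^-1%:E * E t x.
Proof.
move=> mu_ t0 tT uE.
rewrite (_ : 2^-1 = 2 / 4)%R; last by field.
apply: duhE_contraction => //.
- by apply: rmeasurable_norm; exact: rmeasurable_nonlinR.
- apply: ae_imply uE => s h st; apply: filterS (h st) => y.
  by apply: norm_powabs_le_E; case/andP: st.
Qed.

Lemma duhE_nonlinR_lty (u : R -> X -> R) t x : rmeasurable u -> (0 < t)%R -> (t <= T)%R ->
  {ae leb1, forall s, (0 < s < t)%R -> {ae mu, forall y, `|u s y|%:E <= 2%:E * E s y}} ->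
  duhE 0 t (fun s y => `|nonlinR u s y|%:E) x < +oo.
Proof.
move=> mu_ t0 tT uE; apply: le_lt_trans (duhE_nonlinR_le _ _ _ _ uE) _ => //.
by rewrite -(fineK (E_fin x t0)) -EFinM ltry.
Qed.

Lemma duhE_nonlinR_sub_le (u v : R -> X -> R) (c t : R) x : rmeasurable u -> rmeasurable v ->
  (0 <= c)%R -> (0 < t)%R -> (t <= T)%R ->
  {ae leb1, forall s, (0 < s < t)%R -> {ae mu, forall y, `|u s y|%:E <= 2%:E * E s y}} ->
  {ae leb1, forall s, (0 < s < t)%R -> {ae mu, forall y, `|v s y|%:E <= 2%:E * E s y}} ->
  {ae leb1, forall s, (0 < s < t)%R -> {ae mu, forall y, `|u s y - v s y|%:E <= c%:E * E s y}} ->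
  duhE 0 t (fun s y => `|nonlinR u s y - nonlinR v s y|%:E) x <= (c / 4)%:E * E t x.
Proof.
move=> mu_ mv c0 t0 tT uE vE cE.
apply: duhE_contraction => //.
- apply/measurable_EFinP; apply: measurableT_comp => //.
  by apply: measurable_funB; exact: rmeasurable_nonlinR.
- apply: ae_imply3 uE vE cE => s h1 h2 h3 st.
  move: (h1 st) (h2 st) (h3 st); apply: filterS3 => y.
  by apply: powabs_lip_E; case/andP: st.
Qed.

Fixpoint picard n : R -> X -> R :=
  if n is n'.+1 then fun t x =>
    if (0 < t < T)%R then (heatR t u0 x + duhR 0 t (nonlinR (picard n')) x)%R else 0%R
  else fun _ _ => 0%R.

Lemma picardS n t x : (0 < t < T)%R ->
  picard n.+1 t x = (heatR t u0 x + duhR 0 t (nonlinR (picard n)) x)%R.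
Proof. by move=> tT /=; rewrite tT. Qed.

Lemma measurable_time_restriction (f : R -> X -> R) : rmeasurable f ->
  rmeasurable (fun t x => if (0 < t < T)%R then f t x else 0%R).
Proof.
move=> mf; apply: measurable_fun_ifT => //.
apply: (measurable_and (f := fun z : Rm * X => (0 < z.1)%R) (g := fun z : Rm * X => (z.1 < T)%R));
  by apply: measurable_fun_ltr.
Qed.

Lemma rmeasurable_picard n : rmeasurable (picard n).
Proof.
elim: n => [|n IH] /=; first exact: measurable_cst.
apply: measurable_time_restriction; apply: measurable_funD.
  exact: measurable_heatR.
by apply: measurable_duhR; exact: rmeasurable_nonlinR.
Qed.

Let ae_ae (Q : R -> X -> Prop) (D : R -> bool) : (forall s y, D s -> Q s y) ->
  {ae leb1, forall s, D s -> {ae mu, forall y, Q s y}}.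
Proof. by move=> h; apply: aeW => s Ds; apply: aeW => y; exact: h. Qed.

Let duhR_eq_bound (u : R -> X -> R) t x : rmeasurable u -> (0 < t < T)%R ->
  (forall s y, (0 < s < T)%R -> `|u s y|%:E <= 2%:E * E s y) ->
  `|heatR t u0 x + duhR 0 t (nonlinR u) x|%:E <= 2%:E * E t x.
Proof.
move=> mu_ /andP[t0 tT] uE.
have h : {ae leb1, forall s, (0 < s < t)%R -> {ae mu, forall y, `|u s y|%:E <= 2%:E * E s y}}.
  by apply: ae_ae => s y /andP[s0 st]; apply: uE; rewrite s0 (lt_trans st).
have Foo := duhE_nonlinR_lty x mu_ t0 (ltW tT) h.
have hu : `|heatR t u0 x|%:E <= E t x.
  by apply: le_heatR => //; rewrite -(fineK (E_fin x t0)) ltry.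
have hd : `|duhR 0 t (nonlinR u) x|%:E <= 2^-1%:E * E t x.
  apply: le_trans (duhE_nonlinR_le x mu_ t0 (ltW tT) h).
  exact: le_duhR (rmeasurable_nonlinR mu_) Foo.
apply: (@le_trans _ _ (`|heatR t u0 x|%:E + `|duhR 0 t (nonlinR u) x|%:E)).
  by rewrite -EFinD lee_fin ler_normD.
apply: (le_trans (leeD hu hd)).
rewrite -(fineK (E_fin x t0)) -!EFinM -EFinD lee_fin.
have : (0 <= fine (E t x))%R by rewrite fine_ge0.
lra.
Qed.

Let duhR_sub_bound (u v : R -> X -> R) (c t : R) x : rmeasurable u -> rmeasurable v ->
  (0 <= c)%R -> (0 < t < T)%R ->
  (forall s y, (0 < s < T)%R -> `|u s y|%:E <= 2%:E * E s y) ->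
  (forall s y, (0 < s < T)%R -> `|v s y|%:E <= 2%:E * E s y) ->
  (forall s y, (0 < s < T)%R -> `|u s y - v s y|%:E <= c%:E * E s y) ->
  `|duhR 0 t (nonlinR u) x - duhR 0 t (nonlinR v) x|%:E <= (c / 4)%:E * E t x.
Proof.
move=> mu_ mv c0 /andP[t0 tT] uE vE cE.
have sub s : (0 < s < t)%R -> (0 < s < T)%R.
  by move=> /andP[s0 st]; rewrite s0 (lt_trans st).
have hu : {ae leb1, forall s, (0 < s < t)%R -> {ae mu, forall y, `|u s y|%:E <= 2%:E * E s y}}.
  by apply: ae_ae => s y /sub; exact: uE.
have hv : {ae leb1, forall s, (0 < s < t)%R -> {ae mu, forall y, `|v s y|%:E <= 2%:E * E s y}}.
  by apply: ae_ae => s y /sub; exact: vE.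
have hc : {ae leb1, forall s, (0 < s < t)%R -> {ae mu, forall y, `|u s y - v s y|%:E <= c%:E * E s y}}.
  by apply: ae_ae => s y /sub; exact: cE.
apply: le_trans (duhE_nonlinR_sub_le x mu_ mv c0 t0 (ltW tT) hu hv hc).
apply: le_duhR_sub; try exact: rmeasurable_nonlinR.
- exact: duhE_nonlinR_lty (ltW tT) hu.
- exact: duhE_nonlinR_lty (ltW tT) hv.
Qed.

Lemma picard_le n t x : (0 < t < T)%R -> `|picard n t x|%:E <= 2%:E * E t x.
Proof.
elim: n t x => [|n IH] t x tT /=; first by rewrite normr0 mule_ge0 ?lee_fin.
by rewrite tT; apply: duhR_eq_bound => //; exact: rmeasurable_picard.
Qed.

Lemma picard_sub_le n t x : (0 < t < T)%R ->
  `|picard n.+1 t x - picard n t x|%:E <= (2 / 2 ^+ n)%:E * E t x.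
Proof.
elim: n t x => [|n IH] t x tT.
  by rewrite [picard 0 t x]/= subr0 expr0 divr1; exact: picard_le.
have -> : (picard n.+2 t x - picard n.+1 t x =
    duhR 0 t (nonlinR (picard n.+1)) x - duhR 0 t (nonlinR (picard n)) x)%R.
  by rewrite (picardS n.+1)// (picardS n)//; ring.
apply: (@le_trans _ _ (((2 / 2 ^+ n) / 4)%:E * E t x)).
  apply: duhR_sub_bound => //; try exact: rmeasurable_picard.
  - by move=> s y; exact: picard_le.
  - by move=> s y; exact: picard_le.
rewrite lee_wpmul2r// lee_fin exprS invfM mulrA.
have : (0 <= (2 ^+ n)^-1 :> R)%R by rewrite invr_ge0 exprn_ge0.
lra.
Qed.

(** Consecutive iterates differ by at most a multiple of E(t, x) / 2^n, which is finite at every x,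
    so the limit exists and satisfies Duhamel's formula everywhere in (0, T), not just almost
    everywhere. *)
Lemma picard_solution : exists w : R -> X -> R,
  [/\ rmeasurable w,
      forall t x, (0 < t < T)%R -> `|w t x|%:E <= 2%:E * E t x &
      forall t x, (0 < t < T)%R -> w t x = (heatR t u0 x + duhR 0 t (nonlinR w) x)%R].
Proof.
pose e t x := if (0 < t < T)%R then fine (E t x) else 0%R.
have e0 t x : (0 <= e t x)%R by rewrite /e; case: ifP => // _; exact: fine_ge0.
have eE t x : (0 < t < T)%R -> E t x = (e t x)%:E.
  by move=> tT; rewrite /e tT fineK//; apply: E_fin; case/andP: tT.
have step t x n : (`|picard n.+1 t x - picard n t x| <= 2 * e t x / 2 ^+ n)%R.
  have [tT|tT] := boolP (0 < t < T)%R.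
    by have := picard_sub_le n x tT; rewrite eE// -EFinM lee_fin mulrAC.
  suff h j : picard j t x = 0%R by rewrite !h subr0 normr0 divr_ge0 ?mulr_ge0 ?exprn_ge0.
  by case: j => [|j] //=; rewrite (negPf tT).
have lim t x := cid2 (geometric_limit (step t x)).
pose w t x := sval (lim t x).
have wlim t x : picard n t x @[n --> \oo] --> w t x by rewrite /w; case: (lim t x).
have wsub t x n : (`|w t x - picard n t x| <= 2 * (2 * e t x) / 2 ^+ n)%R.
  by rewrite /w; case: (lim t x).
have mw : rmeasurable w.
  apply: (measurable_fun_cvg (h := fun n (z : Rm * X) => picard n z.1 z.2)).
  - by move=> n; exact: rmeasurable_picard.
  - by move=> z _; exact: wlim.
have wE t x : (0 < t < T)%R -> `|w t x|%:E <= 2%:E * E t x.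
  move=> tT; rewrite eE// -EFinM lee_fin -subr_le0 -lee_fin.
  apply: (@le0_geometric _ (2 * (2 * e t x))%R) => n; rewrite lee_fin.
  have := picard_le n x tT; rewrite eE// -EFinM lee_fin => p1.
  have := wsub t x n; have := ler_normD (w t x - picard n t x)%R (picard n t x).
  by rewrite subrK; lra.
exists w; split => // t x tT; apply/eqP; rewrite -subr_eq0 -normr_le0 -lee_fin.
apply: (@le0_geometric _ (3 * e t x)%R) => n; rewrite lee_fin.
set rhs := (heatR t u0 x + _)%R.
(* [w] is within 4 E / 2^n of the n-th iterate, and one application of the Duhamel map divides this
   by 4. *)
have h1 : (`|picard n.+1 t x - rhs| <= e t x / 2 ^+ n)%R.
  rewrite distrC picardS// /rhs opprD addrACA subrr add0r -lee_fin.
  rewrite (_ : e t x / 2 ^+ n = (4 / 2 ^+ n) / 4 * e t x)%R; last by field; rewrite expf_neq0.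
  rewrite EFinM -eE//; apply: duhR_sub_bound => //; first exact: rmeasurable_picard.
  - by move=> s y; exact: picard_le.
  - move=> s y sT; rewrite eE// -EFinM lee_fin (le_trans (wsub s y n))//.
    by rewrite le_eqVlt; apply/orP; left; apply/eqP; field; rewrite expf_neq0.
have := ler_normD (w t x - picard n.+1 t x)%R (picard n.+1 t x - rhs)%R.
rewrite addrA subrK => /le_trans; apply; apply: (le_trans (lerD (wsub t x n.+1) h1)).
by rewrite le_eqVlt; apply/orP; left; apply/eqP; rewrite exprS; field; rewrite expf_neq0.
Qed.

(** Domination gives |u - v| <= 4 E, and each passage through Duhamel's formula gains at least a
    factor 2. No bound uniform up to t = 0 is required, unlike in Gronwall's argument. *)
Lemma unique_dominated (u v : R -> X -> R) (tau : R) : (tau <= T)%R ->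
  rmeasurable u -> rmeasurable v ->
  (forall t, (0 < t < tau)%R -> {ae mu, forall x, `|u t x|%:E <= 2%:E * E t x}) ->
  (forall t, (0 < t < tau)%R -> {ae mu, forall x, `|v t x|%:E <= 2%:E * E t x}) ->
  (forall t, (0 < t < tau)%R ->
    {ae mu, forall x, u t x = (heatR t u0 x + duhR 0 t (nonlinR u) x)%R}) ->
  (forall t, (0 < t < tau)%R ->
    {ae mu, forall x, v t x = (heatR t u0 x + duhR 0 t (nonlinR v) x)%R}) ->
  forall t, (0 < t < tau)%R -> {ae mu, forall x, u t x = v t x}.
Proof.
move=> tauT mu_ mv uE vE uD vD.
have aes (Q : R -> X -> Prop) : (forall s, (0 < s < tau)%R -> {ae mu, forall y, Q s y}) ->
    forall t, (0 < t < tau)%R ->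
    {ae leb1, forall s, (0 < s < t)%R -> {ae mu, forall y, Q s y}}.
  move=> h t /andP[_ tt]; apply: aeW => s /andP[s0 st]; apply: h.
  by rewrite s0 (lt_trans st).
have claim n t : (0 < t < tau)%R ->
    {ae mu, forall x, `|u t x - v t x|%:E <= (4 / 2 ^+ n)%:E * E t x}.
  elim: n t => [|n IH] t tt; have /andP[t0 tT] := tt.
    move: (uE _ tt) (vE _ tt); apply: filterS2 => x.
    rewrite -(fineK (E_fin x t0)) -!EFinM !lee_fin => h1 h2.
    by apply: (le_trans (ler_normB _ _)); rewrite expr0 divr1; lra.
  move: (uD _ tt) (vD _ tt); apply: filterS2 => x -> ->.
  rewrite opprD addrACA subrr add0r.
  have tT' : (t <= T)%R by rewrite ltW// (lt_le_trans tT).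
  have hu := aes _ uE _ tt; have hv := aes _ vE _ tt; have hc := aes _ IH _ tt.
  apply: (@le_trans _ _ (((4 / 2 ^+ n) / 4)%:E * E t x)).
    apply: le_trans (duhE_nonlinR_sub_le x mu_ mv _ t0 tT' hu hv hc).
      apply: le_duhR_sub; try exact: rmeasurable_nonlinR.
      - exact: duhE_nonlinR_lty tT' hu.
      - exact: duhE_nonlinR_lty tT' hv.
    by rewrite divr_ge0// exprn_ge0.
  rewrite lee_wpmul2r// lee_fin exprS invfM mulrA.
  have : (0 <= (2 ^+ n)^-1 :> R)%R by rewrite invr_ge0 exprn_ge0.
  lra.
move=> t tt; have /ae_foralln := fun n => claim n t tt.
have /andP[t0 _] := tt.
apply: filterS => x h; apply/eqP; rewrite -subr_eq0 -normr_le0 -lee_fin.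
apply: (@le0_geometric _ (4 * fine (E t x))%R) => n.
by move: (h n); rewrite -(fineK (E_fin x t0)) -EFinM mulrAC.
Qed.

(** * Continuity in time of the Picard solution *)

Section time_continuity.
Context (pw cL : R) (pw0 : (0 <= pw)%R)
  (le_time : forall s t x y, (0 < s)%R -> (s <= t)%R -> (G s x y <= (t / s) `^ pw * G t x y)%R)
  (cL0 : (0 <= cL)%R)
  (time_lip : forall s t x y, (0 < s)%R -> (s <= t)%R -> (t <= 2 * s)%R ->
    (`|G t x y - G s x y| <= cL * ((t - s) / s) * G (2 * t) x y)%R).
Variable w : R -> X -> R.
Hypotheses (mw : rmeasurable w)
  (wE : forall t x, (0 < t < T)%R -> `|w t x|%:E <= 2%:E * E t x)
  (wD : forall t x, (0 < t < T)%R -> w t x = (heatR t u0 x + duhR 0 t (nonlinR w) x)%R).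

Let mF : rmeasurable (nonlinR w). Proof. exact: rmeasurable_nonlinR. Qed.

Let F_le s y : (0 < s < T)%R -> `|nonlinR w s y|%:E <= (2 * k s)%:E * E s y.
Proof. by move=> sT; apply: norm_powabs_le_E; [case/andP: sT|exact: wE]. Qed.

Let heatR_time_le t t' x : (0 < t)%R -> (t <= t')%R -> (t' <= 2 * t)%R ->
  `|heatR t' u0 x - heatR t u0 x|%:E <= (cL * ((t' - t) / t))%:E * E (2 * t')%R x.
Proof.
move=> t0 tt t2; have t'0 : (0 < t')%R by exact: lt_le_trans tt.
have c0 : (0 <= cL * ((t' - t) / t))%R by rewrite mulr_ge0// divr_ge0 ?subr_ge0// ltW.
have i s : (0 < s)%R -> mu.-integrable setT (fun y => (G s x y * u0 y)%:E).
  by move=> s0; apply: integrable_heatR => //; rewrite -(fineK (E_fin x s0)) ltry.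
rewrite /heatR -RintegralB//; try exact: i.
rewrite EFin_normr_Rintegral//; last by have := integrableB measurableT (i _ t'0) (i _ t0).
apply: (le_trans (le_abse_integral _ _ _)) => //.
  by apply/measurable_EFinP; apply: measurable_funB; apply: measurable_funM => //;
    exact: measurable_kernel_comp.
rewrite -heatEZ//; apply: ge0_le_integral => //.
- apply/measurable_EFinP; apply: measurableT_comp => //.
  by apply: measurable_funB; apply: measurable_funM => //; exact: measurable_kernel_comp.
- by apply: measurable_heatE_integrand; exact: emeasurable_funM.
- move=> y _; rewrite /= -mulrBl normrM -!EFinM lee_fin mulrA ler_wpM2r//.
  by rewrite mulrC; apply: time_lip.
Qed.

(** The source is at most 2 k(s) E(s), and the semigroup over [tau s] turns E(s) into E(tau s +
    s). *)
Let integral_F_le (D : set Rm) (tau : Rm -> Rm) x (B : \bar R) : measurable D ->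
  measurable_fun setT tau -> 0 <= B ->
  (forall s, D s -> [/\ (0 < s < T)%R, (0 < tau s)%R & E (tau s + s)%R x <= B]) ->
  \int[mu2]_z ((\1_D z.1)%:E * ((G (tau z.1) x z.2)%:E * `|nonlinR w z.1 z.2|%:E)) <=
  (\int[leb1]_(s in D) (2 * k s)%:E) * B.
Proof.
move=> mD mtau B0 hD.
rewrite (integral_prod_heatE _ _ _ (Q := fun s y => `|nonlinR w s y|%:E))//; last exact: rmeasurable_norm.
rewrite -ge0_integralZr//; last 2 first.
- by apply/measurable_EFinP; apply: measurable_funM => //; exact: measurable_funTS.
- by move=> s _; rewrite lee_fin mulr_ge0.
apply: ge0_le_integral => //.
- by move=> s _; apply: heatE_ge0 => y; rewrite lee_fin.
- apply: measurable_funTS; apply: (measurable_heatE_param (Z := Rm) (xi := fun=> x)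
    (Q := fun s y => `|nonlinR w s y|%:E)) => //; exact: rmeasurable_norm.
- apply: emeasurable_funM => //; apply/measurable_EFinP; apply: measurable_funM => //.
  exact: measurable_funTS.
- move=> s Ds; have [sT ts EB] := hD _ Ds; have /andP[s0 _] := sT.
  apply: (@le_trans _ _ (heatE (tau s) (fun y => (2 * k s)%:E * E s y) x)).
    apply: le_heatE.
    + by apply/measurable_EFinP; apply: measurableT_comp => //; exact: rmeasurable_slice.
    + by apply: emeasurable_funM => //; exact: measurable_heatE.
    + by move=> y; rewrite lee_fin.
    + by move=> y; apply: mule_ge0; rewrite // lee_fin mulr_ge0.
    + by apply: aeW => y; exact: F_le.
  rewrite heatEZ//; [|exact: measurable_heatE|by rewrite mulr_ge0].
  rewrite heatE_heatE//; apply: lee_wpmul2l => //.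
  by rewrite lee_fin mulr_ge0.
Qed.

Let k_le s s' : (0 < s)%R -> (s <= s')%R -> (k s' <= k s)%R.
Proof.
move=> s0 ss; rewrite /k ler_wpM2l ?mulr_ge0 ?powR_ge0 ?(le_trans ler01)//.
have s'0 : (0 < s')%R by exact: lt_le_trans ss.
rewrite !powRN lef_pV2 ?posrE ?powR_gt0//.
by apply: ge0_ler_powR; rewrite ?nnegrE ?mulr_ge0 ?(ltW alpha0) ?(ltW s0) ?(ltW s'0).
Qed.

Let integral_k_itv (r s s' : R) : (0 < r)%R -> (r <= s)%R -> (s <= s')%R ->
  \int[leb1]_(x in `[s, s'[) (2 * k x)%:E <= (2 * k r * (s' - s))%:E.
Proof.
move=> r0 rs ss.
apply: (@le_trans _ _ (\int[leb1]_(x in `[s, s'[) (cst (2 * k r)%:E) x)).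
  apply: ge0_le_integral => //.
  - by move=> x _; rewrite lee_fin mulr_ge0.
  - by apply/measurable_EFinP; apply: measurable_funM => //; exact: measurable_funTS.
  - move=> x /=; rewrite in_itv/= => /andP[sx _]; rewrite lee_fin ler_wpM2l// k_le//.
    exact: le_trans sx.
rewrite integral_cst//= lebesgue_measure_itv/= lte_fin.
case: ifPn => _; first by rewrite -EFinB -EFinM.
by rewrite mule0 lee_fin; apply: mulr_ge0; [exact: mulr_ge0|rewrite subr_ge0].
Qed.

(* Near the endpoint s = t the time derivative of the kernel is not integrable,
   so there the Duhamel integrals over a length dl are bounded separately. *)
Lemma solution_time_le t t' dl x : (0 < t)%R -> (t <= t')%R -> (t' < T)%R ->
  (0 < dl)%R -> (t' - t <= dl)%R -> (dl <= t / 2)%R ->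
  `|w t' x - w t x|%:E <=
    (cL * ((t' - t) / t))%:E * E (2 * t')%R x +
    ((cL * ((t' - t) / dl) * 2 `^ pw)%:E * E (2 * t')%R x +
     ((2 * k (t / 2) * (dl + (t' - t)))%:E * E t' x + (2 * k (t / 2) * dl)%:E * E t x)).
Proof.
move=> t0 tt tT dl0 h1 h2; have t'0 : (0 < t')%R by exact: lt_le_trans tt.
have tT' : (0 < t < T)%R by rewrite t0 (le_lt_trans tt).
have t'T' : (0 < t' < T)%R by rewrite t'0.
have t20 : (0 < 2 * t')%R by rewrite mulr_gt0.
rewrite (wD x t'T') (wD x tT') opprD addrACA.
apply: (@le_trans _ _ (`|heatR t' u0 x - heatR t u0 x|%:E +
    `|duhR 0 t' (nonlinR w) x - duhR 0 t (nonlinR w) x|%:E)).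
  by rewrite -EFinD lee_fin ler_normD.
apply: leeD; first by apply: heatR_time_le => //; lra.
have Foo s : (0 < s < T)%R -> duhE 0 s (fun s y => `|nonlinR w s y|%:E) x < +oo.
  move=> /andP[s0 sT]; apply: duhE_nonlinR_lty => //; first exact: ltW.
  apply: aeW => r /andP[r0 rs]; apply: aeW => y; apply: wE.
  by rewrite r0 (lt_trans rs).
have i1 := integrable_duhR mF (Foo _ t'T'); have i2 := integrable_duhR mF (Foo _ tT').
rewrite /duhR -RintegralB// EFin_normr_Rintegral//; last first.
  by have := integrableB measurableT i1 i2.
apply: (le_trans (le_abse_integral _ _ _)) => //.
  by apply/measurable_EFinP; apply: measurable_funB; exact: measurable_duhK.
pose Q (D : set Rm) (tau : Rm -> Rm) (z : Rm * X) :=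
  (\1_D z.1)%:E * ((G (tau z.1) x z.2)%:E * `|nonlinR w z.1 z.2|%:E).
have mQ D (tau : Rm -> Rm) : measurable D -> measurable_fun setT tau -> measurable_fun setT (Q D tau).
  move=> mD mtau; apply: emeasurable_funM.
    by apply/measurable_EFinP; exact: measurable_indic_fst.
  apply: emeasurable_funM; last exact: rmeasurable_norm.
  apply/measurable_EFinP; apply: measurable_kernel_comp => //.
  exact: (measurableT_comp mtau measurable_fst).
have Q0 D tau z : 0 <= Q D tau z.
  by apply: mule_ge0; [rewrite lee_fin|apply: mule_ge0; rewrite lee_fin].
pose D1 : set Rm := `]0%R, (t - dl)%R[%classic.
pose D2 : set Rm := `[(t - dl)%R, t'[%classic.
pose D3 : set Rm := `[(t - dl)%R, t[%classic.
pose tau1 (s : Rm) : Rm := (2 * (t' - s))%R.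
pose tau2 (s : Rm) : Rm := (t' - s)%R.
pose tau3 (s : Rm) : Rm := (t - s)%R.
have mt2 : measurable_fun setT tau2 by exact: measurable_funB.
have mt3 : measurable_fun setT tau3 by exact: measurable_funB.
have mt1 : measurable_fun setT tau1 by exact: measurable_funM.
have c0 : (0 <= cL * ((t' - t) / dl))%R by rewrite mulr_ge0// divr_ge0 ?subr_ge0// ltW.
apply: (@le_trans _ _ (\int[mu2]_z ((cL * ((t' - t) / dl))%:E * Q D1 tau1 z +
    (Q D2 tau2 z + Q D3 tau3 z)))).
  apply: ge0_le_integral => //.
  - apply/measurable_EFinP; apply: measurableT_comp => //.
    by apply: measurable_funB; exact: measurable_duhK.
  - apply: emeasurable_funD.
      by apply: emeasurable_funM; [exact: measurable_cst|apply: mQ => //; exact: measurable_itv].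
    by apply: emeasurable_funD; apply: mQ => //; exact: measurable_itv.
  - move=> [s y] _; rewrite /= /Q -!EFinM -!EFinD lee_fin /duhK !indicE !mem_setE !in_itv/=.
    rewrite /tau1 /tau2 /tau3; move: (nonlinR w s y) => f.
    have g2 : (0 <= G (t' - s) x y * `|f|)%R by rewrite mulr_ge0.
    have g3 : (0 <= G (t - s) x y * `|f|)%R by rewrite mulr_ge0.
    have [s0|s0] := ltP 0%R s; have [st'|st'] := ltP s t'; have [st|st] := ltP s t;
      have [sd|sd] := ltP s (t - dl)%R; rewrite ?andbF ?andbT ?mul0r ?mul1r ?mulr0 ?add0r ?addr0
        ?subr0 ?subrr ?oppr0 ?normr0 ?normrN ?normrM ?(ger0_norm (G0 _ _ _))//;
      try lra.
    + rewrite -mulrBl normrM mulrA ler_wpM2r//.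
      have ts0 : (0 < t - s)%R by rewrite subr_gt0.
      apply: (le_trans (time_lip _ _ ts0 _ _)); [lra|lra|].
      rewrite ler_wpM2r// ler_wpM2l// (_ : t' - s - (t - s) = t' - t)%R; last by ring.
      rewrite ler_wpM2l ?subr_ge0// lef_pV2 ?posrE//; lra.
    + by apply: (le_trans (ler_normB _ _)); rewrite !normrM !(ger0_norm (G0 _ _ _)).
rewrite ge0_integralD//; last 4 first.
- by move=> z _; apply: mule_ge0; rewrite // lee_fin.
- by apply: emeasurable_funM; [exact: measurable_cst|apply: mQ => //; exact: measurable_itv].
- by move=> z _; apply: adde_ge0.
- by apply: emeasurable_funD; apply: mQ => //; exact: measurable_itv.
apply: leeD.
  rewrite ge0_integralZl_EFin//; last by apply: mQ => //; exact: measurable_itv.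
  rewrite [X in _ <= X * _]EFinM -muleA; apply: lee_wpmul2l; first by rewrite lee_fin.
  apply: (@le_trans _ _ ((\int[leb1]_(s in D1) (2 * k s)%:E) * ((2 `^ pw)%:E * E (2 * t')%R x))).
    apply: integral_F_le;
      [exact: measurable_itv|exact: mt1|by apply: mule_ge0; rewrite // lee_fin powR_ge0|].
    move=> s; rewrite /D1/= in_itv/= => /andP[s0 sd]; split.
    - by rewrite s0; lra.
    - by rewrite /tau1; lra.
    (* Here tau1 s + s = 2 t' - s lies between t' and 2 t', whence the factor 2 ^ pw. *)
    - have q0 : (0 < tau1 s + s)%R by rewrite /tau1; lra.
      apply: (le_trans (heatE_le_time le_time x q0 (t := 2 * t')%R _ _ _)) => //.
        by rewrite /tau1; lra.
      apply: lee_wpmul2r => //; rewrite lee_fin; apply: ge0_ler_powR; rewrite ?nnegrE//.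
        by rewrite divr_ge0// ltW.
      by rewrite ler_pdivrMr// /tau1; lra.
  have mD1 : measurable D1 by exact: measurable_itv.
  rewrite -[leRHS]mul1e; apply: lee_wpmul2r.
    by apply: mule_ge0; rewrite // lee_fin powR_ge0.
  under eq_integral do rewrite EFinM.
  rewrite ge0_integralZl_EFin//; last 2 first.
  - by move=> s _; rewrite lee_fin.
  - by apply/measurable_EFinP; exact: measurable_funTS.
  have td0 : (0 < t - dl)%R by lra.
  have tdT : (t - dl <= T)%R by lra.
  apply: (@le_trans _ _ (2%:E * (4^-1)%:E)).
    by apply: lee_wpmul2l; [rewrite lee_fin|exact: integral_k].
  by rewrite -EFinM lee_fin; lra.
have th0 : (0 < t / 2)%R by rewrite divr_gt0.
rewrite ge0_integralD//; try by apply: mQ => //; exact: measurable_itv.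
apply: leeD.
  apply: (@le_trans _ _ ((\int[leb1]_(s in D2) (2 * k s)%:E) * E t' x)).
    apply: integral_F_le; [exact: measurable_itv|exact: mt2|exact: E_ge0|];
      move=> s; rewrite /D2/= in_itv/= => /andP[sd st]; split.
    - by apply/andP; split; lra.
    - by rewrite /tau2; lra.
    - by rewrite /tau2 subrK.
  apply: lee_wpmul2r => //; rewrite (_ : dl + (t' - t) = t' - (t - dl))%R; last by ring.
  by apply: integral_k_itv; lra.
apply: (@le_trans _ _ ((\int[leb1]_(s in D3) (2 * k s)%:E) * E t x)).
  apply: integral_F_le; [exact: measurable_itv|exact: mt3|exact: E_ge0|];
    move=> s; rewrite /D3/= in_itv/= => /andP[sd st]; split.
  - by apply/andP; split; lra.
  - by rewrite /tau3; lra.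
  - by rewrite /tau3 subrK.
apply: lee_wpmul2r => //; rewrite -[X in (_ * X)%:E](_ : t - (t - dl) = dl)%R; last by ring.
by apply: integral_k_itv; lra.
Qed.

(** Times at distance at most dl^2 make both (t' - t) / dl and the endpoint length dl of order dl in
    [solution_time_le]. All heat flows are compared with the one at time 4 t0, so the modulus is
    relative to one fixed function of x, which will be in L^q. *)
Lemma solution_time_modulus t0 eps : (0 < t0 < T)%R -> (0 < eps)%R ->
  exists2 r, (0 < r)%R & forall t x, (`|t - t0| < r)%R ->
    [/\ (0 < t < T)%R & `|w t x - w t0 x|%:E <= eps%:E * E (4 * t0)%R x].
Proof.
move=> /andP[t00 t0T] eps0.
(* 8 is the largest ratio of 4 t0 to the times r >= t0 / 2 that occur; the 6 in [C] is 4 + 2, from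
   the two endpoint integrals. *)
pose P : R := (8 `^ pw)%R.
pose C : R := (P * (cL * 2 / t0 + cL * 2 `^ pw + 6 * k (t0 / 4)))%R.
have P0 : (0 <= P)%R by exact: powR_ge0.
have t0i : (0 <= t0^-1)%R by rewrite invr_ge0 ltW.
have A1 : (0 <= cL * 2 / t0)%R by rewrite !mulr_ge0.
have A2 : (0 <= cL * 2 `^ pw)%R by rewrite mulr_ge0// powR_ge0.
have A3 : (0 <= 6 * k (t0 / 4))%R by rewrite mulr_ge0.
have C0 : (0 <= C)%R by rewrite mulr_ge0// !addr_ge0.
pose dl := (Num.min (Num.min 1 (t0 / 4)) (eps / (C + 1)))%R.
have C1 : (0 < C + 1)%R by rewrite ltr_wpDl.
have dl0 : (0 < dl)%R by rewrite !lt_min ltr01 !divr_gt0.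
have [[dl1 dlt] dle] : ((dl <= 1)%R /\ (dl <= t0 / 4)%R) /\ (dl <= eps / (C + 1))%R.
  by rewrite /dl !ge_min !lexx !orbT.
have Cdl : (C * dl <= eps)%R.
  apply: (@le_trans _ _ ((C + 1) * dl)%R); first by rewrite ler_wpM2r ?(ltW dl0)// lerDl.
  by rewrite mulrC -ler_pdivlMr.
exists (Num.min (dl * dl) (T - t0))%R; first by rewrite lt_min mulr_gt0// subr_gt0.
have dd : (dl * dl <= dl)%R by rewrite ler_piMl// ltW.
have main s s' x : (t0 * 3 / 4 <= s)%R -> (s <= s')%R -> (s' <= t0 * 5 / 4)%R -> (s' < T)%R ->
    (s' - s <= dl * dl)%R -> `|w s' x - w s x|%:E <= eps%:E * E (4 * t0)%R x.
  move=> h1 h2 h3 h4 h5.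
  have s0 : (0 < s)%R by apply: lt_le_trans h1; lra.
  have s'0 : (0 < s')%R by exact: lt_le_trans h2.
  have EP r : (t0 / 2 <= r)%R -> (r <= 4 * t0)%R -> E r x <= P%:E * E (4 * t0)%R x.
    move=> r1 r2; have r0 : (0 < r)%R by apply: lt_le_trans r1; lra.
    apply: (le_trans (heatE_le_time le_time x r0 r2 _ _)) => //.
    apply: lee_wpmul2r => //; rewrite lee_fin; apply: ge0_ler_powR; rewrite ?nnegrE//.
      by rewrite divr_ge0 ?mulr_ge0 ?(ltW t00) ?(ltW r0).
    by rewrite ler_pdivrMr//; lra.
  apply: (le_trans (solution_time_le x s0 h2 h4 dl0 _ _)); [exact: le_trans dd|lra|].
  have cmp (c c' : R) r : (0 <= c)%R -> (c <= c')%R -> (t0 / 2 <= r)%R -> (r <= 4 * t0)%R ->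
      c%:E * E r x <= (c' * P)%:E * E (4 * t0)%R x.
    move=> c0 cc r1 r2; rewrite [X in _ <= X * _]EFinM -muleA.
    by apply: lee_pmul => //; exact: EP.
  have ds : (0 <= s' - s)%R by rewrite subr_ge0.
  have k4 : (k (s / 2) <= k (t0 / 4))%R by apply: k_le; lra.
  apply: (@le_trans _ _ ((cL * 2 / t0 * dl * P)%:E * E (4 * t0)%R x +
    ((cL * 2 `^ pw * dl * P)%:E * E (4 * t0)%R x +
    ((4 * k (t0 / 4) * dl * P)%:E * E (4 * t0)%R x + (2 * k (t0 / 4) * dl * P)%:E * E (4 * t0)%R x)))).
    apply: leeD; last (apply: leeD; last apply: leeD); apply: cmp; try lra.
    - by rewrite mulr_ge0// divr_ge0 ?(ltW s0).
    - rewrite -!mulrA ler_wpM2l// ler_pdivrMr//.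
      rewrite (_ : 2 * (t0^-1 * dl) * s = dl * (2 * s / t0))%R; last by ring.
      apply: (le_trans h5); rewrite ler_wpM2l ?(ltW dl0)//; apply: (le_trans dl1).
      by rewrite ler_pdivlMr//; lra.
    - by rewrite !mulr_ge0 ?powR_ge0// invr_ge0 ltW.
    - by rewrite mulrAC ler_wpM2l// ler_pdivrMr.
    - by apply: mulr_ge0; [exact: mulr_ge0|rewrite addr_ge0// ltW].
    - rewrite (_ : 4 * k (t0 / 4) * dl = 2 * k (t0 / 4) * (dl + dl))%R; last by ring.
      apply: ler_pM; [exact: mulr_ge0|by rewrite addr_ge0// ltW|by rewrite ler_wpM2l|].
      by rewrite lerD2l (le_trans h5).
    - by apply: mulr_ge0; [exact: mulr_ge0|exact: ltW].
    - by rewrite ler_wpM2r ?(ltW dl0)// ler_wpM2l.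
  have t40 : (0 < 4 * t0)%R by rewrite mulr_gt0.
  rewrite -(fineK (E_fin x t40)) -!EFinM -!EFinD lee_fin -!mulrDl.
  rewrite ler_wpM2r ?fine_ge0//; apply: le_trans Cdl.
  by rewrite le_eqVlt; apply/orP; left; apply/eqP; rewrite /C; ring.
move=> t x; rewrite lt_min => /andP[tdl tT].
have tt1 : (t - t0 <= `|t - t0|)%R := ler_norm _.
have tt2 : (t0 - t <= `|t - t0|)%R by rewrite distrC ler_norm.
split; first by apply/andP; split; lra.
have [h|h] := leP t0 t; first by apply: main; lra.
by rewrite distrC; apply: main; lra.
Qed.

End time_continuity.

End fixed_point.

(** * Uniqueness of bounded solutions *)

Section bounded_uniqueness.
Variables (alpha m : R).
Hypotheses (alpha0 : (0 < alpha)%R) (m1 : (1 <= m)%R)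
  (lip : forall r r' M : R, (`|r| <= M)%R -> (`|r'| <= M)%R ->
    (`|powabs alpha r - powabs alpha r'| <= m * M `^ alpha * `|r - r'|)%R).

Lemma duhE_restrict (a t : R) (P : R -> X -> \bar R) x : (0 <= a)%R ->
  duhE 0 t (fun s y => (\1_`]a, t[ s)%:E * P s y) x = duhE a t P x.
Proof.
move=> a0; rewrite /duhE integral_mkcond [RHS]integral_mkcond.
apply: eq_integral => s _; rewrite !patchE !mem_setE !in_itv/=.
case: (boolP (a < s < t)%R) => ast.
  have /andP[as_ st] := ast; rewrite (le_lt_trans a0 as_) st/=.
  by congr heatE; apply/funext => y; rewrite indicE mem_setE in_itv/= ast mul1e.
case: ifP => // _; rewrite /heatE integral0_eq// => y _.
by rewrite indicE mem_setE in_itv/= (negPf ast) mul0e mule0.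
Qed.

(** Agreement before [a] removes (0, a) from the difference of the Duhamel terms; on (a, b) the
    nonlinearity is Lipschitz and Gronwall's argument applies. For a = 0 the agreement is vacuous,
    which is the way it is used when q = oo. *)
Lemma unique_bounded (u0 : X -> R) (u v : R -> X -> R) (a b M : R) : (0 <= a)%R ->
  rmeasurable u -> rmeasurable v -> (0 <= M)%R ->
  {ae leb1, forall s, (a < s < b)%R -> {ae mu, forall y, (`|u s y| <= M)%R}} ->
  {ae leb1, forall s, (a < s < b)%R -> {ae mu, forall y, (`|v s y| <= M)%R}} ->
  (forall s, (0 < s < a)%R -> {ae mu, forall y, u s y = v s y}) ->
  (forall t, (a < t < b)%R -> {ae mu, forall x,
    duhE 0 t (fun s y => `|nonlinR alpha u s y|%:E) x < +oo /\
    u t x = (heatR t u0 x + duhR 0 t (nonlinR alpha u) x)%R}) ->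
  (forall t, (a < t < b)%R -> {ae mu, forall x,
    duhE 0 t (fun s y => `|nonlinR alpha v s y|%:E) x < +oo /\
    v t x = (heatR t u0 x + duhR 0 t (nonlinR alpha v) x)%R}) ->
  forall t, (a < t < b)%R -> {ae mu, forall x, u t x = v t x}.
Proof.
move=> a0 mu_ mv M0 uM vM uv uD vD t tab.
(* [M + 1] keeps L positive when M = 0, as Gronwall's argument asks. *)
pose P s y := `|u s y - v s y|%:E; pose L := (m * (M + 1) `^ alpha)%R.
have L0 : (0 < L)%R by rewrite mulr_gt0 ?powR_gt0 ?(lt_le_trans ltr01)// lerDr.
have mP : pmeasurable P.
  by apply/measurable_EFinP; apply: measurableT_comp => //; exact: measurable_funB.
have P0 s y : 0 <= P s y by rewrite lee_fin.
have fmu := rmeasurable_nonlinR alpha mu_; have fmv := rmeasurable_nonlinR alpha mv.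
have PM : {ae leb1, forall s, (a < s < b)%R -> {ae mu, forall y, P s y <= (2 * M)%:E}}.
  apply: ae_imply2 uM vM => s h1 h2 sab.
  move: (h1 sab) (h2 sab); apply: filterS2 => y h3 h4; rewrite lee_fin.
  by apply: (le_trans (ler_normB _ _)); lra.
have PD t' : (a < t' < b)%R -> {ae mu, forall x, P t' x <= L%:E * duhE a t' P x}.
  move=> tab'; move: (uD _ tab') (vD _ tab'); apply: filterS2 => x [h1 h2] [h3 h4].
  rewrite /P h2 h4 opprD addrACA subrr add0r -duhEZ//; last exact: ltW.
  apply: (le_trans (le_duhR_sub fmu fmv h1 h3)).
  have q0 s y : 0 <= (\1_`]a, t'[ s)%:E * (L%:E * P s y).
    by apply: mule_ge0; [rewrite lee_fin|apply: mule_ge0; rewrite // lee_fin ltW].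
  rewrite -[leRHS](@duhE_restrict a t' (fun s y => L%:E * P s y) x a0); apply: le_duhE.
  - apply/measurable_EFinP; apply: measurableT_comp => //; exact: measurable_funB.
  - apply: emeasurable_funM.
      by apply/measurable_EFinP; exact: measurable_indic_fst.
    by apply: emeasurable_funM.
  - by move=> s y; rewrite lee_fin.
  - exact: q0.
  (* At s = a neither the agreement nor the bounds are known. *)
  have a_null : {ae leb1, forall s, s != a}.
    exists [set a]; split => //; first exact: lebesgue_measure_set1.
    by move=> s /= /negP; rewrite negbK => /eqP.
  apply: ae_imply3 a_null uM vM => s sa h5 h6 /andP[s0 st].
  have [as_|sa'] := ltP a s; last first.
    have {}sa : (s < a)%R by rewrite lt_neqAle sa.
    apply: filterS (uv s _); last by rewrite s0.
    by move=> y uvy; rewrite /nonlinR uvy subrr normr0; exact: q0.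
  have sab : (a < s < b)%R by rewrite as_ (lt_trans st)//; case/andP: tab'.
  move: (h5 sab) (h6 sab); apply: filterS2 => y uMy vMy.
  rewrite indicE mem_setE in_itv/= as_ st mul1e -EFinM lee_fin.
  apply: lip; [apply: (le_trans uMy)|apply: (le_trans vMy)]; by rewrite lerDl.
have M20 : (0 <= 2 * M)%R by rewrite mulr_ge0.
apply: filterS (gronwall_duhE mP P0 L0 M20 PM PD tab) => x.
by move=> /eqP; rewrite eqe normr_eq0 subr_eq0 => /eqP.
Qed.

(** Let V(s) = e^{(s-e) Delta}|v| and let P be the positive part of |u| - 2 V. The nonlinearity is
    at most k V + L P, and [small] says that k has integral at most 1, so the Duhamel term is at
    most V plus L times that of P. Hence |u| <= 2 V + L times the Duhamel term of P, so P satisfies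
    a linear Gronwall inequality without source and vanishes. This replaces a continuity argument in
    time for the pointwise barrier 2 V. *)
Lemma comparison (u : R -> X -> R) (v : X -> R) (e tau K b : R) :
  rmeasurable u -> measurable_fun setT v -> (0 <= K)%R -> (0 <= b)%R -> (alpha * b < 1)%R ->
  (forall s x, (0 < s)%R -> heatE s (fun y => `|v y|%:E) x <= (K * s `^ (- b))%:E) ->
  ((2 * K) `^ alpha * ((tau - e) `^ (1 - alpha * b) / (1 - alpha * b)) <= 2^-1)%R ->
  (forall t, (e < t < tau)%R -> exists M : R,
    {ae leb1, forall s, (e < s < t)%R -> {ae mu, forall y, (`|u s y| <= M)%R}}) ->
  (forall t, (e < t < tau)%R -> {ae mu, forall x, `|u t x|%:E <=
    heatE (t - e) (fun y => `|v y|%:E) x + duhE e t (fun s y => `|nonlinR alpha u s y|%:E) x}) ->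
  forall t, (e < t < tau)%R ->
    {ae mu, forall x, `|u t x|%:E <= 2%:E * heatE (t - e) (fun y => `|v y|%:E) x}.
Proof.
move=> mu_ mv K0 b0 ab1 HK small bound ineq t tet.
have ab10 : (0 < 1 - alpha * b)%R by rewrite subr_gt0.
pose V s := heatE (s - e) (fun y => `|v y|%:E).
have mabsv : measurable_fun setT (fun y => `|v y|%:E).
  by apply/measurable_EFinP; exact: measurableT_comp.
have V0 s y : 0 <= V s y by apply: heatE_ge0 => z; rewrite lee_fin.
have mV : pmeasurable V.
  apply: (measurable_heatE_param (Z := (Rm * X)%type) (tau := (fun z => z.1 - e)%R) (xi := snd)
    (Q := fun _ y => `|v y|%:E)) => //.
  - by apply: measurable_funB.
  - exact: (measurableT_comp mabsv measurable_snd).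
have Vfin s y : (e < s)%R -> V s y \is a fin_num.
  by move=> es; rewrite ge0_fin_numE//; apply: le_lt_trans (HK _ _ _) (ltry _); rewrite subr_gt0.
pose h s y := fine (V s y).
have h0 s y : (0 <= h s y)%R by rewrite fine_ge0.
have mh : rmeasurable h by exact: measurableT_comp.
pose p s y := Num.max (`|u s y| - 2 * h s y)%R 0%R.
have mp : rmeasurable p.
  apply: measurable_maxr => //; apply: measurable_funB; first exact: measurableT_comp.
  exact: measurable_funM.
have p0 s y : (0 <= p s y)%R by rewrite le_max lexx orbT.
pose P s y := (p s y)%:E.
have mP : pmeasurable P by exact/measurable_EFinP.
have P0 s y : 0 <= P s y by rewrite lee_fin.
(* The bound on u is available on intervals ending before [tau]; this one still contains [t] in its
   interior. *)
pose t1 := ((t + tau) / 2)%R.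
have et1 : (e < t1 < tau)%R by rewrite /t1; move: tet; lra.
have [M uM] := bound _ et1.
pose L := (m * (`|M| + 1) `^ alpha)%R.
have L0 : (0 < L)%R by rewrite mulr_gt0 ?powR_gt0 ?(lt_le_trans ltr01)// lerDr.
pose k s := (2 * (2 * K) `^ alpha * (s - e) `^ (- (alpha * b)))%R.
have k0 s : (0 <= k s)%R by rewrite !mulr_ge0 ?powR_ge0.
have mk : measurable_fun setT (k : Rm -> R).
  apply: measurable_funM => //.
  by have /measurable_EFinP := @measurable_powR_shift R setT (- (alpha * b)) e.
have nonlin_le s y : (e < s)%R -> (`|u s y| <= M)%R ->
    `|nonlinR alpha u s y|%:E <= (k s)%:E * V s y + L%:E * P s y.
  move=> es usM; have se0 : (0 < s - e)%R by rewrite subr_gt0.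
  have := HK _ y se0; rewrite -/(V s y) -(fineK (Vfin s y es)) -/(h s y) lee_fin => hK.
  rewrite -!EFinM -EFinD lee_fin /nonlinR norm_powabs.
  have sb0 : (0 <= (s - e) `^ (- b))%R by exact: powR_ge0.
  have hk : ((2 * h s y) `^ alpha * (2 * h s y) <= k s * h s y)%R.
    rewrite (_ : k s * h s y = (2 * K) `^ alpha * (s - e) `^ (- (alpha * b)) * (2 * h s y))%R; last first.
      by rewrite /k; ring.
    rewrite ler_wpM2r ?mulr_ge0//.
    apply: (@le_trans _ _ ((2 * K * (s - e) `^ (- b)) `^ alpha)%R).
      by apply: ge0_ler_powR; rewrite ?nnegrE ?(ltW alpha0) ?mulr_ge0//; lra.
    by rewrite powRM// ?mulr_ge0// -powRrM mulNr (mulrC b).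
  have Lp0 : (0 <= L * p s y)%R by rewrite mulr_ge0// ltW.
  (* Below the barrier 2 h the term with [k] suffices; above it the Lipschitz bound is used between
     the barrier and |u|, whose difference is [p]. *)
  have [uh|hu] := leP `|u s y|%R (2 * h s y)%R.
    apply: (@le_trans _ _ ((2 * h s y) `^ alpha * (2 * h s y))%R); last by lra.
    apply: ler_pM => //.
    by apply: ge0_ler_powR; rewrite ?nnegrE ?(ltW alpha0) ?mulr_ge0.
  have M0 : (0 <= M)%R by exact: le_trans usM.
  have hM : (`|(2 * h s y)%R| <= M)%R.
    by rewrite ger0_norm ?mulr_ge0//; apply: le_trans usM; exact: ltW.
  have nuM : (`| `|u s y| | <= M)%R by rewrite normr_id.
  have := lip nuM hM; rewrite /powabs normr_id (ger0_norm (_ : 0 <= 2 * h s y)%R) ?mulr_ge0//.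
  rewrite (ger0_norm (_ : 0 <= `|u s y| - 2 * h s y)%R) ?subr_ge0 ?(ltW hu)//.
  move=> /(le_trans (ler_norm _)) => h1.
  have pE : p s y = (`|u s y| - 2 * h s y)%R.
    by rewrite /p; apply/max_idPl; rewrite subr_ge0 ltW.
  have h2 : (m * M `^ alpha * (`|u s y| - 2 * h s y) <= L * p s y)%R.
    rewrite pE ler_wpM2r ?subr_ge0 ?(ltW hu)// ler_wpM2l ?(le_trans ler01)//.
    apply: ge0_ler_powR; rewrite ?nnegrE ?(ltW alpha0) ?addr_ge0//.
    by rewrite ger0_norm// lerDl.
  lra.
have PD t' : (e < t' < t1)%R -> {ae mu, forall x, P t' x <= L%:E * duhE e t' P x}.
  move=> et'; have /andP[et'1 t'1] := et'.
  have t'tau : (e < t' < tau)%R by rewrite et'1 (lt_trans t'1)//; case/andP: et1.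
  apply: filterS (ineq _ t'tau) => x ux.
  have int_k : \int[leb1]_(s in `]e, t'[) (k s)%:E <= 1.
    under eq_integral do rewrite EFinM.
    rewrite ge0_integralZl_EFin//; last 3 first.
    - by move=> s _; rewrite lee_fin powR_ge0.
    - exact: measurable_powR_shift.
    - by rewrite mulr_ge0 ?powR_ge0.
    apply: (@le_trans _ _ ((2 * (2 * K) `^ alpha)%:E *
        ((tau - e) `^ (1 - alpha * b) / (1 - alpha * b))%:E)).
      apply: lee_wpmul2l; first by rewrite lee_fin mulr_ge0 ?powR_ge0.
      apply: (le_trans (integral_powR_shift _ _ _)) => //; first by rewrite mulr_ge0// ltW.
      rewrite lee_fin ler_wpM2r ?invr_ge0 ?(ltW ab10)//.
      have /andP[_ /ltW t'le] := t'tau.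
      apply: ge0_ler_powR; rewrite ?nnegrE ?(ltW ab10) ?subr_ge0 ?lerD2r ?(ltW et'1)//.
      exact: le_trans (ltW et'1) t'le.
    by rewrite -EFinM lee_fin; lra.
  have hD : duhE e t' (fun s y => `|nonlinR alpha u s y|%:E) x <= V t' x + L%:E * duhE e t' P x.
    apply: (@le_trans _ _ (duhE e t' (fun s y => (k s)%:E * V s y + L%:E * P s y) x)).
      apply: le_duhE.
      - by apply: rmeasurable_norm; exact: rmeasurable_nonlinR.
      - apply: emeasurable_funD; last exact: emeasurable_funM.
        apply: emeasurable_funM => //; apply/measurable_EFinP.
        exact: (measurableT_comp mk measurable_fst).
      - by move=> s y; rewrite lee_fin.
      - by move=> s y; apply: adde_ge0; apply: mule_ge0; rewrite // lee_fin// ltW.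
      - apply: ae_imply uM => s hs /andP[es st].
        have est : (e < s < t1)%R by rewrite es (lt_trans st).
        by apply: filterS (hs est) => y; exact: nonlin_le.
    rewrite duhED; last 4 first.
    - apply: emeasurable_funM => //; apply/measurable_EFinP.
      exact: (measurableT_comp mk measurable_fst).
    - exact: emeasurable_funM.
    - by move=> s y; apply: mule_ge0; rewrite // lee_fin.
    - by move=> s y; apply: mule_ge0; rewrite // lee_fin// ltW.
    rewrite duhEZ ?(ltW L0)// leeD2r//.
    rewrite duhE_heatE//.
    by rewrite -[leRHS]mul1e; apply: lee_wpmul2r => //; exact: V0.
  have {hD}ux : `|u t' x|%:E <= (2 * h t' x)%:E + L%:E * duhE e t' P x.
    apply: (le_trans ux); rewrite -/(V t' x) mulr_natl mulr2n EFinD /h fineK ?Vfin//.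
    by rewrite -[leRHS]addeA; apply: leeD2l.
  have D0 : 0 <= L%:E * duhE e t' P x by apply: mule_ge0; [rewrite lee_fin ltW|exact: duhE_ge0].
  rewrite /P /p; have [uh|hu] := leP `|u t' x|%R (2 * h t' x)%R.
    by rewrite (max_idPr _)// subr_le0.
  rewrite (max_idPl _) ?subr_ge0 ?(ltW hu)//.
  by rewrite EFinB leeBlDl.
have PM : {ae leb1, forall s, (e < s < t1)%R -> {ae mu, forall y, P s y <= `|M|%:E}}.
  apply: ae_imply uM => s hs est; apply: filterS (hs est) => y usM.
  rewrite lee_fin ge_max normr_ge0 andbT.
  apply: (@le_trans _ _ `|u s y|%R); first by rewrite lerBlDr lerDl mulr_ge0.
  exact: le_trans usM (ler_norm _).
have tt1 : (e < t < t1)%R by rewrite /t1; move: tet; lra.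
apply: filterS (gronwall_duhE mP P0 L0 (normr_ge0 M) PM PD tt1) => x /eqP.
rewrite eqe => /eqP pt0; have et : (e < t)%R by case/andP: tet.
rewrite -/(V t x) -(fineK (Vfin t x et)) -EFinM lee_fin -subr_le0 -/(h t x).
by rewrite -[leRHS]pt0 le_max lexx.
Qed.

End bounded_uniqueness.

End semigroup.

(** * Smoothing estimates *)

Section Lnorm_order.
Context {R : realType} d (X : measurableType d) (mu : {measure set X -> \bar R}).
Local Open Scope ereal_scope.

Lemma Lnorm_le (q : \bar R) (f g : X -> \bar R) : 0 < q ->
  measurable_fun setT f -> measurable_fun setT g ->
  {ae mu, forall x, `|f x| <= `|g x|} -> 'N[mu]_q[f] <= 'N[mu]_q[g].
Proof.
case: q => [r| |//]; last first.
  move=> _ mf mg fg; rewrite unlock; case: ifPn => // _; exact: le_ess_sup.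
rewrite lte_fin => r0 mf mg fg; rewrite unlock; apply: gt0_ler_poweR.
- by rewrite invr_ge0 ltW.
- by rewrite in_itv/= leey andbT; apply: integral_ge0 => x _; exact: poweR_ge0.
- by rewrite in_itv/= leey andbT; apply: integral_ge0 => x _; exact: poweR_ge0.
have mp (h : X -> \bar R) : measurable_fun setT h -> measurable_fun setT (fun x => `|h x| `^ r).
  by move=> mh; apply: (measurableT_comp (measurable_poweR _)); exact: measurableT_comp.
apply: ae_ge0_le_integral => //; try by move=> x _; exact: poweR_ge0.
- exact: mp.
- exact: mp.
apply: filterS fg => x h _; apply: gt0_ler_poweR; rewrite ?in_itv/= ?leey ?abse_ge0//.
exact: ltW.
Qed.

Lemma Lnormy_le (f : X -> \bar R) M : 0 <= M -> {ae mu, forall x, `|f x| <= M} ->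
  'N[mu]_+oo[f] <= M.
Proof. by move=> M0 fM; rewrite unlock; case: ifPn => // _; apply/ess_supP. Qed.

Lemma Lnormy_ge (f : X -> \bar R) : {ae mu, forall x, `|f x| <= 'N[mu]_+oo[f]}.
Proof.
rewrite unlock; case: ifPn => [_|]; first exact: (ess_sup_ge mu (abse \o f)).
(* On a null space the L^oo norm is 0 by convention, and any property holds almost everywhere. *)
rewrite -leNgt => mu0; exists setT; split => //.
by apply/eqP; rewrite eq_le mu0 measure_ge0.
Qed.

Lemma LfunP_bound (q : \bar R) (f : X -> R) : f \in Lfun mu q <->
  measurable_fun setT f /\ 'N[mu]_q[EFin \o f] < +oo.
Proof.
split.
  move=> /andP[]; rewrite inE/= => mf; rewrite inE => fq.
  by split => //; exact: fq.
by move=> [mf fq]; apply/andP; split; rewrite inE.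
Qed.

Lemma Lnorm_cmul (q : \bar R) (f : X -> R) (c : R) : 1 <= q -> f \in Lfun mu q ->
  'N[mu]_q[EFin \o (fun x => c * f x)%R] = `|c|%:E * 'N[mu]_q[EFin \o f].
Proof. by move=> q1 fq; have := LnormZ (Lfun_Sub q1 fq) c. Qed.

Lemma Lfun_cmul (q : \bar R) (f : X -> R) (c : R) : 1 <= q -> f \in Lfun mu q ->
  (fun x => c * f x)%R \in Lfun mu q.
Proof.
move=> q1 /[dup] fq /LfunP_bound[mf fqoo]; apply/LfunP_bound; split.
  exact: measurable_funM.
rewrite Lnorm_cmul//; apply: lte_mul_pinfty => //; by rewrite ?lee_fin.
Qed.

End Lnorm_order.

Section heat_Lnorm.
Context {R : realType} d (X : measurableType d)
  (mu : {sigma_finite_measure set X -> \bar R}) (G : R -> X -> X -> R)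
  (KG : semigroup_kernel mu G) (GC : forall t x y, G t x y = G t y x).
Local Open Scope ereal_scope.
Local Notation E f t := (heatE mu G t (fun y => `|f y|%:E)).

Let G0 t x y : (0 <= G t x y)%R. Proof. exact: kernel_ge0 KG _ _ _. Qed.
#[local] Hint Resolve G0 : core.

Let mG t x : measurable_fun setT (G t x).
Proof. exact: (measurable_kernel_comp KG). Qed.

Lemma heatE_lnormy t (f : X -> R) x : (0 < t)%R -> measurable_fun setT f ->
  E f t x <= 'N[mu]_+oo[EFin \o f].
Proof.
move=> t0 mf.
have [N|N] := eqVneq ('N[mu]_+oo[EFin \o f]) +oo; first by rewrite N leey.
have Nf : 'N[mu]_+oo[EFin \o f] \is a fin_num by rewrite ge0_fin_numE ?Lnorm_ge0// lt_neqAle N leey.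
rewrite -(fineK Nf) -(heatE_cst KG x (fine 'N[mu]_+oo[EFin \o f]) t0).
apply: (le_heatE KG) => //.
- by apply/measurable_EFinP; exact: measurableT_comp.
- by move=> y; rewrite /= lee_fin fine_ge0// Lnorm_ge0.
- by have := Lnormy_ge mu (EFin \o f); apply: filterS => y /=; rewrite -{1}(fineK Nf).
Qed.

(** Jensen's inequality for the probability density G t x, obtained from Hoelder's inequality with
    the splitting G = G^(1/p') G^(1/r), whose first factor has norm 1 in L^p'. *)
Lemma heatE_jensen t (f : X -> R) (r : R) x : (0 < t)%R -> (1 < r)%R -> measurable_fun setT f ->
  (E f t x) `^ r <= heatE mu G t (fun y => (`|f y| `^ r)%:E) x.
Proof.
move=> t0 r1 mf; have r0 : (0 < r)%R by exact: lt_trans r1.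
have [p' [p'0 pp]] : exists p' : R, (0 < p')%R /\ (p'^-1 + r^-1 = 1)%R.
  exists ((1 - r^-1)^-1)%R; split; last by rewrite invrK subrK.
  by rewrite invr_gt0 subr_gt0 invf_lt1.
have p'i : (p'^-1 = 1 - r^-1)%R by rewrite -pp addrK.
have mf1 : measurable_fun setT (fun y => (G t x y `^ p'^-1)%R).
  by apply: (measurableT_comp (measurable_powR _)).
have mf2 : measurable_fun setT (fun y => (G t x y `^ r^-1 * `|f y|)%R).
  apply: measurable_funM; last exact: measurableT_comp.
  by apply: (measurableT_comp (measurable_powR _)).
have := @hoelder _ _ _ mu _ _ p' r mf1 mf2 p'0 r0 pp.
rewrite Lnorm1 => H.
have -> : heatE mu G t (fun y => (`|f y| `^ r)%:E) x =
    ('N[mu]_r%:E[EFin \o (fun y => (G t x y `^ r^-1 * `|f y|)%R)]) `^ r.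
  rewrite poweR_Lnorm ?gt_eqF//; apply: eq_integral => y _ /=.
  rewrite -EFinM; congr EFin; rewrite [in RHS]ger0_norm; last by rewrite mulr_ge0// powR_ge0.
  rewrite powRM ?powR_ge0//; by rewrite -powRrM mulVf ?gt_eqF// powRr1.
apply: gt0_ler_poweR; rewrite ?in_itv/= ?leey ?Lnorm_ge0 ?(ltW r0)//.
  by rewrite andbT; apply: heatE_ge0 => // y; rewrite lee_fin.
have N1 : 'N[mu]_p'%:E[EFin \o (fun y => (G t x y `^ p'^-1)%R)] = 1.
  rewrite unlock (_ : (\int[mu]_y _) = 1); first by rewrite poweR_EFin powR1.
  rewrite -(kernel_mass KG x t0); apply: eq_integral => y _ /=.
  by rewrite ger0_norm ?powR_ge0// ?poweR_EFin -powRrM mulVf ?gt_eqF// powRr1.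
rewrite N1 mul1e in H; apply: le_trans H.
rewrite /heatE; apply: ge0_le_integral => //.
- by move=> y _; rewrite -EFinM lee_fin mulr_ge0.
- by apply: emeasurable_funM; apply/measurable_EFinP => //; exact: measurableT_comp.
- apply/measurable_EFinP; apply: measurableT_comp => //; exact: measurable_funM.
- move=> y _; rewrite /= -EFinM lee_fin mulrA normrM normr_id ger0_norm ?mulr_ge0 ?powR_ge0//.
  rewrite -powRD ?pp ?powRr1//.
  by rewrite oner_eq0.
Qed.

(** For finite q, integrate Jensen's inequality in x and exchange the integrals; the mass in the
    first variable is one by the symmetry [GC]. *)
Lemma Lnorm_heatE q t (f : X -> R) : (0 < t)%R -> 1 < q -> measurable_fun setT f ->
  'N[mu]_q[E f t] <= 'N[mu]_q[EFin \o f].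
Proof.
move=> t0 q1 mf; case: q q1 => [r| |//]; last first.
  move=> _; apply: Lnormy_le; first exact: Lnorm_ge0.
  apply: aeW => x; rewrite gee0_abs.
    exact: heatE_lnormy.
  by apply: heatE_ge0 => // y; rewrite lee_fin.
rewrite lte_fin => r1; have r0 : (0 < r)%R by exact: lt_trans r1.
have E0 x : 0 <= E f t x by apply: heatE_ge0 => // y; rewrite lee_fin.
rewrite unlock; apply: gt0_ler_poweR.
- by rewrite invr_ge0 ltW.
- by rewrite in_itv/= leey andbT; apply: integral_ge0 => x _; exact: poweR_ge0.
- by rewrite in_itv/= leey andbT; apply: integral_ge0 => x _; rewrite lee_fin powR_ge0.
have mfa : measurable_fun setT (fun y => `|f y|%:E).
  by apply/measurable_EFinP; exact: measurableT_comp.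
have mfr : measurable_fun setT (fun y => (`|f y| `^ r)%:E).
  apply/measurable_EFinP; apply: (measurableT_comp (measurable_powR _)); exact: measurableT_comp.
apply: (@le_trans _ _ (\int[mu]_x heatE mu G t (fun y => (`|f y| `^ r)%:E) x)).
  apply: ge0_le_integral => //.
  - by move=> x _; exact: poweR_ge0.
  - apply: (measurableT_comp (measurable_poweR _)); apply: measurableT_comp => //.
    by apply: (measurable_heatE KG) => // y; rewrite lee_fin.
  - by apply: (measurable_heatE KG) => // y; rewrite lee_fin powR_ge0.
  - by move=> x _; rewrite gee0_abs//; exact: heatE_jensen.
rewrite /heatE.
rewrite (@fubini_tonelli _ _ _ _ _ mu mu (fun z : X * X => (G t z.1 z.2)%:E * (`|f z.2| `^ r)%:E)) /=; last 2 first.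
- apply: emeasurable_funM.
    by apply/measurable_EFinP; apply: (measurable_kernel_comp KG (tau := fun=> t)).
  exact: (measurableT_comp mfr measurable_snd).
- by move=> z; rewrite -EFinM lee_fin mulr_ge0 ?powR_ge0.
apply: ge0_le_integral => //.
- by move=> y _; apply: integral_ge0 => x _; rewrite -EFinM lee_fin mulr_ge0 ?powR_ge0.
- apply: (@measurable_integral_param _ _ _ X X mu
    (fun z : X * X => (G t z.2 z.1)%:E * (`|f z.1| `^ r)%:E)).
  apply: emeasurable_funM; last exact: (measurableT_comp mfr measurable_fst).
  by apply/measurable_EFinP; apply: (measurable_kernel_comp KG (tau := fun=> t)).
- move=> y _; rewrite ge0_integralZr//; last 2 first.
  + by apply/measurable_EFinP; apply: (measurable_kernel_comp KG (tau := fun=> t)).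
  + by move=> x _; rewrite lee_fin.
  under eq_integral do rewrite GC.
  by rewrite (kernel_mass KG y t0) mul1e.
Qed.

End heat_Lnorm.

(** * Weighted bounds for the Gaussian *)

Section reflection.
Context {R : realType}.
Local Notation leb1 := (@lebesgue_measure R).
Local Notation Rm := (measurableTypeR R).
Local Open Scope ereal_scope.

Let mopp : measurable_fun setT (-%R : Rm -> Rm). Proof. exact: oppr_measurable. Qed.

(** Lebesgue measure and its image under reflection agree on half-open intervals, hence
    everywhere. *)
Lemma integral_oppr (f : R -> \bar R) : measurable_fun setT (f : Rm -> _) -> (forall x, 0 <= f x) ->
  \int[leb1]_x f (- x)%R = \int[leb1]_x f x.
Proof.
move=> mf f0.
pose m := isMeasurableFun.Build _ _ Rm Rm (-%R : Rm -> Rm) mopp.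
pose o : {mfun Rm >-> Rm} := HB.pack (-%R : Rm -> Rm) m.
have H : forall A : set Rm, measurable A -> leb1 A = pushforward leb1 o A.
  apply: lebesgue_measure_unique => X [[a b] _ <-].
  rewrite [RHS](_ : _ = leb1 (`[(- b)%R, (- a)%R[%classic)); last first.
    congr (leb1 _); apply/seteqP; split => x; rewrite /= !in_itv/= lerNl ltrNr andbC//.
  by rewrite !lebesgue_measure_itv/= !lte_fin ltrN2 !EFinN oppeK addeC.
rewrite [RHS](@eq_measure_integral _ _ _ _ (pushforward leb1 o)); last by move=> A mA _; exact: H.
rewrite (@ge0_integral_pushforward _ _ _ _ R _ mopp leb1 setT f) ?preimage_setT//.
Qed.

Lemma integral_normr_le (h : R -> \bar R) : measurable_fun setT (h : Rm -> _) -> (forall x, 0 <= h x) ->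
  \int[leb1]_x h `|x|%R <= 2%:E * \int[leb1]_(x in `[0%R, +oo[) h x.
Proof.
move=> mh h0.
pose D : set Rm := `[0%R, +oo[%classic.
have mD : measurable D by exact: measurable_itv.
pose g (x : Rm) := (\1_D x)%:E * h x.
have g0 x : 0 <= g x by rewrite mule_ge0// lee_fin.
have mg : measurable_fun setT g.
  by apply: emeasurable_funM => //; apply/measurable_EFinP; exact: measurable_indic.
have gE : \int[leb1]_(x in D) h x = \int[leb1]_x g x.
  rewrite integral_mkcond; apply: eq_integral => x _; rewrite /g patchE indicE.
  by case: ifPn => _; rewrite ?mul1e ?mul0e.
rewrite gE mule_natl mule2n -{2}(integral_oppr mg g0).
rewrite -ge0_integralD//; last exact: measurableT_comp.
apply: ge0_le_integral => //.
- by apply: measurableT_comp => //; exact: normr_measurable.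
- by apply: emeasurable_funD => //; exact: measurableT_comp.
- move=> x _; have [x0|x0] := leP 0%R x.
    apply: (@le_trans _ _ (g x)); last by rewrite leeDl.
    by rewrite /g indicE mem_setE in_itv/= andbT x0 mul1e ger0_norm.
  apply: (@le_trans _ _ (g (- x)%R)); last by rewrite leeDr.
  by rewrite /g indicE mem_setE in_itv/= andbT oppr_ge0 (ltW x0) mul1e ltr0_norm.
Qed.

End reflection.

Section gaussian_powers.
Context {R : realType}.
Local Notation leb1 := (@lebesgue_measure R).
Local Notation Rm := (measurableTypeR R).

Lemma gauss1_le (t a b : R) : 0 < t -> gauss1 t a b <= (4 * pi * t) `^ (- 2^-1).
Proof.
move=> t0; rewrite /gauss1 powRN powR12_sqrt ?mulr_ge0 ?pi_ge0 ?(ltW t0)//.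
rewrite -[leRHS]mulr1; apply: ler_wpM2l; first by rewrite invr_ge0 sqrtr_ge0.
by rewrite -expR0 ler_expR oppr_le0 divr_ge0 ?sqr_ge0// mulr_ge0// (ltW t0).
Qed.

(* The singular factor is integrated over |y| <= sqrt t and bounded by its value at sqrt t elsewhere. *)
Lemma integral_gauss1_powR (p a : R) : 1 <= p -> 0 <= a -> a < 1 ->
  exists2 C : R, 0 <= C & forall t x, 0 < t ->
    (\int[leb1]_y (gauss1 t x y `^ p * `|y| `^ (- a))%:E <=
     (C * t `^ (- (p / 2) + (1 - a) / 2))%:E)%E.
Proof.
move=> p1 a0 a1.
have p4 : 0 < 4 * pi :> R by rewrite mulr_gt0// pi_gt0.
have a10 : 0 < 1 - a by rewrite subr_gt0.
exists ((4 * pi) `^ (- (p / 2)) * (2 * ((1 - a)^-1)) + (4 * pi) `^ (- ((p - 1) / 2))).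
  by rewrite addr_ge0 ?powR_ge0// mulr_ge0 ?powR_ge0// mulr_ge0// invr_ge0 ltW.
move=> t x t0; have pt0 : 0 < 4 * pi * t by rewrite mulr_gt0.
pose r := t `^ 2^-1; have r0 : 0 < r by rewrite powR_gt0.
pose D : set Rm := `[0, r]%classic.
pose h (y : R) : \bar R := ((\1_D y)%:E * (y `^ (- a))%:E)%E.
have mD : measurable D by exact: measurable_itv.
have mh : measurable_fun setT (h : Rm -> _).
  apply: emeasurable_funM; apply/measurable_EFinP; first exact: measurable_indic.
  exact: measurable_powR.
have h0 y : (0 <= h y)%E by rewrite mule_ge0// lee_fin ?powR_ge0.
have mg := measurable_gauss1 t x.
apply: (@le_trans _ _ (\int[leb1]_y (((4 * pi * t) `^ (- (p / 2)))%:E * h `|y|%R +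
    ((4 * pi * t) `^ (- ((p - 1) / 2)) * r `^ (- a))%:E * (gauss1 t x y)%:E))%E).
  apply: ge0_le_integral => //.
  - by move=> y _; rewrite lee_fin mulr_ge0 ?powR_ge0.
  - apply/measurable_EFinP; apply: measurable_funM.
      exact: (measurableT_comp (measurable_powR _)).
    by apply: (measurableT_comp (measurable_powR _)); exact: normr_measurable.
  - apply: emeasurable_funD; apply: emeasurable_funM => //.
      by apply: (measurableT_comp mh); exact: normr_measurable.
    exact/measurable_EFinP.
  - move=> y _; rewrite /h indicE mem_setE in_itv/= normr_ge0/=.
    have gp0 : 0 <= gauss1 t x y by exact: gauss1_ge0.
    have p0 : 0 <= p by exact: le_trans p1.
    have [yr|yr] := leP `|y| r.
      apply: (@le_trans _ _ (((4 * pi * t) `^ (- (p / 2)))%:E * (1%:E * (`|y| `^ (- a))%:E))%E); last first.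
        by rewrite leeDl// -EFinM lee_fin mulr_ge0 ?mulr_ge0 ?powR_ge0.
      rewrite mul1e -EFinM lee_fin ler_wpM2r ?powR_ge0//.
      rewrite (_ : - (p / 2) = - 2^-1 * p); last by rewrite mulNr mulrC.
      by rewrite powRrM; apply: ge0_ler_powR; rewrite ?nnegrE ?powR_ge0// gauss1_le.
    rewrite mul0e mule0 add0e -EFinM lee_fin [leRHS]mulrAC.
    apply: ler_pM; rewrite ?powR_ge0//.
      have -> : gauss1 t x y `^ p = gauss1 t x y `^ (p - 1) * gauss1 t x y.
        rewrite -{3}[gauss1 t x y]powRr1// -powRD ?subrK//.
        by rewrite gt_eqF ?implyFb// (lt_le_trans ltr01).
      rewrite ler_wpM2r// (_ : - ((p - 1) / 2) = - 2^-1 * (p - 1)); last by rewrite mulNr mulrC.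
      by rewrite powRrM; apply: ge0_ler_powR; rewrite ?nnegrE ?powR_ge0 ?gauss1_le// subr_ge0.
    rewrite !powRN lef_pV2 ?posrE ?powR_gt0//; last by apply: lt_trans yr.
    by apply: ge0_ler_powR; rewrite ?nnegrE ?(ltW r0) ?(ltW yr).
rewrite ge0_integralD//; last 4 first.
- by move=> y _; rewrite mule_ge0// lee_fin powR_ge0.
- apply: emeasurable_funM => //.
  by apply: (measurableT_comp mh); exact: normr_measurable.
- by move=> y _; rewrite -EFinM lee_fin mulr_ge0 ?mulr_ge0 ?powR_ge0 ?gauss1_ge0.
- by apply: emeasurable_funM => //; exact/measurable_EFinP.
rewrite ge0_integralZl_EFin ?powR_ge0//; last by apply: (measurableT_comp mh); exact: normr_measurable.
rewrite ge0_integralZl_EFin ?mulr_ge0 ?powR_ge0//; last 2 first.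
- by move=> y _; rewrite lee_fin gauss1_ge0.
- exact/measurable_EFinP.
rewrite integral_gauss1// mule1.
have I : (\int[leb1]_y h `|y|%R <= (2 * ((1 - a)^-1 * r `^ (1 - a)))%:E)%E.
  apply: (le_trans (integral_normr_le mh h0)); rewrite EFinM; apply: lee_wpmul2l => //.
  rewrite mulrC; apply: le_trans (integral_powR0 a0 a1 r0).
  rewrite integral_itv_bndo_bndc; last exact: measurable_powR_itv.
  rewrite integral_itv_obnd_cbnd; last exact: measurable_powR_itv.
  rewrite integral_mkcond [leRHS]integral_mkcond le_eqVlt; apply/orP; left; apply/eqP.
  apply: eq_integral => y _; rewrite !patchE /h indicE /D !mem_setE !in_itv/= andbT.
  by case: leP => //= _; case: leP => _; rewrite ?mul1e ?mul0e.
apply: (@le_trans _ _ (((4 * pi * t) `^ (- (p / 2)))%:E * (2 * ((1 - a)^-1 * r `^ (1 - a)))%:E +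
   ((4 * pi * t) `^ (- ((p - 1) / 2)) * r `^ (- a))%:E)%E).
  by apply: leeD => //; apply: lee_wpmul2l => //; rewrite lee_fin powR_ge0.
rewrite -EFinM -EFinD lee_fin /r -!powRrM !(powRM _ (ltW p4) (ltW t0)).
rewrite le_eqVlt; apply/orP; left; apply/eqP.
(* Cutting at |y| = sqrt t makes the two pieces scale with the same power of t. *)
have E1 : t `^ (- (p / 2) + (1 - a) / 2) = t `^ (- (p / 2)) * t `^ (2^-1 * (1 - a)).
  by rewrite -powRD ?(gt_eqF t0) ?implybT//; congr (_ `^ _); field.
have E2 : t `^ (- (p / 2) + (1 - a) / 2) = t `^ (- ((p - 1) / 2)) * t `^ (2^-1 * - a).
  by rewrite -powRD ?(gt_eqF t0) ?implybT//; congr (_ `^ _); field.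
by rewrite [RHS]mulrDl; congr (_ + _); [rewrite E1|rewrite E2]; ring.
Qed.

End gaussian_powers.

(** * Smoothing estimates in weighted spaces *)

Section weighted_smoothing.
Context {R : realType} (N : nat).
Hypothesis N0 : (0 < N)%N.
Local Notation lebN := (@lebesgueRN R N).
Local Notation leb1 := (@lebesgue_measure R).
Local Notation HK := (@heat_kernel R N).

Let N0R : 0 < N%:R :> R. Proof. by rewrite ltr0n. Qed.

Lemma heat_semigroup_kernel : semigroup_kernel lebN HK.
Proof.
split.
- exact: heat_kernel_ge0.
- exact: measurable_heat_kernel.
- exact: integral_heat_kernel.
- exact: heat_kernel_semigroup.
Qed.

Lemma euclid_norm_coord (x : RN R N) i : `|tnth x i| <= euclid_norm x.
Proof.
rewrite -sqrtr_sqr; apply: ler_wsqrtr; rewrite (bigD1 i)//= lerDl.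
by apply: sumr_ge0 => j _; exact: sqr_ge0.
Qed.

Lemma euclid_norm_ge0 (x : RN R N) : 0 <= euclid_norm x.
Proof. exact: sqrtr_ge0. Qed.

Lemma measurable_euclid_norm : measurable_fun setT (@euclid_norm R N).
Proof.
apply: (measurableT_comp (f := @Num.sqrt R)).
  by apply: continuous_measurable_fun; exact: sqrt_continuous.
by apply: measurable_sum => i; apply: measurable_funX; exact: measurable_tnth.
Qed.

Lemma measurable_weight g (f : RN R N -> R) : measurable_fun setT f ->
  measurable_fun setT (weight g f).
Proof.
move=> mf; apply: measurable_funM => //.
exact: (measurableT_comp (measurable_powR _) measurable_euclid_norm).
Qed.

(** At a zero base, [powR] with a negative exponent is 0 rather than infinite, so comparing a
    negative power of |y| with powers of the |y_i| fails on the coordinate hyperplanes. These are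
    null sets. *)
Lemma ae_coord_neq0 : {ae lebN, forall x, forall i, tnth x i != 0}.
Proof.
apply: filter_forall => i.
pose B (j : 'I_N) : set (measurableTypeR R) := if j == i then [set 0] else setT.
have mB j : measurable (B j) by rewrite /B; case: ifP => _ //; exact: measurable_set1.
exists [set x | forall j, B j (tnth x j)]; split.
- rewrite (_ : [set x | _] = \bigcap_(i in [set: 'I_N])
      ((fun x : RN R N => tnth x i) @^-1` B i)); last first.
    by apply/seteqP; split => x /= h j; [move=> _; exact: h|exact: h].
  apply: fin_bigcap_measurable => [|j _]; first exact: finite_finset.
  by rewrite -[X in measurable X]setTI; exact: measurable_tnth.
- rewrite lebesgueRN_box// (bigD1 i)//= {1}/B eqxx.
  by rewrite lebesgue_measure_set1 mul0e.
- move=> x /= /negP; rewrite negbK => /eqP xi j; rewrite /B; case: eqP => // ->.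
  by rewrite /= xi.
Qed.

Let powR_split (r e : R) : 0 <= r -> r `^ e = \prod_(i < N) (r `^ (e / N%:R)).
Proof.
move=> r0; rewrite prodr_const card_ord -powR_mulrn ?powR_ge0// -powRrM.
by rewrite divfK// gt_eqF.
Qed.

Let prod_powR (F : 'I_N -> R) (e : R) : (forall i, 0 <= F i) ->
  (\prod_(i < N) F i) `^ e = \prod_(i < N) (F i `^ e).
Proof.
move=> F0.
have : \prod_(i < N) (F i `^ e) = (\prod_(i < N) F i) `^ e /\ 0 <= \prod_(i < N) F i.
  elim/big_ind2 : _ => [|x1 x2 y1 y2 [-> h1] [-> h2]|i _]; rewrite ?powR1//.
  by rewrite powRM// mulr_ge0.
by case=> ->.
Qed.

Lemma lee_prode (F H : 'I_N -> \bar R) : (forall i, 0 <= F i)%E -> (forall i, F i <= H i)%E ->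
  (\prod_(i < N) F i <= \prod_(i < N) H i)%E.
Proof.
move=> F0 FH.
have : (0 <= \prod_(i < N) F i <= \prod_(i < N) H i)%E.
  elim/big_ind2 : _ => [|x1 x2 y1 y2 /andP[a b] /andP[c e]|i _]; rewrite ?lexx ?lee01//.
    by rewrite mule_ge0//= lee_pmul.
  by rewrite F0 FH.
by case/andP.
Qed.

(** Since |y| >= |y_i| for every i, the weight |y|^(-g p) is at most the product of the |y_i|^(-g p
    / N), and the integral factors into one-dimensional ones with exponent g p / N < 1. *)
Lemma integral_heat_kernel_powR (p g : R) : 1 <= p -> 0 <= g -> g * p < N%:R ->
  exists2 C : R, 0 < C & forall t x, 0 < t ->
    (\int[lebN]_y (HK t x y `^ p * euclid_norm y `^ (- (g * p)))%:E <=
     (C * t `^ (N%:R * (1 - p) / 2 - g * p / 2))%:E)%E.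
Proof.
move=> p1 g0 gpN; pose a := g * p / N%:R.
have p0 : 0 <= p by exact: le_trans p1.
have a0 : 0 <= a by rewrite divr_ge0 ?mulr_ge0.
have a1 : a < 1 by rewrite ltr_pdivrMr ?mul1r.
have [C C0 HC] := integral_gauss1_powR p1 a0 a1.
exists ((C + 1) ^+ N); first by rewrite exprn_gt0// ltr_wpDl.
move=> t x t0.
pose h (i : 'I_N) (y : R) : \bar R := (gauss1 t (tnth x i) y `^ p * `|y| `^ (- a))%:E.
have mh i : measurable_fun setT (h i : measurableTypeR R -> _).
  apply/measurable_EFinP; apply: measurable_funM.
    exact: (measurableT_comp (measurable_powR _) (measurable_gauss1 _ _)).
  by apply: (measurableT_comp (measurable_powR _)); exact: normr_measurable.
have h0 i y : (0 <= h i y)%E by rewrite lee_fin mulr_ge0 ?powR_ge0.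
apply: (@le_trans _ _ (\int[lebN]_y \prod_(i < N) h i (tnth y i))%E).
  apply: ae_ge0_le_integral => //.
  - by move=> y _; rewrite lee_fin mulr_ge0 ?powR_ge0.
  - apply/measurable_EFinP; apply: measurable_funM.
      apply: (measurableT_comp (measurable_powR _)).
      exact: (measurable_kernel_comp heat_semigroup_kernel).
    exact: (measurableT_comp (measurable_powR _) measurable_euclid_norm).
  - by move=> y _; exact: prode_ge0.
  - rewrite (_ : (fun y => _) = (fun y : RN R N => (\prod_(i < N) fine (h i (tnth y i)))%:E)); last first.
      by apply/funext => y; rewrite -prodEFin.
    apply/measurable_EFinP; apply: measurable_prod => i _.
    by apply: measurableT_comp => //; apply: (measurableT_comp (mh i)); exact: measurable_tnth.
  - apply: (ae_imply _ ae_coord_neq0) => y y0 _.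
    rewrite /h prodEFin lee_fin big_split/=; apply: ler_pM; rewrite ?powR_ge0//.
      by rewrite heat_kernel_prod// prod_powR// => i; exact: gauss1_ge0.
    rewrite (powR_split _ (euclid_norm_ge0 _)).
    apply: ler_prod => i _; rewrite powR_ge0/= mulNr -/a !powRN.
    have yi : 0 < `|tnth y i| by rewrite normr_gt0.
    rewrite lef_pV2 ?posrE ?powR_gt0//; last exact: lt_le_trans yi (euclid_norm_coord _ _).
    by apply: ge0_ler_powR; rewrite ?nnegrE ?euclid_norm_ge0 ?euclid_norm_coord.
rewrite ge0_integral_prod_lebesgueRN//.
apply: (@le_trans _ _ (\prod_(i < N) ((C + 1) * t `^ (- (p / 2) + (1 - a) / 2))%:E)%E).
  apply: lee_prode => i; first by apply: integral_ge0 => y _.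
  apply: (le_trans (HC t _ t0)); rewrite lee_fin ler_wpM2r ?powR_ge0// lerDl//.
rewrite prodEFin prodr_const card_ord exprMn lee_fin.
rewrite ler_wpM2l ?exprn_ge0 ?addr_ge0// -powR_mulrn ?powR_ge0// -powRrM le_eqVlt; apply/orP; left; apply/eqP; congr (_ `^ _).
by rewrite /a; field; rewrite gt_eqF.
Qed.

Local Notation E f t := (heatE lebN HK t (fun y => `|f y|%:E)).

Lemma recipy : recip (+oo%E : \bar R) = 0.
Proof. by rewrite /recip invey. Qed.

Lemma recip_fin (r : R) : 0 < r -> recip r%:E = r^-1.
Proof. by move=> r0; rewrite /recip inver gt_eqF. Qed.

Let mK t x : measurable_fun setT (HK t x).
Proof. exact: (measurable_kernel_comp heat_semigroup_kernel). Qed.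

(** Hoelder's inequality after writing |f| = |y|^(-g) (|y|^g |f|): the kernel and the singular
    weight are put in L^p with p conjugate to q, and 1/q + g/N < 1 is the condition g p < N. For q =
    oo this is p = 1, done directly with the essential supremum. *)
Lemma heatE_weight_le q g : (1 < q)%E -> 0 <= g -> recip q + g / N%:R < 1 ->
  exists2 C : R, 0 < C & forall t x (f : RN R N -> R), 0 < t -> measurable_fun setT f ->
    (E f t x <= (C * t `^ (- ((N%:R * recip q + g) / 2)))%:E * Lqwnorm g q f)%E.
Proof.
case: q => [r| |//]; last first.
  move=> _ g0; rewrite recipy add0r mulr0 add0r ltr_pdivrMr// mul1r => gN.
  have [|C C0 HC] := @integral_heat_kernel_powR 1 g (lexx _) g0; first by rewrite mulr1.
  exists C => // t x f t0 mf; set M := Lqwnorm g +oo f.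
  have D0 : 0 < C * t `^ (- (g / 2)) by rewrite mulr_gt0// powR_gt0.
  have M0 : (0 <= M)%E by exact: Lnorm_ge0.
  have [My|My] := eqVneq M +oo%E; first by rewrite My gt0_muley ?leey// lte_fin.
  have Mf : M \is a fin_num by rewrite ge0_fin_numE// lt_neqAle My leey.
  apply: (@le_trans _ _ (\int[lebN]_y ((HK t x y `^ 1 * euclid_norm y `^ (- (g * 1)))%:E * M))%E).
    rewrite /heatE; apply: ae_ge0_le_integral => //.
    - by move=> y _; rewrite -EFinM lee_fin mulr_ge0// heat_kernel_ge0.
    - by apply: emeasurable_funM; apply/measurable_EFinP => //; exact: measurableT_comp.
    - by move=> y _; apply: mule_ge0 => //; rewrite lee_fin mulr_ge0 ?powR_ge0.
    - apply: emeasurable_funM => //; apply/measurable_EFinP; apply: measurable_funM.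
        exact: (measurableT_comp (measurable_powR _)).
      exact: (measurableT_comp (measurable_powR _) measurable_euclid_norm).
    - have := Lnormy_ge lebN (EFin \o weight g f).
      apply: (ae_imply2 _ ae_coord_neq0) => y y0 yM _.
      have yn : 0 < euclid_norm y.
        by apply: lt_le_trans (euclid_norm_coord y (Ordinal N0)); rewrite normr_gt0.
      rewrite mulr1 powRr1 ?heat_kernel_ge0// [X in (_ <= X * _)%E]EFinM -muleA.
      apply: lee_wpmul2l; first by rewrite lee_fin heat_kernel_ge0.
      have -> : (`|f y|%:E = (euclid_norm y `^ (- g))%:E * `|(EFin \o weight g f) y|)%E.
        rewrite /= -EFinM /weight normrM (ger0_norm (powR_ge0 _ _)) mulrA -powRD.
          by rewrite addNr powRr0 mul1r.
        by rewrite (gt_eqF yn) implybT.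
      by apply: lee_wpmul2l => //; rewrite lee_fin powR_ge0.
  rewrite ge0_integralZr//; last 2 first.
  - apply/measurable_EFinP; apply: measurable_funM.
      exact: (measurableT_comp (measurable_powR _)).
    exact: (measurableT_comp (measurable_powR _) measurable_euclid_norm).
  - by move=> y _; rewrite lee_fin mulr_ge0 ?powR_ge0.
  apply: lee_wpmul2r => //; have := HC t x t0; rewrite !mulr1 subrr mulr0 mul0r sub0r.
  by [].
rewrite lte_fin => r1 g0; have r0 : 0 < r by exact: lt_trans r1.
rewrite recip_fin// => rg.
pose p := (1 - r^-1)^-1.
have ri0 : 0 < r^-1 by rewrite invr_gt0.
have ri1 : 0 < 1 - r^-1 by rewrite subr_gt0 invf_lt1.
have p0 : 0 < p by rewrite invr_gt0.
have pp : p^-1 + r^-1 = 1 by rewrite invrK subrK.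
have p1 : 1 <= p by rewrite invf_ge1 ?posrE// gerBl ltW.
have gpN : g * p < N%:R.
  by rewrite -ltr_pdivlMr// /p invrK -ltr_pdivrMl// mulrC ltrBrDl.
have [C C0 HC] := integral_heat_kernel_powR p1 g0 gpN.
exists (C `^ p^-1); first by rewrite powR_gt0.
move=> t x f t0 mf.
pose F (y : RN R N) := HK t x y * euclid_norm y `^ (- g).
have F0 y : 0 <= F y by rewrite mulr_ge0 ?powR_ge0 ?heat_kernel_ge0.
have mF : measurable_fun setT F.
  apply: measurable_funM => //.
  exact: (measurableT_comp (measurable_powR _) measurable_euclid_norm).
have mw := measurable_weight g mf.
have H := @hoelder _ _ _ lebN _ _ p r mF mw p0 r0 pp.
apply: (@le_trans _ _ ('N[lebN]_1[EFin \o (F \* weight g f)%R])%E).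
  rewrite Lnorm1 /heatE; apply: ae_ge0_le_integral => //.
  - by move=> y _; rewrite -EFinM lee_fin mulr_ge0// heat_kernel_ge0.
  - by apply: emeasurable_funM; apply/measurable_EFinP => //; exact: measurableT_comp.
  - by apply: measurableT_comp => //; apply/measurable_EFinP; exact: measurable_funM.
  - apply: (ae_imply _ ae_coord_neq0) => y y0 _.
    have yn : 0 < euclid_norm y.
      by apply: lt_le_trans (euclid_norm_coord y (Ordinal N0)); rewrite normr_gt0.
    rewrite /= -EFinM lee_fin normrM (ger0_norm (F0 y)) /F /weight normrM -[leRHS]mulrA.
    rewrite ler_wpM2l ?heat_kernel_ge0// (ger0_norm (powR_ge0 _ _)) mulrA -powRD.
      by rewrite addNr powRr0 mul1r.
    by rewrite (gt_eqF yn) implybT.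
apply: (le_trans H); apply: lee_wpmul2r; first exact: Lnorm_ge0.
have -> : (C `^ p^-1 * t `^ (- ((N%:R * r^-1 + g) / 2)) =
    (C * t `^ (N%:R * (1 - p) / 2 - g * p / 2)) `^ p^-1).
  rewrite powRM ?powR_ge0 ?(ltW C0)// -powRrM; congr (_ * _ `^ _).
  have -> : r^-1 = 1 - p^-1 by rewrite -pp addrAC subrr add0r.
  by field; rewrite gt_eqF.
rewrite -poweR_EFin unlock; apply: gt0_ler_poweR.
- by rewrite invr_ge0 ltW.
- by rewrite in_itv/= leey andbT; apply: integral_ge0 => y _; rewrite lee_fin powR_ge0.
- by rewrite in_itv/= leey andbT lee_fin mulr_ge0 ?powR_ge0 ?(ltW C0).
apply: le_trans (HC t x t0); rewrite le_eqVlt; apply/orP; left; apply/eqP.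
apply: eq_integral => y _; rewrite /= (ger0_norm (F0 y)) /F powRM ?powR_ge0 ?heat_kernel_ge0//.
by rewrite -powRrM mulNr.
Qed.

Lemma heatE_l1_le t x (f : RN R N -> R) : 0 < t -> measurable_fun setT f ->
  (E f t x <= ((4 * pi * t) `^ (- (N%:R / 2)))%:E * Lqnorm 1 f)%E.
Proof.
move=> t0 mf; rewrite /Lqnorm Lnorm1 -ge0_integralZl_EFin ?powR_ge0//; last first.
  by apply/measurable_EFinP; exact: measurableT_comp.
apply: ge0_le_integral => //.
- by move=> y _; rewrite -EFinM lee_fin mulr_ge0// heat_kernel_ge0.
- by apply: emeasurable_funM; apply/measurable_EFinP => //; exact: measurableT_comp.
- by apply: emeasurable_funM => //; apply/measurable_EFinP => //; exact: measurableT_comp.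
- move=> y _ /=; rewrite -!EFinM lee_fin ler_wpM2r// /heat_kernel -[leRHS]mulr1.
  apply: ler_wpM2l; first exact: powR_ge0.
  by rewrite -expR0 ler_expR oppr_le0 divr_ge0 ?sqr_ge0// mulr_ge0// ltW.
Qed.

(** An integrable function with values in [0, 1] lies in every L^p, because psi^p <= psi; Hoelder's
    inequality concludes. *)
Lemma integral_mul_lty (psi f : RN R N -> R) q : (1 < q)%E -> measurable_fun setT psi ->
  (forall y, 0 <= psi y <= 1) -> (\int[lebN]_y (psi y)%:E < +oo)%E -> Lq q f ->
  (\int[lebN]_y (psi y * `|f y|)%:E < +oo)%E.
Proof.
move=> q1 mpsi psi01 psioo /LfunP_bound[mf foo].
have psi0 y : 0 <= psi y by case/andP: (psi01 y).
case: q q1 foo => [r| |//]; last first.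
  move=> _ Noo; have N0' := Lnorm_ge0 lebN +oo (EFin \o f).
  have Nf : 'N[lebN]_+oo[EFin \o f]%E \is a fin_num by rewrite ge0_fin_numE.
  apply: (@le_lt_trans _ _ (\int[lebN]_y ((psi y)%:E * 'N[lebN]_+oo[EFin \o f]))%E).
    apply: ae_ge0_le_integral => //.
    - by move=> y _; rewrite lee_fin mulr_ge0.
    - apply/measurable_EFinP; apply: measurable_funM => //; exact: measurableT_comp.
    - by move=> y _; rewrite mule_ge0// lee_fin.
    - by apply: emeasurable_funM => //; exact/measurable_EFinP.
    - apply: (ae_imply _ (Lnormy_ge lebN (EFin \o f))) => y yN _.
      by rewrite EFinM; apply: lee_wpmul2l => //; rewrite lee_fin.
  rewrite ge0_integralZr//; last 2 first.
  - exact/measurable_EFinP.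
  - by move=> y _; rewrite lee_fin.
  rewrite -(fineK Nf) muleC; apply: lte_mul_pinfty => //; rewrite ?lee_fin ?fine_ge0//.
rewrite lte_fin => r1 foo; have r0 : 0 < r by exact: lt_trans r1.
pose p := (1 - r^-1)^-1.
have ri0 : 0 < r^-1 by rewrite invr_gt0.
have ri1 : 0 < 1 - r^-1 by rewrite subr_gt0 invf_lt1.
have p0 : 0 < p by rewrite invr_gt0.
have pp : p^-1 + r^-1 = 1 by rewrite invrK subrK.
have p1 : 1 <= p by rewrite invf_ge1 ?posrE// gerBl ltW.
have H := @hoelder _ _ _ lebN _ _ p r mpsi mf p0 r0 pp.
rewrite Lnorm1 in H.
rewrite (_ : integral _ _ _ = \int[lebN]_y `|(EFin \o (psi \* f)%R) y|)%E; last first.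
  by apply: eq_integral => y _; rewrite /= normrM (ger0_norm (psi0 y)).
apply: (le_lt_trans H).
have Npsi : ('N[lebN]_p%:E[EFin \o psi] < +oo)%E.
  rewrite unlock; apply: poweR_lty.
  apply: le_lt_trans psioo; apply: ge0_le_integral => //.
  - by move=> y _; rewrite lee_fin powR_ge0.
  - apply/measurable_EFinP; apply: (measurableT_comp (measurable_powR _)); exact: measurableT_comp.
  - exact/measurable_EFinP.
  - move=> y _; rewrite lee_fin /= (ger0_norm (psi0 y)).
    have /andP[y0 y1] := psi01 y; have [->|yn] := eqVneq (psi y) 0.
      by rewrite powR0// gt_eqF.
    by rewrite -[leRHS]powRr1//; apply: ger_powR => //; rewrite lt_neqAle eq_sym yn y0.
by apply: lte_mul_pinfty => //; [exact: Lnorm_ge0|rewrite ge0_fin_numE//; exact: Lnorm_ge0].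
Qed.

(** For g > N the function psi = 1 / (1 + |y|^g) is integrable, and |f| = psi |f| + psi |y|^g |f| is
    a sum of two products to which [integral_mul_lty] applies. *)
Lemma Lfun1_weight q g (f : RN R N -> R) : (1 < q)%E -> N%:R < g -> Lq q f -> Lqw g q f ->
  Lq 1 f.
Proof.
move=> q1 gN fq [mf wq].
have g0 : 0 < g by exact: lt_trans gN.
pose psi (y : RN R N) := (1 + euclid_norm y `^ g)^-1.
have d0 (y : RN R N) : 0 < 1 + euclid_norm y `^ g by rewrite ltr_wpDr// powR_ge0.
have mpsi : measurable_fun setT psi.
  rewrite (_ : psi = fun y => (1 + euclid_norm y `^ g) `^ (-1)); last first.
    by apply/funext => y; rewrite powR_inv1// ltW.
  apply: (measurableT_comp (measurable_powR _)); apply: measurable_funD => //.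
  exact: (measurableT_comp (measurable_powR _) measurable_euclid_norm).
have psi01 y : 0 <= psi y <= 1.
  rewrite invr_ge0 (ltW (d0 y))/= invf_le1// lerDl powR_ge0//.
(* As max(1, |y|) >= max(1, |y_i|) for every i, psi is at most the product of the max(1,
   |y_i|)^(-b); each factor is integrable on the line because b > 1. *)
pose b := g / N%:R.
have b1 : 1 < b by rewrite ltr_pdivlMr// mul1r.
pose h (y : R) := Num.max 1 `|y| `^ (- b).
have mh : measurable_fun setT (h : measurableTypeR R -> R).
  apply: (measurableT_comp (measurable_powR _)).
  by apply: measurable_maxr => //; exact: normr_measurable.
have hoo : (\int[leb1]_y (h y)%:E < +oo)%E.
  pose k (z : R) := (Num.max 1 z `^ (- b))%:E.
  have mk : measurable_fun setT (k : measurableTypeR R -> _).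
    apply/measurable_EFinP; apply: (measurableT_comp (measurable_powR _)).
    by apply: measurable_maxr.
  have k0 z : (0 <= k z)%E by rewrite lee_fin powR_ge0.
  apply: (le_lt_trans (integral_normr_le mk k0)).
  apply: lte_mul_pinfty => //.
  have -> : `[0%R, +oo[%classic = `[0%R, 1%R[%classic `|` `[1%R, +oo[%classic :> set (measurableTypeR R).
    by rewrite -itv_bndbnd_setU// bnd_simp.
  rewrite ge0_integral_setU//=; last 2 first.
  - exact: measurable_funTS.
  - apply/disj_setPS => z; rewrite /= !in_itv/= andbT => -[/andP[_ z1] z2].
    by move: (lt_le_trans z1 z2); rewrite ltxx.
  apply: lte_add_pinfty.
    apply: (@le_lt_trans _ _ (\int[leb1]_(z in `[0%R, 1%R[) cst 1 z)%E).
      apply: ge0_le_integral => //; first exact: measurable_funTS.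
      move=> z _; rewrite lee_fin powRN invf_le1 ?powR_gt0//; last by rewrite lt_max ltr01.
      rewrite -[leLHS](powRr0 (Num.max 1 z)); apply: ler_powR; first by rewrite le_max lexx.
      by apply: ltW; exact: lt_trans b1.
    by rewrite integral_cst//= lebesgue_measure_itv/= lte_fin ltr01 oppr0 adde0 mule1 ltry.
  rewrite (_ : integral _ _ _ = \int[leb1]_(z in `[1%R, +oo[) (z `^ (- b))%:E)%E.
    exact: integral_powRy.
  apply: eq_integral => z; rewrite inE/= in_itv/= andbT => z1.
  by rewrite /k max_r.
have psioo : (\int[lebN]_y (psi y)%:E < +oo)%E.
  apply: (@le_lt_trans _ _ (\int[lebN]_y \prod_(i < N) (h (tnth y i))%:E)%E).
    apply: ge0_le_integral => //.
    - by move=> y _; rewrite lee_fin; case/andP: (psi01 y).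
    - exact/measurable_EFinP.
    - rewrite (_ : (fun y => _) = (fun y : RN R N => (\prod_(i < N) h (tnth y i))%:E)); last first.
        by apply/funext => y; rewrite prodEFin.
      apply/measurable_EFinP; apply: measurable_prod => i _.
      by apply: (measurableT_comp mh); exact: measurable_tnth.
    - move=> y _; rewrite prodEFin lee_fin.
      pose n := Num.max 1 (euclid_norm y).
      have n1 : 1 <= n by rewrite le_max lexx.
      apply: (@le_trans _ _ (n `^ (- g))).
        rewrite powRN lef_pV2 ?posrE ?powR_gt0//; last exact: lt_le_trans n1.
        rewrite /n; have [_|_] := leP 1 (euclid_norm y); first by rewrite lerDr.
        by rewrite powR1 lerDl powR_ge0.
      rewrite powR_split ?(le_trans ler01)//; apply: ler_prod => i _; rewrite powR_ge0/= mulNr -/b.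
      have m1 : 1 <= Num.max 1 `|tnth y i| by rewrite le_max lexx.
      rewrite /h !powRN lef_pV2 ?posrE ?powR_gt0//; try exact: lt_le_trans m1; try exact: lt_le_trans n1.
      apply: ge0_ler_powR; rewrite ?nnegrE ?(le_trans ler01)//.
        exact: ltW.
      by rewrite /n ge_max !le_max lexx/= euclid_norm_coord orbT.
  rewrite (ge0_integral_prod_lebesgueRN (h := fun _ y => (h y)%:E))//; last 2 first.
  - by move=> i; exact/measurable_EFinP.
  - by move=> i y; rewrite lee_fin powR_ge0.
  rewrite ltey_eq prode_fin_num// => i _; rewrite ge0_fin_numE//.
  by apply: integral_ge0 => y _; rewrite lee_fin powR_ge0.
apply/LfunP_bound; split => //; rewrite Lnorm1.
rewrite (_ : integral _ _ _ = \int[lebN]_y ((psi y * `|f y|)%:E + (psi y * `|weight g f y|)%:E))%E; last first.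
  apply: eq_integral => y _; rewrite -EFinD -mulrDr /weight normrM (ger0_norm (powR_ge0 _ _)).
  by rewrite (_ : `|f y| + _ = (1 + euclid_norm y `^ g) * `|f y|) ?mulKf ?gt_eqF//; ring.
have mm (k : RN R N -> R) : measurable_fun setT k -> measurable_fun setT (fun y => (psi y * `|k y|)%:E).
  by move=> mk; apply/measurable_EFinP; apply: measurable_funM => //; exact: measurableT_comp.
have p0 (k : RN R N -> R) y : (0 <= (psi y * `|k y|)%:E)%E.
  by rewrite lee_fin mulr_ge0//; case/andP: (psi01 y).
rewrite ge0_integralD//; last 2 first.
- exact: mm.
- by apply: mm; exact: measurable_weight.
by apply: lte_add_pinfty; apply: (integral_mul_lty q1).
Qed.

End weighted_smoothing.

(** * Existence time *)

Section convergence_to_zero.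
Context {R : realType} {T : Type} (F : set_system T) {FF : Filter F} (f : T -> \bar R).
Hypothesis f0 : forall t, (0 <= f t)%E.

Lemma cvge0P : f @ F --> (0 : \bar R)%E <->
  forall e : R, 0 < e -> \forall t \near F, (f t <= e%:E)%E.
Proof.
split.
  move=> /fine_cvgP[ffin /cvgrPdist_le fc] e e0.
  move: ffin (fc _ e0); apply: filterS2 => t tfin.
  by rewrite sub0r normrN ger0_norm ?fine_ge0// -lee_fin fineK.
move=> h; apply/fine_cvgP; split.
  apply: filterS (h _ ltr01) => t t1.
  by rewrite ge0_fin_numE// (le_lt_trans t1)// ltry.
apply/cvgrPdist_le => e e0; apply: filterS (h _ e0) => t te.
rewrite sub0r normrN ger0_norm ?fine_ge0//= -lee_fin fineK//.
by rewrite ge0_fin_numE// (le_lt_trans te)// ltry.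
Qed.

End convergence_to_zero.

Section heat_equation.
Context {R : realType} (N : nat) (N0 : (0 < N)%N) (alpha : R) (alpha0 : 0 < alpha).
Local Notation lebN := (@lebesgueRN R N).
Local Notation leb1 := (@lebesgue_measure R).
Local Notation HK := (@heat_kernel R N).
Local Notation E f t := (heatE lebN HK t (fun y => `|f y|%:E)).
Local Notation KG := (@heat_semigroup_kernel R N).
Local Notation Rm := (measurableTypeR R).

Lemma heatE_Lq_le q : (1 < q)%E ->
  exists2 C : R, 0 < C & forall t x (f : RN R N -> R), 0 < t -> measurable_fun setT f ->
    (E f t x <= (C * t `^ (- (N%:R * recip q / 2)))%:E * Lqnorm q f)%E.
Proof.
move=> q1; have r1 : recip q + 0 / N%:R < 1.
  rewrite mul0r addr0; case: q q1 => [r| |//]; last by rewrite recipy.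
  by rewrite lte_fin => r1; rewrite recip_fin ?invf_lt1// (lt_trans ltr01).
have [C C0 HC] := heatE_weight_le N0 q1 (lexx 0) r1.
exists C => // t x f t0 mf; have := HC t x f t0 mf.
rewrite addr0 /Lqwnorm (_ : weight 0 f = f)//.
by apply/funext => y; rewrite /weight powRr0 mul1r.
Qed.

Lemma recip_ge0 q : (1 < q)%E -> 0 <= recip q :> R.
Proof.
case: q => [r| |//]; last by rewrite recipy.
by rewrite lte_fin => r1; rewrite recip_fin ?invr_ge0 ?(lt_trans ltr01)// ltW// (lt_trans ltr01).
Qed.

Lemma subcritical_exponent q : (1 < q)%E -> ((N%:R * alpha / 2)%:E < q)%E ->
  alpha * (N%:R * recip q / 2) < 1.
Proof.
case: q => [r| |//]; last by rewrite recipy mulr0 mul0r mulr0.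
rewrite !lte_fin => r1 qr; have r0 : 0 < r by rewrite (lt_trans ltr01).
rewrite recip_fin// (_ : alpha * (N%:R * r^-1 / 2) = (N%:R * alpha / 2) / r); last by ring.
by rewrite ltr_pdivrMr ?mul1r.
Qed.

(** A solution is constrained only on its time interval; setting it to 0 elsewhere gives the
    measurability on all of space-time that the abstract estimates assume. *)
Definition time_restriction (T : R) (u : R -> RN R N -> R) (t : R) (x : RN R N) : R :=
  if 0 < t < T then u t x else 0.

Lemma rmeasurable_time_restriction T u :
  measurable_fun ((time_oo T%:E : set Rm) `*` [set: RN R N])
    (fun z : Rm * RN R N => u z.1 z.2) ->
  rmeasurable (time_restriction T u).
Proof.
have mD : measurable ((time_oo T%:E : set Rm) `*` [set: RN R N]).
  apply: measurableX => //; rewrite (_ : time_oo _ = `]0, T[%classic); first exact: measurable_itv.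
  by apply/seteqP; split => t; rewrite /time_oo/= in_itv/= lte_fin => /andP.
move=> /(measurable_restrictT _ mD); apply: eq_measurable_fun => -[t x] _; rewrite patchE /time_restriction/=.
have -> : ((t, x) \in (time_oo T%:E : set Rm) `*` [set: RN R N]) = (0 < t < T).
  by apply/idP/idP; rewrite inE /time_oo/= lte_fin; [case=> -[-> ->]|move=> /andP[-> ->]].
by case: ifP.
Qed.

(** Passage between the iterated form of Duhamel's formula in the definition of a solution and the
    space-time form. Only the values on (0, t) matter, so [u] can be exchanged for a globally
    measurable [v]. *)
Lemma duhamel_pointP (u v : R -> RN R N -> R) (u0 : RN R N -> R) t x r : rmeasurable v ->
  (forall s, 0 < s < t -> u s = v s) ->
  ((leb1 \x lebN)%E.-integrable (`]0, t[ `*` [set: RN R N])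
        (fun z => (HK (t - z.1) x z.2 * nonlin alpha (u z.1) z.2)%:E) /\
    r = heat t u0 x + (\int[leb1]_(s in `]0, t[) heat (t - s) (nonlin alpha (u s)) x)%R) <->
  ((duhE lebN HK 0 t (fun s y => `|nonlinR alpha v s y|%:E) x < +oo)%E /\
    r = heatR lebN HK t u0 x + duhR lebN HK 0 t (nonlinR alpha v) x).
Proof.
move=> mv uv; have mF := rmeasurable_nonlinR alpha mv.
have I : (leb1 \x lebN)%E.-integrable (`]0, t[ `*` [set: RN R N])
      (fun z => (HK (t - z.1) x z.2 * nonlin alpha (u z.1) z.2)%:E) <->
    (duhE lebN HK 0 t (fun s y => `|nonlinR alpha v s y|%:E) x < +oo)%E.
  rewrite -(integrable_duhamelP KG)//.
  have mD : measurable (`]0, t[%classic `*` [set: RN R N] : set (Rm * RN R N)) by exact: measurableX.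
  split; apply: eq_integrable => // -[s y]; rewrite inE/= in_itv/= => -[st _];
    by rewrite /nonlin /nonlinR /powabs uv.
have J : (\int[leb1]_(s in `]0, t[) heat (t - s) (nonlin alpha (u s)) x)%R =
    (\int[leb1]_(s in `]0, t[) heatR lebN HK (t - s) (nonlinR alpha v s) x)%R.
  apply: eq_Rintegral => s; rewrite inE/= in_itv/= => st.
  by rewrite (uv s st).
split=> [[/I h ->]|[h ->]]; split.
- exact: h.
- by rewrite J (duhR_iterated KG).
- exact/I.
- by rewrite J (duhR_iterated KG).
Qed.

Section restricted_solution.
Context (q : \bar R) (u0 : RN R N -> R) (u : R -> RN R N -> R) (T : R).
Hypothesis usol : solution alpha q u0 T%:E u.
Local Notation v := (time_restriction T u).

Lemma time_restrictionE t : 0 < t < T -> v t = u t.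
Proof. by move=> tT; apply/funext => x; rewrite /time_restriction tT. Qed.

Lemma restricted_measurable : rmeasurable v.
Proof. by case: usol => _ [mu_ _ _] _ _; exact: rmeasurable_time_restriction. Qed.

Lemma restricted_duhamel t : 0 < t < T -> {ae lebN, forall x,
  (duhE lebN HK 0 t (fun s y => `|nonlinR alpha v s y|%:E) x < +oo)%E /\
  v t x = heatR lebN HK t u0 x + duhR lebN HK 0 t (nonlinR alpha v) x}.
Proof.
case: usol => _ _ _ duh /[dup] tT /andP[t0 tltT].
have tJ : time_oo T%:E t by split; rewrite ?lte_fin.
apply: ae_imply (duh t tJ) => x; rewrite time_restrictionE//.
move/(duhamel_pointP u0 x (u t x) restricted_measurable (t := t)); apply => s /andP[s0 st].
by rewrite time_restrictionE// s0 (lt_trans st).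
Qed.

Lemma restricted_bounded (a b : R) : (if q == +oo%E then 0 <= a else 0 < a) -> b < T ->
  exists2 M : R, 0 <= M &
    {ae leb1, forall s, a < s < b -> {ae lebN, forall y, `|v s y| <= M}}.
Proof.
case: usol => _ [_ _ bd] _ _ a0 bT.
have sub : `[a, b]%classic `<=` (if q == +oo%E then time_co T%:E else time_oo T%:E).
  move=> s; rewrite /= in_itv/= => /andP[as_ sb].
  by case: ifP a0 => _ a0; split; rewrite ?lte_fin ?(le_lt_trans sb)//;
    [exact: le_trans as_|exact: lt_le_trans as_].
have a0' : 0 <= a by move: a0; case: ifP => // _ /ltW.
have [M HM] := bd a b sub; exists `|M| => //.
apply: ae_imply HM => s h /andP[as_ sb].
have {}h : (Lqnorm +oo (u s) <= M%:E)%E by apply: h; rewrite (ltW as_) (ltW sb).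
apply: ae_imply (Lnormy_ge lebN (EFin \o u s)) => y yN.
rewrite time_restrictionE; last by rewrite (le_lt_trans a0')// (lt_trans sb).
by rewrite -lee_fin; apply: (le_trans yN); apply: (le_trans h); rewrite lee_fin ler_norm.
Qed.

End restricted_solution.

Lemma small_time (c e : R) : 0 <= c -> 0 < e ->
  exists2 tau : R, 0 < tau & forall t, 0 <= t -> t <= tau -> c * t `^ e <= 2^-1.
Proof.
move=> c0 e0; have c1 : 0 < 2^-1 / (c + 1) by rewrite divr_gt0 ?invr_gt0// ltr_wpDl.
exists ((2^-1 / (c + 1)) `^ e^-1); first exact: powR_gt0.
move=> t t0 tt; apply: (@le_trans _ _ (c * (2^-1 / (c + 1)))).
  have -> : 2^-1 / (c + 1) = ((2^-1 / (c + 1)) `^ e^-1) `^ e.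
    by rewrite -powRrM mulVf ?gt_eqF// powRr1// ltW.
  rewrite ler_wpM2l//.
  by apply: ge0_ler_powR; rewrite ?nnegrE ?(ltW e0) ?powR_ge0.
by rewrite mulrA ler_pdivrMr ?ltr_wpDl// mulrC ler_wpM2l ?invr_ge0// lerDl.
Qed.

(** * Domination of a solution by the heat flow of its initial value *)

Section domination.
Context (q : \bar R) (q1 : (1 < q)%E) (qc : ((N%:R * alpha / 2)%:E < q)%E) (qoo : q != +oo%E).
Context (u0 : RN R N -> R) (u : R -> RN R N -> R) (T : R).
Hypotheses (u0q : Lq q u0) (usol : solution alpha q u0 T%:E u).
Local Notation v := (time_restriction T u).
Let D t := Lqnorm q (u t \- u0).

Let T0 : 0 < T. Proof. by case: usol; rewrite lte_fin. Qed.

Let mu0 : measurable_fun setT u0. Proof. by case/LfunP_bound: u0q. Qed.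

Let uq t : 0 <= t < T -> Lq q (u t).
Proof.
move=> /andP[t0 tT]; case: usol => _ [_ [h _] _] _ _; apply: h.
by rewrite (negPf qoo); split; rewrite ?lte_fin.
Qed.

Lemma solution_Lq_small (r : R) : 0 < r ->
  exists2 e0, 0 < e0 & forall e, 0 <= e < e0 -> e < T -> (D e <= r%:E)%E.
Proof.
move=> r0; case: usol => _ [_ [_ h] _] ae0 _; move: h; rewrite (negPf qoo) => h.
have J0 : time_co T%:E 0 by split; rewrite ?lte_fin.
have D0 t : (0 <= Lqnorm q (u t \- u 0)%R)%E by exact: Lnorm_ge0.
have /(_ (nbhs_filter _) r r0) := (@cvge0P _ _ _ (within_filter _ _) _ D0).1 (h 0 J0).
rewrite near_withinE => /(nbhs_ballP (0 : R^o))[e0 /= e00 he]; exists e0 => // e /andP[e_ge0 ee0] eT.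
have eJ : time_co T%:E e by split; rewrite ?lte_fin.
have eb : ball (0 : R) e0 e by rewrite /ball/= sub0r normrN ger0_norm.
apply: le_trans (he e eb eJ).
have m1 : measurable_fun setT (u e) by have /uq/LfunP_bound[] : 0 <= e < T by rewrite e_ge0.
have m2 : measurable_fun setT (u 0) by have /uq/LfunP_bound[] : 0 <= (0 : R) < T by rewrite lexx.
apply: Lnorm_le; first exact: lt_trans q1.
- by apply/measurable_EFinP; exact: measurable_funB.
- by apply/measurable_EFinP; exact: measurable_funB.
- by apply: ae_imply ae0 => x /= -> .
Qed.

(** [comparison] is applied from each small time e with v = u(e). Its smallness condition holds
    uniformly in e because the L^q norm of u(e) is at most 1 plus that of u0, and because q > q_c
    gives alpha b < 1 for the unweighted exponent b. Then e -> 0 by [dominated_from_shift]. *)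
Lemma restricted_dominated : exists2 tau : R, 0 < tau <= T &
  forall t, 0 < t < tau -> {ae lebN, forall x, (`|v t x|%:E <= 2%:E * E u0 t x)%E}.
Proof.
have q_ge1 := ltW q1.
have [C C0 HC] := heatE_Lq_le q1.
have [cL cL0 time_lip] := @heat_kernel_time_lipschitz R N.
have [m m1 lip] := powabs_lipschitz alpha0.
pose b := N%:R * recip q / 2.
have b0 : 0 <= b by rewrite divr_ge0// mulr_ge0 ?recip_ge0.
have ab1 : alpha * b < 1 by exact: subcritical_exponent.
have ab10 : 0 < 1 - alpha * b by rewrite subr_gt0.
have n0fin : Lqnorm q u0 \is a fin_num.
  by rewrite ge0_fin_numE ?Lnorm_ge0//; case/LfunP_bound: u0q.
pose K := C * (1 + fine (Lqnorm q u0)).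
have K0 : 0 <= K by rewrite mulr_ge0 ?(ltW C0)// addr_ge0// fine_ge0// Lnorm_ge0.
have [e1 e10 He1] := solution_Lq_small ltr01.
have c0 : 0 <= (2 * K) `^ alpha / (1 - alpha * b) by rewrite divr_ge0 ?powR_ge0 ?(ltW ab10).
have [t1 t10 Ht1] := small_time c0 ab10.
pose tau := Num.min (Num.min e1 T) t1.
have tau0 : 0 < tau by rewrite !lt_min e10 T0.
have [[taue tauT] taut] : (tau <= e1 /\ tau <= T) /\ tau <= t1.
  by rewrite /tau !ge_min !lexx !orbT.
exists tau; first by rewrite tau0.
have mv := restricted_measurable usol.
have mvt t : measurable_fun setT (v t) by exact: rmeasurable_slice.
have vu t : 0 < t < tau -> v t = u t.
  by move=> /andP[t0 tt]; apply: time_restrictionE; rewrite t0 (lt_le_trans tt).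
have De e : 0 < e < tau -> (D e <= 1)%E.
  move=> /andP[e0 et]; apply: He1; first by rewrite ltW//= (lt_le_trans et).
  exact: lt_le_trans tauT.
have Hv e s x : 0 < e < tau -> 0 < s -> (E (v e) s x <= (K * s `^ (- b))%:E)%E.
  move=> et s0; apply: (le_trans (HC s x (v e) s0 (mvt e))).
  have -> : K * s `^ (- b) = C * s `^ (- b) * (1 + fine (Lqnorm q u0)) by rewrite /K mulrAC.
  rewrite [leRHS]EFinM; apply: lee_wpmul2l; first by rewrite lee_fin mulr_ge0 ?powR_ge0 ?(ltW C0).
  rewrite EFinD fineK// (vu _ et).
  have mu_e : measurable_fun setT (u e) by rewrite -(vu _ et).
  have := @eminkowski _ _ _ lebN (u e \- u0)%R u0 q (measurable_funB mu_e mu0) mu0 q_ge1.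
  rewrite (_ : (u e \- u0) \+ u0 = u e)%R; last by apply/funext => y /=; rewrite subrK.
  by move=> /le_trans; apply; apply: leeD => //; exact: De.
have Hu0 s x : 0 < s -> (E u0 s x < +oo)%E.
  by move=> s0; apply: (le_lt_trans (HC s x u0 s0 mu0)); rewrite -(fineK n0fin) -EFinM ltry.
move=> t tt.
have e_fin e : 0 < e < tau -> D e \is a fin_num.
  by move=> et; rewrite ge0_fin_numE ?Lnorm_ge0// (le_lt_trans (De e et))// ltry.
apply: (dominated_from_shift KG cL0 time_lip (u := v) (u0 := u0) (tau := tau) (C := C)
  (delta := b) (eta := fun e => fine (D e))) => //; first exact: ltW.
- move=> e r e0 /andP[er rt].
  have ett : 0 < e < tau by rewrite e0 (lt_trans er).
  have cmp := @comparison _ _ _ _ _ KG alpha m alpha0 m1 lip v (v e) e tau K b mv (mvt e) K0 b0 ab1.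
  apply: cmp.
  + by move=> s x s0; exact: Hv.
  + rewrite mulrA mulrAC; apply: Ht1; first by rewrite subr_ge0 ltW// (lt_trans er).
    by apply: le_trans taut; rewrite gerBl ltW.
  + move=> s /andP[es st]; have [||M M0 HM] := restricted_bounded usol (a := e) (b := s).
    * by rewrite (negPf qoo).
    * by apply: lt_le_trans tauT.
    by exists M.
  + move=> s /andP[es st].
    have sT : 0 < s < T by rewrite (lt_trans e0)// (lt_le_trans st).
    have eT : 0 < e < T by rewrite e0 (lt_trans es)//; case/andP: sT.
    apply: ae_imply (restricted_duhamel usol sT) => x [hfin ->].
    apply: (duhamel_shift_le KG) => //.
    * by rewrite e0.
    * exact: rmeasurable_nonlinR.
    * by apply: Hu0; case/andP: sT.
    * by apply: ae_imply (restricted_duhamel usol eT) => y [].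
  + by rewrite er.
- move=> e s x et s0; rewrite EFinM fineK ?e_fin//.
  rewrite /D -(vu e et); apply: HC => //; exact: measurable_funB.
- move=> r r0; have [e2 e20 He2] := solution_Lq_small r0.
  exists (Num.min e2 tau); first by rewrite lt_min e20.
  move=> e /andP[e0]; rewrite lt_min => /andP[ee et].
  rewrite -lee_fin fineK ?e_fin ?e0//; apply: He2; first by rewrite ltW.
  exact: lt_le_trans tauT.
Qed.

End domination.

(** * Extension of a solution by the Picard solution *)

Section extension.
Context (q : \bar R) (q1 : (1 < q)%E) (qc : ((N%:R * alpha / 2)%:E < q)%E)
  (u0 : RN R N -> R) (u0q : Lq q u0) (m K b T : R).
Hypotheses (m1 : 1 <= m)
  (lip : forall r r' M : R, `|r| <= M -> `|r'| <= M ->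
    `|powabs alpha r - powabs alpha r'| <= m * M `^ alpha * `|r - r'|)
  (K0 : 0 <= K) (b0 : 0 <= b) (ab1 : alpha * b < 1) (T0 : 0 < T)
  (EK : forall t x, 0 < t -> (E u0 t x <= (K * t `^ (- b))%:E)%E)
  (kT : m * (2 * K) `^ alpha * (T `^ (1 - alpha * b) / (1 - alpha * b)) <= 4^-1).
Variable w : R -> RN R N -> R.
Hypotheses (mw : rmeasurable w)
  (wE : forall t x, 0 < t < T -> (`|w t x|%:E <= 2%:E * E u0 t x)%E)
  (wD : forall t x, 0 < t < T ->
    w t x = heatR lebN HK t u0 x + duhR lebN HK 0 t (nonlinR alpha w) x).

Let mu0 : measurable_fun setT u0. Proof. by case/LfunP_bound: u0q. Qed.

Let w_duhamel t x : 0 < t < T ->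
  (duhE lebN HK 0 t (fun s y => `|nonlinR alpha w s y|%:E) x < +oo)%E /\
  w t x = heatR lebN HK t u0 x + duhR lebN HK 0 t (nonlinR alpha w) x.
Proof.
move=> tT; split; last exact: wD.
have /andP[t0 tlt] := tT.
apply: (duhE_nonlinR_lty KG alpha0 m1 mu0 K0 b0 ab1 T0 EK kT) => //; first exact: ltW.
by apply: aeW => s /andP[s0 st]; apply: aeW => y; apply: wE; rewrite s0 (lt_trans st).
Qed.

Let w_le a t x : 0 < a -> a <= t -> t < T -> `|w t x| <= 2 * (K * a `^ (- b)).
Proof.
move=> a0 at_ tT; have t0 : 0 < t by exact: lt_le_trans at_.
rewrite -lee_fin EFinM; apply: (le_trans (wE _ _)); first by rewrite t0.
apply: lee_wpmul2l; first by rewrite lee_fin.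
apply: (le_trans (EK _ t0)); rewrite lee_fin ler_wpM2l// !powRN.
by rewrite lef_pV2 ?posrE ?powR_gt0// ge0_ler_powR ?nnegrE// ltW.
Qed.

Let w_ley t x : q = +oo%E -> 0 < t < T -> `|w t x| <= 2 * fine (Lqnorm +oo u0).
Proof.
move=> qoo tT; have n0 : Lqnorm +oo u0 \is a fin_num.
  by rewrite ge0_fin_numE ?Lnorm_ge0//; move: u0q; rewrite qoo => /LfunP_bound[].
rewrite -lee_fin EFinM fineK//; apply: (le_trans (wE x tT)).
apply: lee_wpmul2l; first by rewrite lee_fin.
by apply: (heatE_lnormy KG) => //; case/andP: tT.
Qed.

(** For q = oo both functions are bounded up to time 0, and Gronwall's argument starts there. For q
    < oo they are first identified on (0, tau) by domination; Gronwall's argument then starts at tau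
    / 2, beyond which [w] is bounded and [u] locally so. *)
Lemma restricted_eq_picard (u : R -> RN R N -> R) (T1 : R) : T1 < T -> solution alpha q u0 T1%:E u ->
  forall t, 0 < t < T1 -> {ae lebN, forall x, time_restriction T1 u t x = w t x}.
Proof.
move=> T1T usol; have mv := restricted_measurable usol.
have step a t B : 0 <= a -> a < t < T1 -> (if q == +oo%E then 0 <= a else 0 < a) -> 0 <= B ->
    (forall s x, a < s < T -> `|w s x| <= B) ->
    (forall s, 0 < s < a -> {ae lebN, forall y, time_restriction T1 u s y = w s y}) ->
    {ae lebN, forall x, time_restriction T1 u t x = w t x}.
  move=> a0 /andP[at_ tT1] aq B0 wB eqa; pose c := (t + T1) / 2.
  (* Solutions are bounded on compact time intervals only, so the interval has to stop before T1. *)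
  have [tc cT1] : t < c /\ c < T1 by rewrite /c; lra.
  have [M M0 HM] := restricted_bounded usol aq cT1.
  apply: (unique_bounded KG m1 lip (u0 := u0) (a := a) (b := c) (M := Num.max M B)) => //.
  - by rewrite le_max M0.
  - apply: ae_imply HM => s h sac; apply: ae_imply (h sac) => y yM.
    by rewrite le_max yM.
  - apply: aeW => s /andP[as_ sc]; apply: aeW => y; rewrite le_max wB ?orbT// as_/=.
    by apply: lt_trans T1T; exact: lt_trans cT1.
  - move=> s /andP[as_ sc]; apply: (restricted_duhamel usol).
    by rewrite (le_lt_trans a0 as_) (lt_trans sc).
  - move=> s /andP[as_ sc]; apply: aeW => x; apply: w_duhamel.
    by rewrite (le_lt_trans a0 as_) (lt_trans sc)// (lt_trans cT1).
  - by rewrite at_.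
have [qoo|qoo] := eqVneq q +oo%E.
  move=> t tT1; apply: (step 0 t (2 * fine (Lqnorm +oo u0))) => //.
  - by rewrite qoo eqxx.
  - by rewrite mulr_ge0// fine_ge0// Lnorm_ge0.
  - by move=> s x sT; exact: w_ley.
  - by move=> s /andP[s0 /(lt_trans s0)]; rewrite ltxx.
have [tau /andP[tau0 tauT1] Htau] := restricted_dominated q1 qc qoo u0q usol.
have eq_tau t : 0 < t < tau -> {ae lebN, forall x, time_restriction T1 u t x = w t x}.
  have inT s : 0 < s < tau -> 0 < s < T1 /\ 0 < s < T.
    move=> /andP[s0 st]; have sT1 := lt_le_trans st tauT1.
    by rewrite s0 sT1 (lt_trans sT1).
  apply: (unique_dominated KG alpha0 m1 lip mu0 K0 b0 ab1 T0 EK kT (tau := tau)) => //.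
  - by apply: le_trans tauT1 _; exact: ltW.
  - by move=> s /inT[_ sT]; apply: aeW => x; exact: wE.
  - by move=> s /inT[sT1 _]; apply: ae_imply (restricted_duhamel usol sT1) => x [].
  - by move=> s /inT[_ sT]; apply: aeW => x; exact: wD.
move=> t /andP[t0 tT1]; have [tt|tt] := ltP t tau; first by apply: eq_tau; rewrite t0.
have t20 : 0 < tau / 2 by rewrite divr_gt0.
apply: (step (tau / 2) t (2 * (K * (tau / 2) `^ (- b)))).
- exact: ltW.
- by rewrite tT1 andbT; apply: lt_le_trans tt; rewrite ltr_pdivrMr// ltr_pMr// ltr1n.
- by rewrite (negPf qoo).
- by rewrite mulr_ge0// mulr_ge0// powR_ge0.
- by move=> s x /andP[as_ sT]; apply: w_le => //; exact: ltW.
- move=> s /andP[s0 st]; apply: eq_tau; rewrite s0/=; apply: (lt_trans st).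
  by rewrite ltr_pdivrMr// ltr_pMr// ltr1n.
Qed.

(** The Picard solution is controlled on (0, T) only, so the initial value has to be put in
    separately. *)
Definition extension (t : R) : RN R N -> R := if 0 < t then w t else u0.

Let heat_bound t : 0 < t -> exists2 h : RN R N -> R, h \in Lfun lebN q &
  forall x, E u0 t x = (h x)%:E /\ 0 <= h x.
Proof.
move=> t0; pose h x := fine (E u0 t x).
have e0 x : (0 <= E u0 t x)%E by apply: (heatE_ge0 KG) => y; rewrite lee_fin.
have hE x : E u0 t x = (h x)%:E.
  by rewrite /h fineK// ge0_fin_numE// (le_lt_trans (EK _ t0))// ltry.
exists h; last by move=> x; rewrite hE fine_ge0.
apply/LfunP_bound; split.
  apply/measurable_EFinP; rewrite (_ : EFin \o h = E u0 t); last by apply/funext => x; rewrite hE.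
  apply: (measurable_heatE KG); last by move=> y; rewrite lee_fin.
  by apply/measurable_EFinP; exact: measurableT_comp.
rewrite (_ : EFin \o h = E u0 t); last by apply/funext => x; rewrite hE.
apply: (le_lt_trans (Lnorm_heatE KG (@heat_kernelC R N) t0 q1 mu0)).
by case/LfunP_bound: u0q.
Qed.

Let q0 : (0 < q)%E. Proof. exact: lt_trans q1. Qed.

Let q_ge1 : (1 <= q)%E. Proof. exact: ltW. Qed.

Let wq t : 0 < t < T -> Lq q (w t).
Proof.
move=> tT; have /andP[t0 _] := tT; have [h hq hE] := heat_bound t0.
have mwt : measurable_fun setT (w t) by exact: rmeasurable_slice.
apply/LfunP_bound; split => //.
have /LfunP_bound[m2 n2] := Lfun_cmul 2 q_ge1 hq.
apply: le_lt_trans n2; apply: Lnorm_le => //.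
- exact/measurable_EFinP.
- exact/measurable_EFinP.
- apply: aeW => x /=; have [hx h0] := hE x.
  by have := wE x tT; rewrite hx -EFinM [`|2 * _|]ger0_norm ?mulr_ge0.
Qed.

(** The pointwise modulus of continuity is relative to E(4 t0), a function in L^q; n + 1 replaces
    its norm n to allow n = 0. *)
Let w_continuous t0 e : 0 < t0 < T -> 0 < e ->
  exists2 r, 0 < r & forall t, `|t - t0| < r -> 0 < t < T /\ (Lqnorm q (w t \- w t0)%R <= e%:E)%E.
Proof.
move=> t0T e0; have /andP[t00 _] := t0T.
have [|h hq hE] := @heat_bound (4 * t0); first by rewrite mulr_gt0.
have /LfunP_bound[mh nh] := hq.
have nfin : 'N[lebN]_q[EFin \o h]%E \is a fin_num by rewrite ge0_fin_numE// Lnorm_ge0.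
pose n := fine 'N[lebN]_q[EFin \o h]%E.
have n0 : 0 <= n by rewrite fine_ge0// Lnorm_ge0.
have [cL cL0 time_lip] := @heat_kernel_time_lipschitz R N.
have n1 : 0 < n + 1 by rewrite ltr_wpDl.
have e1 : 0 < e / (n + 1) by rewrite divr_gt0.
have pw0 : (0 : R) <= N%:R / 2 by rewrite divr_ge0.
have [r r0 Hr] := solution_time_modulus KG alpha0 m1 mu0 K0 b0 ab1 T0 EK kT pw0
  (@heat_kernel_le_time R N) cL0 time_lip mw wE wD t0T e1.
exists r => // t tr; have [tT _] := Hr t [tuple 0 | i < N] tr; split => //.
apply: (@le_trans _ _ 'N[lebN]_q[EFin \o (fun x => e / (n + 1) * h x)%R]%E).
  have mwt s : measurable_fun setT (w s) by exact: rmeasurable_slice.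
  apply: Lnorm_le => //.
  - by apply/measurable_EFinP; exact: measurable_funB.
  - by apply/measurable_EFinP; exact: measurable_funM.
  - apply: aeW => x /=; have [hx h0] := hE x; have [_] := Hr t x tr.
    by rewrite hx -EFinM [`|_ * h x|]ger0_norm// mulr_ge0// ltW.
rewrite (Lnorm_cmul _ q_ge1 hq) -(fineK nfin) -EFinM lee_fin -/n ger0_norm ?(ltW e1)//.
by rewrite mulrAC ler_pdivrMr// ler_wpM2l ?(ltW e0)// lerDl.
Qed.

(** The solution [u] is what gives continuity at t = 0 when q < oo: on (0, T1) it agrees with [w],
    so its convergence to u0 in L^q is that of [w]. Continuity at positive times is [w_continuous],
    and the local bounds come from the decay of E. *)
Lemma extension_solution (u : R -> RN R N -> R) (T1 : R) : T1 < T -> solution alpha q u0 T1%:E u ->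
  solution alpha q u0 T%:E extension.
Proof.
move=> T1T usol; have T10 : 0 < T1 by case: usol; rewrite lte_fin.
have extw t : 0 < t -> extension t = w t by rewrite /extension => ->.
have ext0 : extension 0 = u0 by rewrite /extension ltxx.
split; [by rewrite lte_fin| |by rewrite ext0; exact: ae_eq_refl|].
- split.
  + have mD : measurable ((time_oo T%:E : set Rm) `*` [set: RN R N]).
      apply: measurableX => //; rewrite (_ : time_oo _ = `]0, T[%classic); first exact: measurable_itv.
      by apply/seteqP; split => t; rewrite /time_oo/= in_itv/= lte_fin => /andP.
    apply: (eq_measurable_fun (fun z : Rm * RN R N => w z.1 z.2)); last exact: measurable_funTS.
    by move=> [t x]; rewrite inE/= => -[[t0 _] _]; rewrite extw.
  + split.
      move=> t tJ; have [t0|t0] := ltP 0 t.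
        by rewrite extw//; apply: wq; move: tJ; case: ifP => _ []; rewrite lte_fin t0.
      have -> : t = 0 by apply/eqP; rewrite eq_le t0; move: tJ; case: ifP => _ []// /ltW.
      by rewrite ext0.
    move=> t0 t0J.
    have D0 t : (0 <= Lqnorm q (extension t \- extension t0)%R)%E by exact: Lnorm_ge0.
    apply: (@cvge0P _ _ _ (within_filter _ (nbhs_filter _)) _ D0).2 => e e0.
    rewrite near_withinE; have [t00|t00] := ltP 0 t0.
      have t0T : 0 < t0 < T by move: t0J; case: ifP => _ []; rewrite lte_fin t00.
      have [r r0 Hr] := w_continuous t0T e0.
      apply/(nbhs_ballP (t0 : R^o)); exists r => // t /= tr _.
      have tr' : `|t - t0| < r by move: tr; rewrite /ball/= distrC.
      by have [/andP[t_gt0 _] h] := Hr t tr'; rewrite !extw.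
    have [qoo|qoo] := eqVneq q +oo%E.
      by move: t0J; rewrite qoo eqxx => -[]; rewrite ltNge t00.
    have t0E : t0 = 0 by apply/eqP; rewrite eq_le t00; move: t0J; rewrite (negPf qoo) => -[].
    rewrite t0E ext0; have [e1 e10 He1] := solution_Lq_small q1 qoo u0q usol e0.
    apply/(nbhs_ballP (0 : R^o)); exists (Num.min e1 T1); first by rewrite /= lt_min e10.
    move=> t; rewrite /ball/= sub0r normrN => tr tJ.
    have t_ge0 : 0 <= t by case: tJ.
    move: tr; rewrite ger0_norm// lt_min => /andP[te tT1].
    have [t_gt0|t_le0] := ltP 0 t; last first.
      have -> : t = 0 by apply/eqP; rewrite eq_le t_le0.
      rewrite ext0 (_ : u0 \- u0 = cst 0)%R; last by apply/funext => x /=; rewrite subrr.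
      by rewrite /Lqnorm (_ : EFin \o _ = cst 0%E)// Lnorm0 ?gt_eqF// lee_fin ltW.
    have tT1' : 0 < t < T1 by rewrite t_gt0.
    rewrite extw//; apply: le_trans (He1 t _ tT1); last by rewrite t_ge0.
    have mwt : measurable_fun setT (w t) by exact: rmeasurable_slice.
    have mut : measurable_fun setT (u t).
      by rewrite -(time_restrictionE u tT1'); apply: rmeasurable_slice; exact: restricted_measurable usol.
    apply: Lnorm_le => //.
    * by apply/measurable_EFinP; exact: measurable_funB.
    * by apply/measurable_EFinP; exact: measurable_funB.
    * apply: ae_imply (restricted_eq_picard T1T usol tT1') => x /=.
      by rewrite time_restrictionE// => ->.
  + move=> a c sub; have [ca|ac] := ltP c a.
      exists 0; apply: aeW => s /andP[as_ sc].
      by move: (lt_le_trans ca (le_trans as_ sc)); rewrite ltxx.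
    have inJ s : a <= s <= c -> (if q == +oo%E then time_co T%:E else time_oo T%:E) s.
      by move=> sac; apply: sub; rewrite /= in_itv.
    have [qoo|qoo] := eqVneq q +oo%E.
      exists (2 * fine (Lqnorm +oo u0)); apply: aeW => s /inJ; rewrite qoo eqxx => -[s0].
      have n0 : 0 <= fine (Lqnorm +oo u0) by rewrite fine_ge0// Lnorm_ge0.
      rewrite lte_fin => sT; apply: Lnormy_le; first by rewrite lee_fin mulr_ge0.
      have [s_gt0|s_le0] := ltP 0 s.
        by apply: aeW => x; rewrite extw//= lee_fin; apply: w_ley; rewrite ?s_gt0.
      have -> : s = 0 by apply/eqP; rewrite eq_le s_le0.
      rewrite ext0; apply: ae_imply (Lnormy_ge lebN (EFin \o u0)) => x /le_trans; apply.
      have n0fin : Lqnorm +oo u0 \is a fin_num.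
        by rewrite ge0_fin_numE ?Lnorm_ge0//; move: u0q; rewrite qoo => /LfunP_bound[].
      by rewrite -/(Lqnorm +oo u0) -[leLHS](fineK n0fin) lee_fin ler_peMl// ler1n.
    exists (2 * (K * a `^ (- b))); apply: aeW => s sac.
    have [a0 _] : time_oo T%:E a by move: (inJ a); rewrite lexx ac (negPf qoo); exact.
    have [s0] : time_oo T%:E s by move: (inJ s sac); rewrite (negPf qoo).
    rewrite lte_fin => sT; apply: Lnormy_le.
      by rewrite lee_fin !mulr_ge0 ?powR_ge0.
    by apply: aeW => x; rewrite extw//= lee_fin; apply: w_le => //; case/andP: sac.
- move=> t [t0]; rewrite lte_fin => tT; apply: aeW => x; rewrite extw//.
  apply/(duhamel_pointP u0 x (w t x) mw (u := extension) (t := t)).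
    by move=> s /andP[s0 _]; rewrite extw.
  by apply: w_duhamel; rewrite t0.
Qed.

End extension.

Lemma existence_time_ge q (u0 : RN R N -> R) (m K b T : R) (Tmax : \bar R) : (1 < q)%E ->
  ((N%:R * alpha / 2)%:E < q)%E -> Lq q u0 -> 1 <= m ->
  (forall r r' M : R, `|r| <= M -> `|r'| <= M ->
    `|powabs alpha r - powabs alpha r'| <= m * M `^ alpha * `|r - r'|) ->
  0 <= K -> 0 <= b -> alpha * b < 1 -> 0 < T ->
  (forall t x, 0 < t -> (E u0 t x <= (K * t `^ (- b))%:E)%E) ->
  m * (2 * K) `^ alpha * (T `^ (1 - alpha * b) / (1 - alpha * b)) <= 4^-1 ->
  existence_time alpha q u0 Tmax -> (T%:E <= Tmax)%E.
Proof.
move=> q1 qc u0q m1 lip K0 b0 ab1 T0 EK kT [u [usol umax]].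
rewrite leNgt; apply/negP => TT.
have Tmax0 : (0 < Tmax)%E by case: usol.
case: Tmax => [T1| |] in usol umax TT Tmax0 *; last 2 first.
- by move: TT; rewrite ltNge leey.
- by move: Tmax0; rewrite ltNge leNye.
rewrite lte_fin in TT.
have mu0 : measurable_fun setT u0 by case/LfunP_bound: u0q.
have [w [mw wE wD]] := picard_solution KG alpha0 m1 lip mu0 K0 b0 ab1 T0 EK kT.
have wsol := extension_solution q1 qc u0q m1 lip K0 b0 ab1 T0 EK kT mw wE wD TT usol.
have := umax _ _ wsol; rewrite lee_fin leNgt TT => /(_ _)/wrap[]// t [t0].
rewrite lte_fin => tT1; have [t_gt0|t_le0] := ltP 0 t.
  have tT : 0 < t < T1 by rewrite t_gt0.
  have h := restricted_eq_picard q1 qc u0q m1 lip K0 b0 ab1 T0 EK kT mw wE wD TT usol tT.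
  apply: ae_imply h => x; rewrite time_restrictionE// => -> _.
  by rewrite /extension t_gt0.
have -> : t = 0 by apply/eqP; rewrite eq_le t_le0.
rewrite /extension ltxx; case: usol => _ _ h _.
by apply: ae_imply h => x h' /h' ->.
Qed.

(** The two regimes of the minimum. For gamma < N the condition 1/q + gamma/N < 1 says N/q + gamma <
    N, and the weighted estimate applies; for gamma > N the minimum is N, and the datum is in L^1,
    where the kernel is bounded by its value on the diagonal. *)
Lemma heatE_data_norm_le q (gamma : R) : (1 < q)%E -> 0 < gamma -> gamma != N%:R ->
  (gamma < N%:R -> recip q + gamma / N%:R < 1) ->
  exists2 C : R, 0 < C & forall phi, Lq q phi -> Lqw gamma q phi ->
    0 <= data_norm gamma q phi /\ forall t x, 0 < t ->
      (E phi t x <= (C * data_norm gamma q phi *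
        t `^ (- (2^-1 * Num.min (N%:R * recip q + gamma) N%:R)))%:E)%E.
Proof.
move=> q1 g0 gN hg; have N0R : 0 < N%:R :> R by rewrite ltr0n.
have p40 : 0 < 4 * pi :> R by rewrite mulr_gt0// pi_gt0.
have [gltN|Nleg] := ltP gamma N%:R.
  have rg := hg gltN; have [C C0 HC] := heatE_weight_le N0 q1 (ltW g0) rg.
  exists C => // phi phiq [mphi wq].
  have /LfunP_bound[_ n1oo] := phiq; have /LfunP_bound[_ n2oo] := wq.
  have n1 : Lqnorm q phi \is a fin_num by rewrite ge0_fin_numE// Lnorm_ge0.
  have n2 : Lqwnorm gamma q phi \is a fin_num by rewrite ge0_fin_numE// Lnorm_ge0.
  rewrite /data_norm gltN fineD//.
  have f1 : 0 <= fine (Lqnorm q phi) by rewrite fine_ge0// Lnorm_ge0.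
  have f2 : 0 <= fine (Lqwnorm gamma q phi) by rewrite fine_ge0// Lnorm_ge0.
  split; first exact: addr_ge0.
  move=> t x t0; apply: (le_trans (HC t x phi t0 mphi)).
  rewrite -(fineK n2) -EFinM lee_fin mulrAC min_l; last first.
    have : (recip q + gamma / N%:R) * N%:R <= 1 * N%:R by rewrite ler_wpM2r// ltW.
    by rewrite mulrDl divfK ?gt_eqF// mul1r [recip q * _]mulrC.
  rewrite (mulrC 2^-1) ler_wpM2r ?powR_ge0// ler_wpM2l ?(ltW C0)// lerDr//.
have Nltg : N%:R < gamma by rewrite lt_neqAle eq_sym gN.
exists ((4 * pi) `^ (- (N%:R / 2))); first exact: powR_gt0.
move=> phi phiq wq; have [mphi _] := wq.
have /LfunP_bound[_ n1oo] := Lfun1_weight N0 q1 Nltg phiq wq.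
have n1 : Lqnorm 1 phi \is a fin_num by rewrite ge0_fin_numE// Lnorm_ge0.
rewrite /data_norm ltNge Nleg/=.
have f1 : 0 <= fine (Lqnorm 1 phi) by rewrite fine_ge0// Lnorm_ge0.
split => // t x t0; apply: (le_trans (heatE_l1_le x t0 mphi)).
rewrite -(fineK n1) -EFinM lee_fin min_r; last first.
  by apply: (le_trans Nleg); rewrite lerDr mulr_ge0// recip_ge0.
by rewrite (mulrC 2^-1) powRM ?(ltW p40) ?(ltW t0)// mulrAC.
Qed.

End heat_equation.

Theorem corollary1p4 (R : realType) (N : nat) (alpha gamma : R) (q : \bar R)
    (N_ge1 : (1 <= N)%N) (alpha_gt0 : 0 < alpha) (gamma_gt0 : 0 < gamma)
    (gamma_neqN : gamma != N%:R)
    (min_lt1 : Num.min (N%:R * alpha / 2) (gamma * alpha / 2) < 1)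
    (q_gt1 : (1 < q)%E) (q_gt_qc : ((N%:R * alpha / 2)%:E < q)%E)
    (gamma_small : gamma < N%:R ->
      recip q + gamma / N%:R < 1 /\
      N%:R * alpha / 2 * recip q + alpha * gamma / 2 < 1) :
  exists C : R -> R, (forall r, 0 < C r) /\
    forall phi : RN R N -> R, Lq q phi -> Lqw gamma q phi ->
    forall lambda : R, 0 < lambda <= 1 ->
    forall Tmax : \bar R,
      existence_time alpha q (fun x => lambda * phi x) Tmax ->
      ((C (data_norm gamma q phi) *
        lambda `^ (- (alpha^-1 -
          2^-1 * Num.min (N%:R * recip q + gamma) N%:R)^-1))%:E <= Tmax)%E.

(* The lower bound and its constant *)
Proof.
have N0 : (0 < N)%N by [].
have N0R : 0 < N%:R :> R by rewrite ltr0n.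
have [m m1 lip] := powabs_lipschitz alpha_gt0.
have [C1 C10 HC1] := heatE_data_norm_le N0 q_gt1 gamma_gt0 gamma_neqN (fun h => proj1 (gamma_small h)).
set mn := Num.min _ _ in HC1 *; pose b := 2^-1 * mn.
have rq := recip_ge0 q_gt1.
have b0 : 0 <= b.
  by rewrite mulr_ge0// le_min !ler0n ?andbT addr_ge0 ?mulr_ge0// ltW.
(* For gamma < N this is the second condition of [gamma_small]; for gamma > N the minimum in
   [min_lt1] is N alpha / 2, which bounds alpha b. *)
have ab1 : alpha * b < 1.
  have [gN|Ng] := ltP gamma N%:R.
    have [_ h] := gamma_small gN; apply: le_lt_trans h.
    have -> : N%:R * alpha / 2 * recip q + alpha * gamma / 2 =
        alpha * (2^-1 * (N%:R * recip q + gamma)) by ring.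
    by rewrite ler_wpM2l ?(ltW alpha_gt0)// ler_wpM2l// ge_min lexx.
  apply: (@le_lt_trans _ _ (N%:R * alpha / 2)).
    rewrite (_ : _ / 2 = alpha * (2^-1 * N%:R)); last by ring.
    by rewrite ler_wpM2l ?(ltW alpha_gt0)// ler_wpM2l// ge_min lexx orbT.
  by move: min_lt1; rewrite min_l// ler_pM2r ?invr_gt0// ler_pM2r.
pose s := 1 - alpha * b; have s0 : 0 < s by rewrite subr_gt0.
(* Solving m (2 lambda C1 D)^alpha T^s / s = 1/4 for T^s gives s / (4 m (2 C1 D)^alpha) times
   lambda^(-alpha). With 1 + |r| in place of D the constant is also meaningful for zero data, at the
   price of an inequality. *)
pose A (r : R) := s / (4 * m * 2 `^ alpha * (C1 * (1 + `|r|)) `^ alpha).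
have m0 : 0 < m by exact: lt_le_trans m1.
have A0 r : 0 < A r.
  have B0 : 0 < C1 * (1 + `|r|) by rewrite mulr_gt0// ltr_wpDr.
  by rewrite divr_gt0// mulr_gt0 ?powR_gt0// mulr_gt0 ?powR_gt0// mulr_gt0.
exists (fun r => A r `^ s^-1); split=> [r|phi phiq wq lambda /andP[l0 l1] Tmax]; first exact: powR_gt0.
have [D0 HD] := HC1 phi phiq wq; set D := data_norm gamma q phi in D0 HD *.
have q_ge1 := ltW q_gt1.
(* From 1/alpha - b = s / alpha: the power of lambda in the statement is the s-th root of
   lambda^(-alpha). *)
have eqe : (alpha^-1 - 2^-1 * mn)^-1 = alpha / s.
  by rewrite /s /b -/b; field; rewrite /= ?(gt_eqF alpha_gt0) ?gt_eqF.
apply: (existence_time_ge N0 alpha_gt0 (m := m) (K := lambda * (C1 * D)) (b := b)) => //.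
- exact: Lfun_cmul.
- by rewrite !mulr_ge0// ltW.
- by rewrite mulr_gt0 ?powR_gt0.
- move=> t x t0; have /LfunP_bound[mphi _] := phiq.
  rewrite (_ : (fun y => _) = (fun y => lambda%:E * `|phi y|%:E)%E); last first.
    by apply/funext => y; rewrite normrM (ger0_norm (ltW l0)).
  rewrite (heatEZ (heat_semigroup_kernel N)) ?(ltW l0)//; last first.
    by apply/measurable_EFinP; exact: measurableT_comp.
  by rewrite -[_ * _ * t `^ _]mulrA EFinM; apply: lee_wpmul2l; [rewrite lee_fin ltW|exact: HD].
- rewrite eqe -/s; have -> : (A D `^ s^-1 * lambda `^ (- (alpha / s))) `^ s = A D * lambda `^ (- alpha).
    rewrite powRM ?powR_ge0// -!powRrM mulVf ?gt_eqF// powRr1 ?(ltW (A0 D))//.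
    by rewrite mulNr divfK ?gt_eqF.
  have B0 : 0 < (C1 * (1 + `|D|)) `^ alpha by rewrite powR_gt0// mulr_gt0// ltr_wpDr.
  have DB : (C1 * D) `^ alpha <= (C1 * (1 + `|D|)) `^ alpha.
    apply: ge0_ler_powR; rewrite ?nnegrE ?(ltW alpha_gt0) ?mulr_ge0 ?(ltW C10)// ?addr_ge0//.
    by rewrite ler_wpM2l ?(ltW C10)// ger0_norm// lerDr.
  have la : 0 < lambda `^ alpha by exact: powR_gt0.
  have t2 : 0 < 2 `^ alpha :> R by exact: powR_gt0.
  rewrite !powRM ?mulr_ge0 ?(ltW l0) ?(ltW C10)// -(powRM _ (ltW C10) D0) powRN /A.
  move: DB B0 la t2; set B := (C1 * (1 + _)) `^ _; set B' := (C1 * D) `^ _.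
  move: (lambda `^ alpha) (2 `^ alpha) => L P DB B0 la t2.
  have -> : m * (P * (L * B')) * (s / (4 * m * P * B) / L / s) = 4^-1 * (B' / B).
    by field; rewrite ?gt_eqF.
  by rewrite ler_piMr ?invr_ge0// ler_pdivrMr// mul1r.
Qed.
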